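(* Let $\alpha>1$ and let $\boldsymbol{\gamma}=(\gamma_j)_{j\ge1}$ be a sequence of weights with $1\ge\gamma_1\ge\gamma_2\ge\cdots>0$. Put $s_{\boldsymbol{\gamma}}:=\inf\{\kappa>0:\sum_{j=1}^\infty\gamma_j^\kappa<\infty\}$ (with $\inf\emptyset:=\infty$). Consider multivariate integration $\mathrm{INT}=(\mathrm{INT}_s)_{s\ge1}$ for the weighted Hermite spaces $\mathcal{H}_R$, where $R$ is any one of $r_{s,\alpha,\boldsymbol{\gamma}},\ \rho_{s,\alpha,\boldsymbol{\gamma}},\ \psi_{s,\alpha,\boldsymbol{\gamma}}$ (with $\alpha\in\mathbb{N}$ in the case of $\psi_{s,\alpha,\boldsymbol{\gamma}}$), $s\in\mathbb{N}$. Then the following sufficient conditions hold: 1. SPT holds if $\sum_{j=1}^\infty\gamma_j<\infty$ (which is equivalent to $s_{\boldsymbol{\gamma}}\le1$). In this case the exponent of SPT satisfies $\tau^*(\Lambda^{\mathrm{std}})\le2\max\left(\frac1\alpha,s_{\boldsymbol{\gamma}}\right)$. 2. PT holds if $\limsup_{s\to\infty}\frac1{\ln s}\sum_{j=1}^s\gamma_j<\infty$. 3. WT holds if $\lim_{s\to\infty}\frac1s\sum_{j=1}^s\gamma_j=0$. 4. For $\sigma\in(0,1]$, $(\sigma,\tau)$-WT holds if $\lim_{s\to\infty}\frac1{s^\sigma}\sum_{j=1}^s\gamma_j=0$. 5. UWT holds if $\lim_{s\to\infty}\frac1{s^\sigma}\sum_{j=1}^s\gamma_j=0$ for all $\sig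ma\in(0,1]$.
   Context: Hermite polynomials: for $k\in\mathbb{N}_0$, $H_k(x)=\frac{(-1)^k}{\sqrt{k!}}e^{x^2/2}\frac{d^k}{dx^k}e^{-x^2/2}$; for $\boldsymbol{k}\in\mathbb{N}_0^s$, $H_{\boldsymbol{k}}(\boldsymbol{x})=\prod_{j=1}^sH_{k_j}(x_j)$. Let $\varphi(x)=\frac1{\sqrt{2\pi}}e^{-x^2/2}$, $\varphi_s(\boldsymbol{x})=\prod_{j=1}^s\varphi(x_j)$. The $H_{\boldsymbol{k}}$ form an orthonormal basis of $L_2(\mathbb{R}^s,\varphi_s)$ (all functions real-valued); $\widehat f(\boldsymbol{k})=\int_{\mathbb{R}^s}fH_{\boldsymbol{k}}\varphi_s\,d\boldsymbol{x}$. For $R:\mathbb{N}_0^s\to(0,\infty)$ (such that the kernel series converges absolutely), $\mathcal{H}_R$ is the reproducing kernel Hilbert space on $\mathbb{R}^s$ with kernel $K_R(\boldsymbol{x},\boldsymbol{y})=\sum_{\boldsymbol{k}\in\mathbb{N}_0^s}R(\boldsymbol{k})H_{\boldsymbol{k}}(\boldsymbol{x})H_{\boldsymbol{k}}(\boldsymbol{y})$ and inner product $\langle f,g\rangle_R=\sum_{\boldsymbol{k}}\frac1{R(\boldsymbol{k})}\widehat f(\boldsymbol{k})\widehat g(\boldsymbol{k})$, with norm $\|f\|_R=\langle f,f\rangle_R^{1/2}$. Fourier weights, for $\gamma\in(0,1]$: (r) $r_{\alpha,\gamma}(0)=1$, $r_{\alpha,\gamma}(k)=\gamma\frac1{k!}$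 for $1\le k<\alpha$, $r_{\alpha,\gamma}(k)=\gamma\frac{(k-\alpha)!}{k!}$ for $k\ge\alpha$, where $(k-\alpha)!$ means $\Gamma(k-\alpha+1)$ if $\alpha$ is not an integer; ($\rho$) $\rho_{\alpha,\gamma}(0)=1$, $\rho_{\alpha,\gamma}(k)=\gamma k^{-\alpha}$ for $k\ge1$; ($\psi$, for $\alpha\in\mathbb{N}$) $\psi_{\alpha,\gamma}(k)=\left(1+\frac1\gamma\sum_{\tau=1}^{\alpha}\beta_\tau(k)\right)^{-1}$ with $\beta_\tau(k)=\frac{k!}{(k-\tau)!}$ if $k\ge\tau$ and $\beta_\tau(k)=0$ otherwise. In each case the $s$-dimensional weight is the product, e.g. $r_{s,\alpha,\boldsymbol{\gamma}}(\boldsymbol{k})=\prod_{j=1}^sr_{\alpha,\gamma_j}(k_j)$, and likewise $\rho_{s,\alpha,\boldsymbol{\gamma}}$, $\psi_{s,\alpha,\boldsymbol{\gamma}}$. Integration: $\mathrm{INT}_s:\mathcal{H}_R\to\mathbb{R}$, $\mathrm{INT}_s(f)=\int_{\mathbb{R}^s}f(\boldsymbol{x})\varphi_s(\boldsymbol{x})\,d\boldsymbol{x}$. Algorithms have the form $A_n(f)=\sum_{i=1}^nw_if(\boldsymbol{x}_i)$ with $\boldsymbol{x}_i\in\mathbb{R}^s$, $w_i\in\mathbb{R}$ (i.e. only standard information $\Lambda^{\mathrm{std}}$, function evaluations, is used). The worst-case error is $\sup_{\|f\|_R\le1}|\mathrm{INT}_s(f)-A_n(f)|$, $e(n,\mathrm{INT}_s)$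 is its infimum over all such $A_n$ (for $n=0$ only the zero algorithm, with error $1$), and $n(\varepsilon,s):=\min\{n\in\mathbb{N}_0:e(n,\mathrm{INT}_s)\le\varepsilon\}$ for $\varepsilon\in(0,1)$, $s\in\mathbb{N}$. Tractability notions ($\log=\ln$): PT (polynomial tractability): there are $\tau,\sigma,C\ge0$ with $n(\varepsilon,s)\le C\varepsilon^{-\tau}s^\sigma$ for all $s\in\mathbb{N},\varepsilon\in(0,1)$. SPT (strong polynomial tractability): there are $\tau,C\ge0$ with $n(\varepsilon,s)\le C\varepsilon^{-\tau}$ for all $s\in\mathbb{N},\varepsilon\in(0,1)$; the exponent of SPT, here denoted $\tau^*(\Lambda^{\mathrm{std}})$, is the infimum of all $\tau$ for which such a $C>0$ exists. $(\sigma,\tau)$-WT (for given $\sigma,\tau>0$): $\lim_{s+\varepsilon^{-1}\to\infty}\frac{\log n(\varepsilon,s)}{s^\sigma+\varepsilon^{-\tau}}=0$. WT (weak tractability): $\lim_{s+\varepsilon^{-1}\to\infty}\frac{\log n(\varepsilon,s)}{s+\varepsilon^{-1}}=0$. UWT (uniform weak tractability): $(\sigma,\tau)$-WT for all $\sigma,\tau\in(0,1]$.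
   Formalization: The parenthetical equivalence of Σγ_j<∞ with s_γ≤1 is false (γ_j=1/j has s_γ=1 but a divergent sum); it is replaced by the two true implications Σγ_j<∞ ⇒ s_γ≤1 and s_γ<1 ⇒ Σγ_j<∞. *)

(* Defs.v *)
From HB Require Import structures.
From mathcomp Require Import all_boot all_order all_algebra.
From mathcomp Require Import all_classical all_reals all_analysis.

Set Implicit Arguments.
Unset Strict Implicit.
Unset Printing Implicit Defensive.

Import Order.TTheory GRing.Theory Num.Theory.
Import numFieldNormedType.Exports.

Local Open Scope classical_set_scope.
Local Open Scope ring_scope.

(* The library has the product sigma-algebra on n-tuples but no n-fold
   product measure; Lebesgue measure on R^s is built by recursion on s, the
   Lebesgue measure on R^0 being the unit mass at the empty tuple. *)
Section lebesgue_step.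
Context {R : realType} (s : nat).
Local Notation RR := (measurableTypeR R).
Variable mu : {sigma_finite_measure set (s.-tuple RR) -> \bar R}.

Definition tuple_cons (p : RR * s.-tuple RR) : s.+1.-tuple RR :=
  [the s.+1.-tuple RR of p.1 :: p.2].

Definition lebesgue_step : set (s.+1.-tuple RR) -> \bar R :=
  pushforward (@lebesgue_measure R \x mu)%E tuple_cons.

Let measurable_tuple_cons : measurable_fun setT tuple_cons.
Proof. exact: (measurable_cons measurable_fst measurable_snd). Qed.

Let lebesgue_step0 : lebesgue_step set0 = 0%E.
Proof. exact: measure0. Qed.

Let lebesgue_step_ge0 A : (0 <= lebesgue_step A)%E.
Proof. exact: measure_ge0. Qed.

Let lebesgue_step_sigma_additive : semi_sigma_additive lebesgue_step.
Proof. exact: measure_semi_sigma_additive. Qed.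

HB.instance Definition _ := isMeasure.Build _ _ _ lebesgue_step
  lebesgue_step0 lebesgue_step_ge0 lebesgue_step_sigma_additive.

Let lebesgue_step_sigma_finite : sigma_finite setT lebesgue_step.
Proof.
have /sigma_finiteP[F [TF ndF Foo]] := sigma_finiteT (@lebesgue_measure R).
have /sigma_finiteP[G [TG ndG Goo]] := sigma_finiteT mu.
pose tuple_uncons (t : s.+1.-tuple RR) : RR * s.-tuple RR :=
  (thead t, [tuple tnth t (lift ord0 i) | i < s]).
have uncons_cons p : tuple_uncons (tuple_cons p) = p.
  case: p => x t; congr (_, _) => /=.
  by apply: eq_from_tnth => i; rewrite tnth_mktuple tnthS.
have muncons : measurable_fun setT tuple_uncons.
  apply/measurable_fun_pairP; split; first exact: measurable_tnth.
  apply/measurable_fun_tnthP => i.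
  rewrite (_ : _ \o _ = fun t => tnth t (lift ord0 i)).
    exact: measurable_tnth.
  by apply/funext => t /=; rewrite tnth_mktuple.
exists (fun n => tuple_uncons @^-1` (F n `*` G n)).
  apply/seteqP; split=> // t _.
  have [n _ Fn] : (\bigcup_i F i) (tuple_uncons t).1 by rewrite -TF.
  have [m _ Gm] : (\bigcup_i G i) (tuple_uncons t).2 by rewrite -TG.
  exists (maxn n m) => //; split.
    by move: Fn; exact/subsetPset/ndF/leq_maxl.
  by move: Gm; exact/subsetPset/ndG/leq_maxr.
move=> n; have [mF oF] := Foo n; have [mG oG] := Goo n; split.
  by rewrite -[X in measurable X]setTI; apply: muncons => //; exact: measurableX.
rewrite /lebesgue_step /pushforward (_ : _ @^-1` _ = F n `*` G n).
  by rewrite product_measure1E// lte_mul_pinfty// ge0_fin_numE.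
by rewrite -comp_preimage (_ : _ \o _ = idfun)//; exact/funext.
Qed.

HB.instance Definition _ := Measure_isSigmaFinite.Build _ _ _ lebesgue_step
  lebesgue_step_sigma_finite.
End lebesgue_step.

Fixpoint lebesgue_tuple {R : realType} (s : nat) :
    {sigma_finite_measure set (s.-tuple (measurableTypeR R)) -> \bar R} :=
  match s with
  | 0 => \d_([tuple] : 0.-tuple (measurableTypeR R))
  | s'.+1 => lebesgue_step (lebesgue_tuple s')
  end.

Section hermite.
Context {R : realType}.
Implicit Type s : nat.

Definition hermite (k : nat) (x : R) : R :=
  (-1) ^+ k / Num.sqrt k`!%:R * expR (x ^+ 2 / 2)
  * derive1n k (fun t : R => expR (- (t ^+ 2) / 2)) x.

Definition hermite_prod s (k : s.-tuple nat) (x : s.-tuple R) : R :=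
  \prod_(j < s) hermite (tnth k j) (tnth x j).

Definition gauss_density (x : R) : R :=
  (Num.sqrt (2 * pi))^-1 * expR (- (x ^+ 2) / 2).

Definition gauss_density_prod s (x : s.-tuple R) : R :=
  \prod_(j < s) gauss_density (tnth x j).

Definition INT s (f : s.-tuple R -> R) : R :=
  \int[lebesgue_tuple s]_x (f x * gauss_density_prod x).

Definition fourier_coef s (f : s.-tuple R -> R) (k : s.-tuple nat) : R :=
  \int[lebesgue_tuple s]_x (f x * hermite_prod k x * gauss_density_prod x).

(* The sum of an absolutely convergent real family; [\esum] is the library's
   sum of a nonnegative family. *)
Definition abs_sum (I : choiceType) (a : I -> R) : R :=
  fine (\esum_(i in setT) (Num.max (a i) 0)%:E
        - \esum_(i in setT) (Num.max (- a i) 0)%:E)%E.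

Definition hermite_kernel s (W : s.-tuple nat -> R) (x y : s.-tuple R) : R :=
  abs_sum (fun k => W k * hermite_prod k x * hermite_prod k y).

Definition hermite_inner s (W : s.-tuple nat -> R) (f h : s.-tuple R -> R) : R :=
  abs_sum (fun k => (W k)^-1 * fourier_coef f k * fourier_coef h k).

(* [H], a set of honest (pointwise defined) functions on [X], is a real Hilbert
   space for the inner product [ip], and has reproducing kernel [K]; [ip] is
   only constrained on [H]. By Moore-Aronszajn [K] determines [H]. *)
Record is_rkhs (X : Type) (K : X -> X -> R) (ip : (X -> R) -> (X -> R) -> R)
    (H : set (X -> R)) : Prop := IsRKHS {
  rkhs0 : H (cst 0);
  rkhs_lin : forall a f h, H f -> H h -> H (fun x => a * f x + h x);
  rkhs_ipC : forall f h, H f -> H h -> ip f h = ip h f;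
  rkhs_ip_lin : forall a f f' h, H f -> H f' -> H h ->
    ip (fun x => a * f x + f' x) h = a * ip f h + ip f' h;
  rkhs_ip_ge0 : forall f, H f -> 0 <= ip f f;
  rkhs_ip_eq0 : forall f, H f -> ip f f = 0 -> f = cst 0;
  rkhs_complete : forall u : nat -> X -> R, (forall n, H (u n)) ->
    (forall e, 0 < e -> exists N, forall m n, (N <= m)%N -> (N <= n)%N ->
       Num.sqrt (ip (u m \- u n) (u m \- u n)) < e) ->
    exists2 f, H f & Num.sqrt (ip (u n \- f) (u n \- f)) @[n --> \oo] --> 0;
  rkhs_kernel : forall y, H (K ^~ y);
  rkhs_reproducing : forall f y, H f -> ip f (K ^~ y) = f y }.

Definition is_hermite_space s (W : s.-tuple nat -> R) (H : set (s.-tuple R -> R)) :=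
  is_rkhs (hermite_kernel W) (hermite_inner W) H.

Definition Gamma (x : R) : R :=
  \int[lebesgue_measure]_(t in `]0, +oo[) (t `^ (x - 1) * expR (- t)).

(* (k - alpha)! is read as Gamma (k - alpha + 1) for integer alpha as well. *)
Definition weight_r (alpha g : R) (k : nat) : R :=
  if k == 0 then 1
  else if k%:R < alpha then g * (k`!%:R)^-1
  else g * (Gamma (k%:R - alpha + 1) / k`!%:R).

Definition weight_rho (alpha g : R) (k : nat) : R :=
  if k == 0 then 1 else g * k%:R `^ (- alpha).

Definition beta_psi (tau k : nat) : R :=
  if (tau <= k)%N then k`!%:R / (k - tau)`!%:R else 0.

Definition weight_psi (a : nat) (g : R) (k : nat) : R :=
  (1 + g^-1 * \sum_(1 <= tau < a.+1) beta_psi tau k)^-1.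

(* [w g k] is one of the three univariate weights, as a function of g and k. *)
Definition is_fourier_weight (alpha : R) (w : R -> nat -> R) : Prop :=
  [\/ w = weight_r alpha, w = weight_rho alpha
    | exists2 a : nat, alpha = a%:R & w = weight_psi a].

(* The sequence of weights is indexed from 0: [gamma j] stands for
   gamma_(j+1). *)
Definition weight_prod (w : R -> nat -> R) (gamma : nat -> R) s
    (k : s.-tuple nat) : R :=
  \prod_(j < s) w (gamma j) (tnth k j).

Section complexity.
Variables (s : nat) (W : s.-tuple nat -> R) (H : set (s.-tuple R -> R)).

Definition algorithm n (w : 'I_n -> R) (x : 'I_n -> s.-tuple R)
    (f : s.-tuple R -> R) : R :=
  \sum_(i < n) w i * f (x i).

Definition worst_case_error (A : (s.-tuple R -> R) -> R) : \bar R :=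
  ereal_sup [set `|INT f - A f|%:E |
    f in [set f | H f /\ Num.sqrt (hermite_inner W f f) <= 1]].

Definition minimal_error n : \bar R :=
  ereal_inf [set worst_case_error (algorithm wx.1 wx.2) |
    wx in [set: ('I_n -> R) * ('I_n -> s.-tuple R)]].

(* The minimum over n, and +oo if no n qualifies. *)
Definition info_complexity (eps : R) : \bar R :=
  ereal_inf [set n%:R%:E | n in [set n | (minimal_error n <= eps%:E)%E]].

End complexity.
End hermite.

(* Below, [n s eps] is an information complexity, only used for s >= 1 and
   0 < eps < 1. *)
Section tractability.
Context {R : realType}.
Implicit Types n : nat -> R -> \bar R.

Definition PT n : Prop :=
  exists tau sigma C : R, [/\ 0 <= tau, 0 <= sigma, 0 <= C &
    forall s eps, (0 < s)%N -> 0 < eps < 1 ->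
      (n s eps <= (C * eps `^ (- tau) * s%:R `^ sigma)%:E)%E].

Definition SPT_with n (tau : R) : Prop :=
  0 <= tau /\ exists2 C : R, 0 <= C &
    forall s eps, (0 < s)%N -> 0 < eps < 1 ->
      (n s eps <= (C * eps `^ (- tau))%:E)%E.

Definition SPT n : Prop := exists tau, SPT_with n tau.

Definition SPT_exponent n : \bar R :=
  ereal_inf [set tau%:E | tau in [set tau | SPT_with n tau]].

(* log n(eps, s) / d(s, eps) --> 0 as s + 1/eps --> +oo *)
Definition log_negligible n (d : nat -> R -> R) : Prop :=
  forall delta : R, 0 < delta -> exists M : R, forall s eps,
    (0 < s)%N -> 0 < eps < 1 -> M <= s%:R + eps^-1 ->
    (`|lne (n s eps) * ((d s eps)^-1)%:E| <= delta%:E)%E.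

Definition sigma_tau_WT (sigma tau : R) n : Prop :=
  log_negligible n (fun s eps => s%:R `^ sigma + eps `^ (- tau)).

Definition WT n : Prop := log_negligible n (fun s eps => s%:R + eps^-1).

Definition UWT n : Prop :=
  forall sigma tau, 0 < sigma <= 1 -> 0 < tau <= 1 -> sigma_tau_WT sigma tau n.

Definition sum_exponent (gamma : nat -> R) : \bar R :=
  ereal_inf [set kappa%:E | kappa in
    [set kappa : R | 0 < kappa /\
       (\sum_(0 <= j <oo) (gamma j `^ kappa)%:E < +oo)%E]].

End tractability.

(* Main.v *)
(* Gram-Schmidt applied to the kernel sections at nodes x_1, ..., x_n gives
   orthonormal a_1, ..., a_n in H_R. Integrating the projection onto their span
   is a quadrature rule whose squared worst-case error is at most the residual
   energy E_n = 1 - sum_j INT(a_j)^2; the trace of the residual kernel is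
   t_n = INT K(x,x) - sum_j INT(a_j^2). An averaging argument finds a next node
   with E_{n+1} <= E_n - E_n^2 / (2 t_n), so that N further nodes bring E below
   2 t_n / N. Starting from n = 0, where t_0 = sum R, this gives
   n(eps) <= 3 eps^-2 sum R. The same averaging over the m eigenvalues R(k) >= theta
   contracts the trace by 1 - 1/(8m) at each node; with L a bound of both sum R
   and sum R^p, p <= 1, one has m <= L theta^-p, and the trace eventually falls
   below 4 L theta^(1-p), since sum_{R(k) < theta} R(k) <= L theta^(1-p).
   Choosing theta = eps^2 / 8 gives n(eps) <= C_d L eps^(-2(p+d)) for every d > 0.
   All three weights satisfy R(k) <= C gamma k^-alpha in dimension one, so that
   sum R^p <= exp(c_p sum_j gamma_j^p) as soon as alpha p > 1. *)

Require Import Defs.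
From HB Require Import structures.
From mathcomp Require Import all_boot all_order all_algebra.
From mathcomp Require Import all_classical all_reals all_analysis.
From mathcomp Require Import finmap measurable_realfun ring lra.

Set Implicit Arguments.
Unset Strict Implicit.
Unset Printing Implicit Defensive.

Import Order.TTheory GRing.Theory Num.Theory.
Import numFieldNormedType.Exports.

Local Open Scope classical_set_scope.
Local Open Scope ring_scope.

(** * Pivoted Cholesky decomposition of a reproducing kernel *)

(** Two features of the definitions shape the proof. First, [hermite_kernel] and [hermite_inner] are
    built on [abs_sum], which returns a default value on divergent families. The expansion of the
    kernel is therefore used only at points where its diagonal series is finite. Almost every point
    is of this kind, all nodes are chosen among them, and inequalities between functions are
    required on them alone. It is replaced by its projections onto spans of kernel sections, which
    do lie in [H]; the error of the resulting rule is estimated through Fourier coefficients,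
    [INT f] being the one of index 0. The same projections, of integral close to 1, show that no
    node means error close to 1, which keeps the logarithm of the complexity nonnegative. The trace
    must be made small before the energy, because it is the constant in the 1/N decay of the
    energy. *)

(* Abstracts [INT]: [P] stands for the integrable functions, [L] for the square
   integrable ones, and [good] for a set of full measure. *)
Record is_mean {R : realType} (X : Type) (good : set X) (P L : set (X -> R))
    (I : (X -> R) -> R) : Prop := IsMean {
  mean_int0 : P (cst 0);
  mean_intD : forall a f g, P f -> P g -> P (fun x => a * f x + g x);
  mean_lin : forall a f g, P f -> P g ->
    I (fun x => a * f x + g x) = a * I f + I g;
  mean_le : forall f g, P f -> P g -> (forall x, good x -> f x <= g x) ->
    I f <= I g;
  mean_sq0 : L (cst 0);
  mean_sqD : forall a f g, L f -> L g -> L (fun x => a * f x + g x);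
  mean_sqM : forall f g, L f -> L g -> P (fun x => f x * g x) }.

Lemma set_fun_ext (X Y : Type) (A : set (X -> Y)) (f g : X -> Y) :
  f =1 g -> A f -> A g.
Proof. by move=> /funext->. Qed.

(** * Square integrable functions under an abstract mean *)

Section mean.
Context {R : realType} (X : Type) (good : set X) (P L : set (X -> R))
  (I : (X -> R) -> R).
Hypothesis mI : is_mean good P L I.

Definition dot (f g : X -> R) : R := I (fun x => f x * g x).

Lemma mean0 : I (cst 0) = 0.
Proof.
have := mean_lin mI 1 (mean_int0 mI) (mean_int0 mI).
rewrite (_ : (fun _ => _) = cst 0); last by apply/funext => x /=; rewrite mulr0 addr0.
by rewrite mul1r => /eqP; rewrite -subr_eq0 opprD addNKr oppr_eq0 => /eqP.
Qed.

Lemma mean_intZ a f : P f -> P (fun x => a * f x).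
Proof.
move=> Pf; have := mean_intD mI a Pf (mean_int0 mI).
by apply: set_fun_ext => x /=; rewrite addr0.
Qed.

Lemma meanZ a f : P f -> I (fun x => a * f x) = a * I f.
Proof.
move=> Pf; have := mean_lin mI a Pf (mean_int0 mI).
rewrite mean0 addr0 => <-; congr I.
by apply/funext => x /=; rewrite addr0.
Qed.

Lemma mean_sqZ a f : L f -> L (fun x => a * f x).
Proof.
move=> Lf; have := mean_sqD mI a Lf (mean_sq0 mI).
by apply: set_fun_ext => x /=; rewrite addr0.
Qed.

Lemma mean_int_sum (J : Type) (r : seq J) (Q : pred J) (f : J -> X -> R) :
  (forall j, Q j -> P (f j)) -> P (fun x => \sum_(j <- r | Q j) f j x).
Proof.
move=> Pf; elim: r => [|j r IH].
  have := mean_int0 mI; apply: set_fun_ext => x /=.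
  by rewrite big_nil.
have [Qj|nQj] := boolP (Q j).
  have := mean_intD mI 1 (Pf _ Qj) IH; apply: set_fun_ext => x.
  by rewrite big_cons Qj mul1r.
by apply: set_fun_ext IH => x; rewrite big_cons (negbTE nQj).
Qed.

Lemma mean_sum (J : Type) (r : seq J) (Q : pred J) (f : J -> X -> R) :
  (forall j, Q j -> P (f j)) ->
  I (fun x => \sum_(j <- r | Q j) f j x) = \sum_(j <- r | Q j) I (f j).
Proof.
move=> Pf; elim: r => [|j r IH].
  rewrite big_nil -[RHS]mean0; congr I; apply/funext => x /=.
  by rewrite big_nil.
rewrite big_cons; have [Qj|nQj] := boolP (Q j).
  rewrite -IH -[X in X + _]mul1r -(mean_lin mI); [|exact: Pf|exact: mean_int_sum].
  by congr I; apply/funext => x; rewrite big_cons Qj mul1r.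
by rewrite -IH; congr I; apply/funext => x; rewrite big_cons (negbTE nQj).
Qed.

Lemma mean_sq_sum (J : Type) (r : seq J) (Q : pred J) (f : J -> X -> R) :
  (forall j, Q j -> L (f j)) -> L (fun x => \sum_(j <- r | Q j) f j x).
Proof.
move=> Lf; elim: r => [|j r IH].
  have := mean_sq0 mI; apply: set_fun_ext => x /=.
  by rewrite big_nil.
have [Qj|nQj] := boolP (Q j).
  have := mean_sqD mI 1 (Lf _ Qj) IH; apply: set_fun_ext => x.
  by rewrite big_cons Qj mul1r.
by apply: set_fun_ext IH => x; rewrite big_cons (negbTE nQj).
Qed.

Lemma dotC f g : dot f g = dot g f.
Proof. by congr I; apply/funext => x; rewrite mulrC. Qed.

Lemma dot_lin a f g h : L f -> L g -> L h ->
  dot (fun x => a * f x + g x) h = a * dot f h + dot g h.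
Proof.
move=> Lf Lg Lh; rewrite -(mean_lin mI); try exact: (mean_sqM mI).
by congr I; apply/funext => x; rewrite mulrDl mulrA.
Qed.

Lemma dotZ a f h : L f -> L h -> dot (fun x => a * f x) h = a * dot f h.
Proof.
move=> Lf Lh; rewrite -meanZ; last exact: (mean_sqM mI).
by congr I; apply/funext => x; rewrite mulrA.
Qed.

Lemma dotZZ a f : L f ->
  dot (fun x => a * f x) (fun x => a * f x) = a ^+ 2 * dot f f.
Proof.
move=> Lf; rewrite dotZ //; last exact: mean_sqZ.
by rewrite dotC dotZ // mulrA.
Qed.

Lemma dotB f g h : L f -> L g -> L h ->
  dot (fun x => f x - g x) h = dot f h - dot g h.
Proof.
move=> Lf Lg Lh; rewrite addrC -mulN1r -dot_lin //.
by congr I; apply/funext => x; rewrite mulN1r addrC.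
Qed.

Lemma mean_sqB f g : L f -> L g -> L (fun x => f x - g x).
Proof.
move=> Lf Lg; have := mean_sqD mI (-1) Lg Lf; apply: set_fun_ext => x.
by rewrite mulN1r addrC.
Qed.

Lemma dot_sum (J : Type) (r : seq J) (Q : pred J) (f : J -> X -> R) h :
  (forall j, Q j -> L (f j)) -> L h ->
  dot (fun x => \sum_(j <- r | Q j) f j x) h = \sum_(j <- r | Q j) dot (f j) h.
Proof.
move=> Lf Lh; rewrite -(@mean_sum _ r Q (fun j x => f j x * h x)); last first.
  by move=> j Qj; apply: (mean_sqM mI) => //; exact: Lf.
by congr I; apply/funext => x; rewrite mulr_suml.
Qed.

Lemma dot_ge0 f : L f -> 0 <= dot f f.
Proof.
move=> Lf; rewrite -mean0; apply: (mean_le mI).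
- exact: (mean_int0 mI).
- exact: (mean_sqM mI).
by move=> x _; rewrite /= -expr2 sqr_ge0.
Qed.

Lemma bessel (J : eqType) (S : seq J) (phi : J -> X -> R) f :
  uniq S -> (forall k, k \in S -> L (phi k)) ->
  (forall k l, k \in S -> l \in S -> dot (phi k) (phi l) = (k == l)%:R) ->
  L f -> \sum_(k <- S) dot f (phi k) ^+ 2 <= dot f f.
Proof.
move=> uS Lphi on Lf.
(* The redundant filter [k \in S] carries membership into the summation lemmas, whose hypotheses are
   asked only for indices satisfying the filter. *)
pose g x := \sum_(k <- S | k \in S) dot f (phi k) * phi k x.
have Lg : L g by apply: mean_sq_sum => k kS; apply: mean_sqZ; exact: Lphi.
have gphi k : k \in S -> dot g (phi k) = dot f (phi k).
  move=> kS; rewrite dot_sum; last exact: Lphi; last first.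
    by move=> l lS; apply: mean_sqZ; exact: Lphi.
  rewrite -big_seq (bigD1_seq k) //= dotZ; [|exact: Lphi|exact: Lphi].
  rewrite on // eqxx mulr1 big1_seq ?addr0 // => l /andP[lk lS].
  by rewrite dotZ; [|exact: Lphi|exact: Lphi]; rewrite on // (negbTE lk) mulr0.
have hg h : L h -> (forall k, k \in S -> dot h (phi k) = dot f (phi k)) ->
    dot g h = \sum_(k <- S) dot f (phi k) ^+ 2.
  move=> Lh hphi; rewrite dot_sum //; last first.
    by move=> l lS; apply: mean_sqZ; exact: Lphi.
  rewrite -big_seq; apply: eq_big_seq => k kS.
  by rewrite dotZ; [|exact: Lphi|by []]; rewrite [dot _ h]dotC hphi // expr2.
have := dot_ge0 (mean_sqB Lf Lg).
rewrite dotB //; last exact: mean_sqB.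
rewrite ![dot _ (fun x => _ - _)]dotC !dotB // (hg g) // (hg f) // [dot f g]dotC.
by rewrite (hg f) // subrr subr0 subr_ge0.
Qed.

Lemma dot_sq_le f g : L f -> L g -> dot g g = 1 -> dot f g ^+ 2 <= dot f f.
Proof.
move=> Lf Lg g1.
have := @bessel unit [:: tt] (fun _ => g) f isT (fun _ _ => Lg) _ Lf.
by rewrite big_seq1; apply=> -[] [] _ _; rewrite g1.
Qed.

End mean.

(** Expand the sum of the squares of [T k - A / m]. A real [m] above the size replaces the size
    itself, since only a bound on the number of large eigenvalues is known. *)
Lemma sqr_sum_le {R : realType} (J : Type) (S : seq J) (T : J -> R) (m : R) :
  0 < m -> (size S)%:R <= m ->
  (\sum_(k <- S) T k) ^+ 2 <= m * \sum_(k <- S) T k ^+ 2.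
Proof.
move=> m0 Sm; set A := \sum_(k <- S) T k.
have : 0 <= \sum_(k <- S) (T k - A / m) ^+ 2.
  by apply: sumr_ge0 => k _; exact: sqr_ge0.
under eq_bigr do rewrite sqrrB.
rewrite big_split /= sumrB.
rewrite big_const_seq iter_addr addr0 count_predT.
under [X in _ - X]eq_bigr do rewrite -mulr_natr.
rewrite -2!mulr_suml -/A => h.
have : 0 <= m * (\sum_(k <- S) T k ^+ 2 - A * (A / m) * 2 + (A / m) ^+ 2 * m).
  rewrite mulr_ge0 ?(ltW m0) //; apply: (le_trans h); rewrite lerD2l -[leLHS]mulr_natr.
  by rewrite ler_wpM2l ?sqr_ge0.
have -> : m * (\sum_(k <- S) T k ^+ 2 - A * (A / m) * 2 + (A / m) ^+ 2 * m)
   = m * \sum_(k <- S) T k ^+ 2 - A ^+ 2.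
  by field; rewrite gt_eqF.
by rewrite subr_ge0.
Qed.

(** * Greedy choice of nodes and decay of the residual *)

Section cholesky.
Context {R : realType} (X : Type) (good : set X) (P L : set (X -> R))
  (I : (X -> R) -> R) (K : X -> X -> R) (ip : (X -> R) -> (X -> R) -> R)
  (H : set (X -> R)).
Hypothesis mI : is_mean good P L I.
Hypothesis hK : is_rkhs K ip H.
Hypothesis KL : forall z, good z -> L (K ^~ z).
Hypothesis Kdiag : P (fun x => K x x).

Local Notation dot := (dot I).

(* Gram-Schmidt orthonormalisation of [n] kernel sections [K ^~ x i]; by
   [chol_eval], an inner product with [a j] is a quadrature rule. *)
Record cholesky (n : nat) (a : nat -> X -> R) : Prop := Cholesky {
  chol_sq : forall j, (j < n)%N -> L (a j);
  chol_mem : forall j, (j < n)%N -> H (a j);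
  chol_orth : forall i j, (i < n)%N -> (j < n)%N -> ip (a i) (a j) = (i == j)%:R;
  chol_eval : exists x : nat -> X, forall j, (j < n)%N -> exists c : nat -> R,
    forall f, H f -> ip f (a j) = \sum_(i < n) c i * f (x i) }.

(** The Schur complement of the kernel after [n] pivots, that is, the reproducing kernel of the
    orthogonal complement of the span of the [a j]. *)
Definition residual (n : nat) (a : nat -> X -> R) (z y : X) : R :=
  K y z - \sum_(j < n) a j z * a j y.

Definition residual_trace (n : nat) (a : nat -> X -> R) : R :=
  I (fun x => K x x) - \sum_(j < n) dot (a j) (a j).

(** For an eigenpair [lam], [phi] of the kernel operator with [phi] of norm one, this is the
    quadratic form of the residual operator at [phi]. *)
Definition residual_energy (n : nat) (a : nat -> X -> R) (lam : R) (phi : X -> R) : R :=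
  lam - \sum_(j < n) dot (a j) phi ^+ 2.

Lemma rkhs_linr a f f' h : H f -> H f' -> H h ->
  ip h (fun x => a * f x + f' x) = a * ip h f + ip h f'.
Proof.
move=> Hf Hf' Hh; have Hff' := rkhs_lin hK a Hf Hf'.
by rewrite (rkhs_ipC hK) // (rkhs_ip_lin hK) // !(rkhs_ipC hK Hh).
Qed.

Lemma rkhs_ip0 h : H h -> ip h (cst 0) = 0.
Proof.
move=> Hh; have H0 := rkhs0 hK; have := rkhs_linr 1 H0 H0 Hh.
rewrite (_ : (fun _ => _) = cst 0); last by apply/funext => x /=; rewrite mulr0 addr0.
by rewrite mul1r => /eqP; rewrite -subr_eq0 opprD addNKr oppr_eq0 => /eqP.
Qed.

Lemma rkhs_comb n (c : nat -> R) (a : nat -> X -> R) :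
  (forall j, (j < n)%N -> H (a j)) ->
  H (fun x => \sum_(j < n) c j * a j x) /\
  forall h, H h -> ip h (fun x => \sum_(j < n) c j * a j x) =
                   \sum_(j < n) c j * ip h (a j).
Proof.
elim: n => [|n IH] Ha.
  have -> : (fun x => \sum_(j < 0) c j * a j x) = cst 0.
    by apply/funext => x; rewrite big_ord0.
  by split=> [|h Hh]; [exact: (rkhs0 hK)|rewrite rkhs_ip0 // big_ord0].
have [Hn ipn] := IH (fun j jn => Ha j (ltnW jn)).
have -> : (fun x => \sum_(j < n.+1) c j * a j x) =
    (fun x => c n * a n x + \sum_(j < n) c j * a j x).
  by apply/funext => x; rewrite big_ord_recr /= addrC.
split=> [|h Hh]; first by apply: (rkhs_lin hK) => //; exact: Ha.
by rewrite rkhs_linr // ?ipn // ?big_ord_recr 1?addrC //; exact: Ha.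
Qed.

Section residual.
Variables (n : nat) (a : nat -> X -> R).
Hypothesis ca : cholesky n a.

Lemma residual_mem z : H (residual n a z).
Proof.
have [Hs _] := rkhs_comb (fun j => a j z) (chol_mem ca).
have := rkhs_lin hK (-1) Hs (rkhs_kernel hK z).
by apply: set_fun_ext => y; rewrite mulN1r addrC.
Qed.

Lemma residual_ip z f : H f ->
  ip f (residual n a z) = f z - \sum_(j < n) a j z * ip f (a j).
Proof.
move=> Hf; have [Hs ips] := rkhs_comb (fun j => a j z) (chol_mem ca).
rewrite (_ : residual n a z =
    fun y => (-1) * \sum_(j < n) a j z * a j y + K y z); last first.
  by apply/funext => y; rewrite mulN1r addrC.
rewrite rkhs_linr //; last exact: (rkhs_kernel hK).
by rewrite ips // (rkhs_reproducing hK) // mulN1r addrC.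
Qed.

Lemma residual_orth z j : (j < n)%N -> ip (a j) (residual n a z) = 0.
Proof.
move=> jn; rewrite residual_ip; last exact: (chol_mem ca).
rewrite (bigD1 (Ordinal jn)) //= (chol_orth ca) // eqxx mulr1.
rewrite big1 ?addr0 ?subrr // => i ij.
rewrite (chol_orth ca) // eq_sym (_ : (_ == _) = false) ?mulr0 //.
by apply: contraNF ij => /eqP e; apply/eqP/val_inj.
Qed.

Lemma residual_norm z :
  ip (residual n a z) (residual n a z) = residual n a z z.
Proof.
have Hr := residual_mem z.
rewrite residual_ip // big1 ?subr0 // => j _.
by rewrite (rkhs_ipC hK Hr (chol_mem ca (ltn_ord j))) residual_orth ?mulr0.
Qed.

Lemma residual_ge0 z : 0 <= residual n a z z.
Proof. by rewrite -residual_norm; apply: (rkhs_ip_ge0 hK); exact: residual_mem. Qed.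

Lemma residual_eq0 z : residual n a z z = 0 -> residual n a z = cst 0.
Proof.
rewrite -residual_norm => /(rkhs_ip_eq0 hK); apply; exact: residual_mem.
Qed.

Lemma residual_sq z : good z -> L (residual n a z).
Proof.
move=> gz; apply: (mean_sqB mI); first exact: KL.
by apply: (mean_sq_sum mI) => j _; apply: (mean_sqZ mI); exact: (chol_sq ca).
Qed.

Lemma residual_diag_int : P (fun z => residual n a z z).
Proof.
have Ps : P (fun z => \sum_(j < n) a j z * a j z).
  apply: (mean_int_sum mI) => j _.
  by apply: (mean_sqM mI); exact: (chol_sq ca).
have := mean_intD mI (-1) Ps Kdiag.
by apply: set_fun_ext => y; rewrite mulN1r addrC.
Qed.

Lemma residual_traceE : residual_trace n a = I (fun z => residual n a z z).
Proof.
have Pj (j : 'I_n) : P (fun z => a j z * a j z).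
  by apply: (mean_sqM mI); exact: (chol_sq ca).
have Ps : P (fun z => \sum_(j < n) a j z * a j z) by exact: (mean_int_sum mI).
rewrite /residual_trace -(mean_sum mI) //.
rewrite addrC -mulN1r -(mean_lin mI) //.
by congr I; apply/funext => y; rewrite mulN1r addrC.
Qed.

(** The residual section at [z] is orthogonal to the earlier [a j] and has squared norm
    [residual n a z z], so dividing it by the root extends the orthonormal family at the price of a
    single new node. *)
Lemma cholesky_step z : good z -> 0 < residual n a z z ->
  cholesky n.+1 (fun j => if j == n
    then fun y => (Num.sqrt (residual n a z z))^-1 * residual n a z y else a j).
Proof.
move=> gz rz; set r := residual n a z.
set c := (Num.sqrt _)^-1; set a' := fun j => _.
have Hr : H r by exact: residual_mem.
have Hcr : H (fun y => c * r y).
  have := rkhs_lin hK c Hr (rkhs0 hK); apply: set_fun_ext => y /=.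
  by rewrite addr0.
have ipcr f : H f -> ip f (fun y => c * r y) = c * ip f r.
  move=> Hf; rewrite -[RHS]addr0 -(rkhs_ip0 Hf) -rkhs_linr //; last exact: (rkhs0 hK).
  by congr (ip f); apply/funext => y /=; rewrite addr0.
have a'n : a' n = (fun y => c * r y) by rewrite /a' eqxx.
have a'j j : (j < n)%N -> a' j = a j by move=> jn; rewrite /a' ltn_eqF.
split.
- move=> j; rewrite ltnS leq_eqVlt => /predU1P[->|jn].
    by rewrite a'n; apply: (mean_sqZ mI); exact: residual_sq.
  by rewrite a'j //; exact: (chol_sq ca).
- move=> j; rewrite ltnS leq_eqVlt => /predU1P[->|jn]; first by rewrite a'n.
  by rewrite a'j //; exact: (chol_mem ca).
- have off i : (i < n)%N -> ip (a i) (fun y => c * r y) = 0.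
    by move=> i_n; rewrite ipcr ?residual_orth ?mulr0 //; exact: (chol_mem ca).
  move=> i j; rewrite !ltnS (leq_eqVlt i) (leq_eqVlt j).
  move=> /predU1P[->|i_n] /predU1P[->|jn].
  + rewrite a'n eqxx ipcr // (rkhs_ipC hK) // ipcr // residual_norm mulrA.
    rewrite -invfM -expr2 sqr_sqrtr ?(ltW rz) // mulVf ?gt_eqF //.
  + by rewrite a'n a'j // (rkhs_ipC hK Hcr (chol_mem ca jn)) off // gtn_eqF.
  + by rewrite a'n a'j // off // ltn_eqF.
  + by rewrite !a'j // (chol_orth ca).
- have [x xa] := chol_eval ca.
  exists (fun i => if i == n then z else x i).
  have /choice[cc ccP] : forall j, exists c : nat -> R, (j < n)%N ->
      forall f, H f -> ip f (a j) = \sum_(i < n) c i * f (x i).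
    move=> j; have [jn|nj] := boolP (j < n)%N; last by exists (fun=> 0).
    by have [d dP] := xa _ jn; exists d.
  have small (d : nat -> R) (f : X -> R) : \sum_(i < n.+1) (if (i : nat) == n then 0 else d i) *
      f (if (i : nat) == n then z else x i) = \sum_(i < n) d i * f (x i).
    rewrite big_ord_recr /= eqxx mul0r addr0.
    by apply: eq_bigr => i _; rewrite ltn_eqF.
  move=> j; rewrite ltnS leq_eqVlt => /predU1P[->|jn].
    (* The new node carries the weight [c]; the old nodes carry the correction that subtracts the
       projection onto the earlier [a j]. *)
    exists (fun i => if i == n then c
                     else - c * \sum_(j < n) a j z * cc j i) => f Hf.
    rewrite a'n ipcr // residual_ip // big_ord_recr /= eqxx mulrBr addrC.
    congr (_ + _); rewrite -mulNr mulr_sumr.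
    under [LHS]eq_bigr => k _ do rewrite (ccP k (ltn_ord k) f Hf) 2!mulr_sumr.
    rewrite exchange_big /=; apply: eq_bigr => i _.
    rewrite ltn_eqF // -mulrA mulr_suml mulr_sumr.
    by apply: eq_bigr => k _; rewrite !mulrA.
  exists (fun i => if i == n then 0 else cc j i) => f Hf.
  by rewrite a'j // small; exact: ccP.
Qed.

Section eigen.
Variables (J : eqType) (S : seq J) (phi : J -> X -> R) (lam : J -> R).
Hypothesis uS : uniq S.
Hypothesis Lphi : forall k, k \in S -> L (phi k).
Hypothesis phi_on : forall k l, k \in S -> l \in S ->
  dot (phi k) (phi l) = (k == l)%:R.
Hypothesis phi_eigen : forall k z, k \in S -> good z ->
  dot (K ^~ z) (phi k) = lam k * phi k z.

Lemma dot_residual k z : k \in S -> good z ->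
  dot (residual n a z) (phi k) =
  lam k * phi k z - \sum_(j < n) dot (a j) (phi k) * a j z.
Proof.
move=> kS gz; have Laj (j : 'I_n) : L (fun y => a j z * a j y).
  by apply: (mean_sqZ mI); exact: (chol_sq ca).
rewrite (dotB mI); [|exact: KL|exact: (mean_sq_sum mI)|exact: Lphi].
rewrite phi_eigen // (dot_sum mI) //; last exact: Lphi.
congr (_ - _); apply: eq_bigr => j _.
by rewrite (dotZ mI) 1?mulrC //; [exact: (chol_sq ca)|exact: Lphi].
Qed.

(** By Bessel, the nodes remove from the energies of [S] at most what they remove from the trace.
    The difference between trace and energies is thus at most its initial value, the mass of the
    eigenvalues outside [S]. *)
Lemma residual_energy_sum_ge :
  residual_trace n a - (I (fun x => K x x) - \sum_(k <- S) lam k) <=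
  \sum_(k <- S) residual_energy n a (lam k) (phi k).
Proof.
rewrite /residual_energy sumrB exchange_big /= /residual_trace.
have : \sum_(j < n) \sum_(k <- S) dot (a j) (phi k) ^+ 2 <=
    \sum_(j < n) dot (a j) (a j).
  by apply: ler_sum => j _; apply: (bessel mI) => //; exact: (chol_sq ca).
by lra.
Qed.

(* Were the inequality to fail at every good point, integrating over [z] would
   contradict Cauchy-Schwarz. *)
Lemma pick_pivot (m tb : R) : 0 < m -> (size S)%:R <= m ->
  0 < tb -> residual_trace n a <= tb ->
  0 < \sum_(k <- S) residual_energy n a (lam k) (phi k) ->
  exists z, [/\ good z, 0 < residual n a z z &
    (\sum_(k <- S) residual_energy n a (lam k) (phi k)) ^+ 2 * residual n a z z
    <= 2 * m * tb * \sum_(k <- S) dot (residual n a z) (phi k) ^+ 2].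
Proof.
move=> m0 Sm tb0 ttb; set T := \sum_(k <- S) _ => T0; apply: contrapT => nz.
(* At good points this is [dot (residual n a z) (phi k)]; the closed form is square integrable as a
   function of [z]. *)
pose b k z := lam k * phi k z - \sum_(j < n) dot (a j) (phi k) * a j z.
have Lb k : k \in S -> L (b k).
  move=> kS; apply: (mean_sqB mI); first by apply: (mean_sqZ mI); exact: Lphi.
  apply: (mean_sq_sum mI) => j _; apply: (mean_sqZ mI); exact: (chol_sq ca).
have bphi k : k \in S ->
    dot (b k) (phi k) = residual_energy n a (lam k) (phi k).
  move=> kS; have Laj (j : 'I_n) : L (a j) by exact: (chol_sq ca).
  have Laj' (j : 'I_n) : L (fun y => dot (a j) (phi k) * a j y).
    exact: (mean_sqZ mI).
  rewrite (dotB mI); [|by apply: (mean_sqZ mI); exact: Lphi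
    |exact: (mean_sq_sum mI)|exact: Lphi].
  rewrite (dotZ mI); [|exact: Lphi|exact: Lphi].
  rewrite phi_on // eqxx mulr1 (dot_sum mI) //; last exact: Lphi.
  congr (_ - _); apply: eq_bigr => j _.
  by rewrite (dotZ mI) // ?expr2 //; exact: Lphi.
have Pb k : k \in S -> P (fun x => b k x * b k x).
  by move=> kS; apply: (mean_sqM mI); exact: Lb.
have le_ae z : good z ->
    2 * m * tb * (\sum_(k <- S | k \in S) b k z * b k z) <= T ^+ 2 * residual n a z z.
  move=> gz.
  have -> : \sum_(k <- S | k \in S) b k z * b k z =
      \sum_(k <- S) dot (residual n a z) (phi k) ^+ 2.
    rewrite -big_seq; apply: eq_big_seq => k kS.
    by rewrite dot_residual // expr2.
  (* Where the diagonal of the residual vanishes, so does the whole section, and both sides are 0.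
     Elsewhere the inequality is the assumed failure of [z] as a pivot. *)
  have := residual_ge0 z; rewrite le_eqVlt => /predU1P[r0|r0].
    rewrite -r0 mulr0 big1 ?mulr0 // => k _.
    rewrite (residual_eq0 (esym r0)) /dot.
    rewrite (_ : (fun _ => _) = cst 0) ?(mean0 mI) ?expr0n //.
    by apply/funext => x /=; rewrite mul0r.
  rewrite leNgt; apply/negP => lt; apply: nz; exists z; split => //.
  exact: ltW.
have Ps : P (fun z => \sum_(k <- S | k \in S) b k z * b k z).
  exact: (mean_int_sum mI).
have := mean_le mI (mean_intZ mI (2 * m * tb) Ps)
  (mean_intZ mI (T ^+ 2) residual_diag_int) le_ae.
rewrite !(meanZ mI) // -?residual_traceE; [|exact: residual_diag_int].
rewrite (mean_sum mI) // -big_seq.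
(* Cauchy-Schwarz twice: over the indices in [S], at the cost of [m], and in the mean against each
   [phi k], of norm one. *)
have : T ^+ 2 <= m * \sum_(k <- S) I (fun x => b k x * b k x).
  apply: (le_trans (sqr_sum_le _ m0 Sm)); rewrite ler_pM2l //.
  rewrite big_seq [leRHS]big_seq; apply: ler_sum => k kS.
  rewrite -bphi //; apply: (dot_sq_le mI); rewrite ?phi_on ?eqxx //.
  - exact: Lb.
  - exact: Lphi.
set Q := \sum_(k <- S) _ => TQ le.
have T20 : 0 < T ^+ 2 by rewrite exprn_gt0.
(* The factor 2 in the statement is there to make this a strict contradiction. *)
have : 2 * tb * T ^+ 2 <= T ^+ 2 * tb.
  apply: (@le_trans _ _ (2 * m * tb * Q)).
    by rewrite (_ : 2 * m * tb * Q = 2 * tb * (m * Q)); [rewrite ler_pM2l // mulr_gt0|ring].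
  by apply: (le_trans le); rewrite ler_pM2l.
by have := mulr_gt0 T20 tb0; lra.
Qed.

End eigen.
End residual.

Section iteration.
Variables (J : eqType) (S : seq J) (phi : J -> X -> R) (lam : J -> R).
Hypothesis uS : uniq S.
Hypothesis Lphi : forall k, k \in S -> L (phi k).
Hypothesis phi_on : forall k l, k \in S -> l \in S ->
  dot (phi k) (phi l) = (k == l)%:R.
Hypothesis phi_eigen : forall k z, k \in S -> good z ->
  dot (K ^~ z) (phi k) = lam k * phi k z.

Lemma cholesky0 (x0 : X) a : cholesky 0 a.
Proof. by split=> //; exists (fun=> x0). Qed.

(** While the trace [t] exceeds [2 * tau], the energies of [S] add up to at least [t / 2]. By Bessel
    the pivot then lowers the trace by at least (t/2)^2 / (2 m t) = t / (8 m), the 2 being that of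
    [pick_pivot]. *)
Lemma trace_decay (x0 : X) (m tau : R) : 1 <= m -> (size S)%:R <= m -> 0 < tau ->
  I (fun x => K x x) - \sum_(k <- S) lam k <= tau ->
  forall N, exists n a, [/\ (n <= N)%N, cholesky n a &
    residual_trace n a <=
      Num.max (2 * tau) ((1 - (8 * m)^-1) ^+ N * I (fun x => K x x))].
Proof.
move=> m1 Sm tau0 tauK; have m0 : 0 < m by exact: lt_le_trans m1.
elim=> [|N [n [a [nN ca tra]]]].
  exists 0%N, (fun=> cst 0); split=> //; first exact: cholesky0.
  by rewrite /residual_trace big_ord0 subr0 expr0 mul1r le_max lexx orbT.
have [t2|t2] := leP (residual_trace n a) (2 * tau).
  by exists n, a; split=> //; [exact: leqW|rewrite le_max t2].
have {tra} tra : residual_trace n a <= (1 - (8 * m)^-1) ^+ N * I (fun x => K x x).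
  by move: tra; rewrite le_max leNgt t2.
set t := residual_trace n a in t2 tra *.
have t0 : 0 < t by apply: lt_trans t2; rewrite mulr_gt0.
have ge_T : t - tau <= \sum_(k <- S) residual_energy n a (lam k) (phi k).
  by apply: le_trans _ (residual_energy_sum_ge ca lam uS Lphi phi_on); rewrite lerB.
have tT : t / 2 <= \sum_(k <- S) residual_energy n a (lam k) (phi k).
  by apply: le_trans _ ge_T; lra.
have T0 : 0 < \sum_(k <- S) residual_energy n a (lam k) (phi k).
  by apply: lt_le_trans tT; rewrite divr_gt0.
have [z [gz rz hz]] :=
  pick_pivot ca Lphi phi_on phi_eigen m0 Sm t0 (lexx t) T0.
exists n.+1, (fun j => if j == n
    then fun y => (Num.sqrt (residual n a z z))^-1 * residual n a z y else a j).
split=> //; first exact: cholesky_step.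
rewrite le_max; apply/orP; right.
rewrite /residual_trace big_ord_recr /= eqxx.
under eq_bigr => j _ do rewrite ltn_eqF //.
rewrite opprD addrA -/(residual_trace n a) -/t.
have Lr := residual_sq ca gz.
rewrite (dotZZ mI) // exprVn sqr_sqrtr ?(ltW rz) //.
rewrite exprS -mulrA; apply: (@le_trans _ _ ((1 - (8 * m)^-1) * t)); last first.
  rewrite ler_wpM2l // subr_ge0 invf_le1 ?mulr_gt0 //.
  by rewrite (le_trans m1) // ler_peMl ?ler1n // ltW.
rewrite mulrBl mul1r lerD2l lerN2.
rewrite ler_pdivrMl ?mulr_gt0 // mulrCA ler_pdivlMl //.
have bes := bessel mI uS Lphi phi_on Lr.
suff : t * (residual n a z z * t) <= t * (8 * m * dot (residual n a z) (residual n a z)).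
  by rewrite ler_pM2l.
apply: (@le_trans _ _ (4 * ((\sum_(k <- S) residual_energy n a (lam k) (phi k)) ^+ 2
    * residual n a z z))); last first.
  apply: (@le_trans _ _ (4 * (2 * m * t * \sum_(k <- S) dot (residual n a z) (phi k) ^+ 2))).
    by rewrite ler_pM2l.
  rewrite [leLHS](_ : _ = (8 * m * t) * \sum_(k <- S) dot (residual n a z) (phi k) ^+ 2); last by ring.
  rewrite [leRHS](_ : _ = (8 * m * t) * dot (residual n a z) (residual n a z)); last by ring.
  by rewrite ler_pM2l // !mulr_gt0.
rewrite [leLHS](_ : _ = t ^+ 2 * residual n a z z); last by ring.
rewrite [leRHS](_ : _ = (2 * \sum_(k <- S) residual_energy n a (lam k) (phi k)) ^+ 2
    * residual n a z z); last by ring.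
rewrite ler_pM2r // lerXn2r ?nnegrE ?(ltW t0) //; last first.
  by rewrite mulrC -ler_pdivrMr.
by rewrite mulr_ge0 // ltW.
Qed.

End iteration.

(** Here [pick_pivot] is applied to the single eigenpair 1, [cst 1]. The trace bound survives
    because a new node never increases the trace. The product form [N * E] is trivial at [N = 0];
    the rate is that of E' = - E^2 / (2 tb). *)
Lemma energy_decay (x0 : X) n0 a0 (tb : R) : L (cst 1) -> I (cst 1) = 1 ->
  (forall z, good z -> I (K ^~ z) = 1) ->
  0 < tb -> cholesky n0 a0 -> residual_trace n0 a0 <= tb ->
  forall N, exists n a, [/\ (n <= n0 + N)%N, cholesky n a,
    residual_trace n a <= tb & N%:R * residual_energy n a 1 (cst 1) <= 2 * tb].
Proof.
move=> L1 I1 IK tb0 ca0 tr0; elim=> [|N [n [a [nN ca tra En]]]].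
  exists n0, a0; split=> //; first by rewrite addn0.
  by rewrite mul0r mulr_ge0 // ltW.
set E := residual_energy n a 1 (cst 1) in En *.
have [E0|E0] := leP E 0.
  exists n, a; split=> //; first by rewrite (leq_trans nN) // leq_add2l.
  by apply: (@le_trans _ _ 0); [rewrite mulr_ge0_le0|rewrite mulr_ge0 // ltW].
have on : forall k l : unit, k \in [:: tt] -> l \in [:: tt] ->
    dot (cst 1) (cst 1) = (k == l)%:R.
  move=> [] [] _ _; rewrite -[RHS]I1; congr I.
  by apply/funext => x /=; rewrite mulr1.
have L1' (k : unit) : k \in [:: tt] -> L (cst 1) by [].
have K1 z : good z -> dot (K ^~ z) (cst 1) = 1 * cst 1 z.
  move=> gz; transitivity (I (K ^~ z)); last by rewrite IK // mul1r.
  congr I.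
  by apply/funext => x /=; rewrite mulr1.
have E1 : \sum_(k <- [:: tt]) residual_energy n a 1 (cst 1) = E by rewrite big_seq1.
have [|z [gz rz]] := @pick_pivot n a ca unit [:: tt] (fun=> cst 1) (fun=> 1)
    L1' on (fun _ z _ => K1 z) 1 tb ltr01 (lexx 1) tb0 tra.
  by rewrite E1.
rewrite E1 big_seq1 mulr1 => hz.
exists n.+1, (fun j => if j == n
    then fun y => (Num.sqrt (residual n a z z))^-1 * residual n a z y else a j).
have Lr := residual_sq ca gz.
split; first by rewrite addnS ltnS.
- exact: cholesky_step.
- rewrite /residual_trace big_ord_recr /= eqxx.
  under eq_bigr => j _ do rewrite ltn_eqF //.
  rewrite opprD addrA -/(residual_trace n a) (le_trans _ tra) // gerBl.
  by apply: (dot_ge0 mI); exact: (mean_sqZ mI).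
rewrite /residual_energy big_ord_recr /= eqxx.
under eq_bigr => j _ do rewrite ltn_eqF //.
rewrite opprD addrA -/(residual_energy n a 1 (cst 1)) -/E.
rewrite (dotZ mI) // exprMn exprVn sqr_sqrtr ?(ltW rz) //.
set d := dot _ _ ^+ 2 in hz *.
have dE : E ^+ 2 / (2 * tb) <= (residual n a z z)^-1 * d.
  rewrite [leRHS]mulrC ler_pdivrMr ?mulr_gt0 // mulrAC ler_pdivlMr //.
  by rewrite [leRHS]mulrC.
apply: (@le_trans _ _ (N.+1%:R * (E - E ^+ 2 / (2 * tb)))).
  by rewrite ler_wpM2l // lerD2l lerN2.
(* In this scaling the induction hypothesis is N u <= 1, and (N + 1) u (1 - u) <= (1 + u) (1 - u) <=
   1. *)
set u := E / (2 * tb); have tb2 : 0 < 2 * tb by rewrite mulr_gt0.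
have EE : E = u * (2 * tb) by rewrite /u divfK // gt_eqF.
have u0 : 0 < u by rewrite divr_gt0.
have uN : N%:R * u <= 1 by rewrite mulrA ler_pdivrMr // mul1r.
rewrite [leLHS](_ : _ = (N.+1%:R * (u * (1 - u))) * (2 * tb)); last first.
  by rewrite EE; field; rewrite gt_eqF.
rewrite -[leRHS]mul1r ler_pM2r //.
have [u1|u1] := leP u 1; last first.
  rewrite (@le_trans _ _ 0) // mulr_ge0_le0 // mulr_ge0_le0 ?ltW //.
  by rewrite subr_lt0.
apply: (@le_trans _ _ ((1 + u) * (1 - u))).
  rewrite mulrA ler_wpM2r ?subr_ge0 // -natr1 mulrDl mul1r.
  by rewrite lerD2r.
by rewrite mulrC -subr_sqr expr1n gerBl sqr_ge0.
Qed.

(* [g] is the orthogonal projection onto the span of the [a j] of the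
   representer of the integral. *)
Lemma cholesky_quadrature n a : L (cst 1) -> cholesky n a ->
  let E := residual_energy n a 1 (cst 1) in
  exists (x : nat -> X) (c : nat -> R) (g : X -> R),
  [/\ H g, forall f, H f -> ip f g = \sum_(i < n) c i * f (x i),
      ip g g = 1 - E & I g = 1 - E].
Proof.
move=> L1 ca E; have [x xa] := chol_eval ca.
have /choice[c cP] : forall j, exists c : nat -> R, (j < n)%N ->
    forall f, H f -> ip f (a j) = \sum_(i < n) c i * f (x i).
  move=> j; have [jn|nj] := boolP (j < n)%N; last by exists (fun=> 0).
  by have [d dP] := xa _ jn; exists d.
pose b j := dot (a j) (cst 1).
have bI j : b j = I (a j).
  by congr I; apply/funext => y /=; rewrite mulr1.
have Pa j : (j < n)%N -> P (a j).
  move=> jn; apply: set_fun_ext (mean_sqM mI (chol_sq ca jn) L1) => y /=.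
  by rewrite mulr1.
have [Hg ipg] := rkhs_comb b (chol_mem ca).
exists x, (fun i => \sum_(j < n) b j * c j i), (fun y => \sum_(j < n) b j * a j y).
split=> //.
- move=> f Hf; rewrite ipg //.
  under [LHS]eq_bigr => j _ do rewrite (cP j (ltn_ord j) f Hf) mulr_sumr.
  rewrite exchange_big /=; apply: eq_bigr => i _; rewrite mulr_suml.
  by apply: eq_bigr => j _; rewrite mulrA.
- rewrite ipg // /E /residual_energy opprB addrC subrK.
  apply: eq_bigr => j _; rewrite (rkhs_ipC hK Hg (chol_mem ca (ltn_ord j))).
  rewrite ipg; last exact: (chol_mem ca).
  rewrite (bigD1 j) //= (chol_orth ca) // eqxx mulr1 big1 ?addr0 -?expr2 //.
  move=> i ij; rewrite (chol_orth ca) // (_ : (_ == _) = false) ?mulr0 //.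
  by apply: contraNF ij => /eqP e; apply/eqP/val_inj.
- rewrite (mean_sum mI); last by move=> j _; apply: (mean_intZ mI); exact: Pa.
  rewrite /E /residual_energy opprB addrC subrK.
  by apply: eq_bigr => j _; rewrite (meanZ mI) ?expr2 -?bI //; exact: Pa.
Qed.

End cholesky.

Lemma rkhs_cauchy_schwarz {R : realType} (X : Type) (K : X -> X -> R)
    (ip : (X -> R) -> (X -> R) -> R) (H : set (X -> R)) f h :
  is_rkhs K ip H -> H f -> H h -> ip f h ^+ 2 <= ip f f * ip h h.
Proof.
move=> hK Hf Hh; have [h0|hn0] := eqVneq (ip h h) 0.
  by rewrite (rkhs_ip_eq0 hK Hh h0) (rkhs_ip0 hK Hf) expr0n /= (rkhs_ip0 hK (rkhs0 hK)) mulr0.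
have hp : 0 < ip h h by rewrite lt_neqAle eq_sym hn0 (rkhs_ip_ge0 hK).
pose g x := - (ip f h / ip h h) * h x + f x.
have Hg : H g by exact: (rkhs_lin hK).
have : 0 <= ip g g by exact: (rkhs_ip_ge0 hK).
rewrite (_ : ip g g = ip f f - ip f h ^+ 2 / ip h h); last first.
  rewrite {1}/g (rkhs_ip_lin hK) // (rkhs_linr hK _ Hh Hf Hh) (rkhs_linr hK _ Hh Hf Hf).
  by rewrite (rkhs_ipC hK Hh Hf); field.
by rewrite subr_ge0 ler_pdivrMr.
Qed.

(** * Hermite polynomials *)

Section hermite_polynomial.
Context {R : realType}.
Implicit Types (p q : {poly R}) (x : R) (k : nat).

(** The monic (probabilists') Hermite polynomials. The recurrence is what one more derivative of p
    e^(-x^2/2) produces, up to sign; [hermite] divides by the root of k!. *)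
Fixpoint hermite_poly k : {poly R} :=
  if k is k'.+1 then 'X * hermite_poly k' - (hermite_poly k')^`() else 1.

Lemma hermite_poly_monic k :
  hermite_poly k \is monic /\ size (hermite_poly k) = k.+1.
Proof.
elim: k => [|k [mk sk]]; first by rewrite monic1 size_poly1.
have sX : size ('X * hermite_poly k) = k.+2.
  by rewrite size_monicM ?monicX // ?monic_neq0 // size_polyX sk.
have sd : (size (- (hermite_poly k)^`()) < size ('X * hermite_poly k)%R)%N.
  by rewrite size_polyN sX (ltn_trans (lt_size_deriv _)) ?monic_neq0 ?sk.
split; last by rewrite /= size_polyDl.
by rewrite monicE /= lead_coefDl // -monicE monicMl // monicX.
Qed.

Lemma is_derive_gauss x :
  is_derive x (1 : R) (fun t : R => expR (- (t ^+ 2) / 2)) (- x * expR (- (x ^+ 2) / 2)).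
Proof.
have -> : (fun t : R => expR (- (t ^+ 2) / 2)) = expR \o horner (- (2^-1) *: 'X^2).
  by apply/funext => t /=; rewrite hornerZ hornerXn; congr expR; field.
apply: trigger_derive.
rewrite derivZ derivXn hornerZ hornerMn hornerXn hornerZ hornerXn /= expr1.
have -> : - 2^-1 * x ^+ 2 = - (x ^+ 2) / 2 by field.
by rewrite mulrC; congr (_ * _); field.
Qed.

Lemma is_derive_poly_gauss p x :
  is_derive x (1 : R) (fun t : R => p.[t] * expR (- (t ^+ 2) / 2))
    ((p^`() - 'X * p).[x] * expR (- (x ^+ 2) / 2)).
Proof.
have := is_deriveM (is_derive_poly p x) (is_derive_gauss x).
move=> h; apply: (trigger_derive h).
by rewrite /GRing.scale /= hornerD hornerN hornerM hornerX; ring.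
Qed.

Lemma derive1n_gauss k : derive1n k (fun t : R => expR (- (t ^+ 2) / 2)) =
  fun x => (-1) ^+ k * ((hermite_poly k).[x] * expR (- (x ^+ 2) / 2)).
Proof.
elim: k => [|k IH]; first by apply/funext => x; rewrite /= hornerC !mul1r.
rewrite derive1nS IH; apply/funext => x; rewrite derive1E.
have d := is_deriveZ ((-1) ^+ k) (is_derive_poly_gauss (hermite_poly k) x).
rewrite (_ : (fun _ => _) = ((-1) ^+ k \*: (fun t : R => (hermite_poly k).[t] * expR (- (t ^+ 2) / 2)))) //.
rewrite (@derive_val _ _ _ _ _ _ _ d) /GRing.scale /= (exprS _ k) !(hornerD, hornerN, hornerM, hornerX); ring.
Qed.

Lemma hermiteE k x : hermite k x = (Num.sqrt k`!%:R)^-1 * (hermite_poly k).[x].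
Proof.
rewrite /hermite derive1n_gauss.
have ee : expR (x ^+ 2 / 2) * expR (- (x ^+ 2) / 2) = 1 :> R.
  by rewrite -expRD mulNr subrr expR0.
have ss : (-1) ^+ k * (-1) ^+ k = 1 :> R by rewrite -expr2 sqrr_sign.
transitivity (((-1) ^+ k * (-1) ^+ k) * (expR (x ^+ 2 / 2) * expR (- (x ^+ 2) / 2)) *
  ((Num.sqrt k`!%:R)^-1 * (hermite_poly k).[x])); first by ring.
by rewrite ee ss !mul1r.
Qed.

Lemma exprn_le_expR (x : R) n : 0 <= x -> x ^+ n <= n`!%:R * expR x.
Proof.
move=> x0; case: n => [|n]; first by rewrite expr0 mul1r -[leLHS]expR0 ler_expR.
have := expR_ge1Dxn n x0; rewrite -ler_pdivrMl ?ltr0n ?fact_gt0 // mulrC.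
by apply: le_trans; rewrite lerDr.
Qed.

(** For |x| > 1, |x|^i <= 4^i (x^2/4)^i, and (x^2/4)^i <= i! e^(x^2/4). The exponent 1/4 spends half
    of the Gaussian on the polynomial and leaves e^(-x^2/4) for integrability and limits. *)
Lemma poly_le_gauss p : exists2 C : R, 0 <= C &
  forall x, `|p.[x]| <= C * expR (x ^+ 2 / 4).
Proof.
exists (\sum_(i < size p) `|p`_i| * (1 + 4 ^+ i * i`!%:R)).
  by apply: sumr_ge0 => i _; rewrite !(mulr_ge0, addr_ge0, exprn_ge0).
move=> x; rewrite horner_coef mulr_suml; apply: (le_trans (ler_norm_sum _ _ _)).
apply: ler_sum => i _; rewrite normrM -mulrA ler_wpM2l // normrX.
have x4 : 0 <= x ^+ 2 / 4 by rewrite divr_ge0 ?sqr_ge0.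
have e1 : 1 <= expR (x ^+ 2 / 4) by rewrite -[leLHS]expR0 ler_expR.
rewrite mulrDl mul1r.
have [x1|x1] := leP `|x| 1.
  rewrite (le_trans (exprn_ile1 _ _ _)) // (le_trans e1) // lerDl.
  by rewrite !(mulr_ge0, exprn_ge0, expR_ge0).
apply: (@le_trans _ _ (4 ^+ i * i`!%:R * expR (x ^+ 2 / 4))); last by rewrite lerDr expR_ge0.
apply: (@le_trans _ _ (`|x| ^+ (2 * i))).
  by rewrite ler_weXn2l ?(ltW x1) // leq_pmull.
rewrite exprM real_normK ?num_real // -mulrA.
apply: le_trans (ler_wpM2l _ (exprn_le_expR i x4)); last by rewrite exprn_ge0.
by rewrite -exprMn mulrC divfK.
Qed.

Lemma gauss_split x : expR (- (x ^+ 2) / 2) = expR (- (x ^+ 2) / 4) * expR (- (x ^+ 2) / 4) :> R.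
Proof. by rewrite -expRD; congr expR; field. Qed.

Lemma measurable_gauss_poly p :
  measurable_fun setT (fun x : R => p.[x] * expR (- (x ^+ 2) / 2)).
Proof.
apply: measurable_funM; first exact: measurable_poly.
apply: measurableT_comp => //; apply: measurable_funM => //.
apply: measurableT_comp => //.
Qed.

Lemma integrable_poly_gauss p : (@lebesgue_measure R).-integrable setT
  (fun x => (p.[x] * expR (- (x ^+ 2) / 2))%:E).
Proof.
have [C C0 pC] := poly_le_gauss p.
have s2 : Num.sqrt 2 != 0 :> R by rewrite gt_eqF // sqrtr_gt0.
(* The remaining factor e^(-x^2/4) is, up to its peak value, the normal density of standard
   deviation sqrt 2. *)
have := integrableZl measurableT (C / normal_peak (Num.sqrt 2))
  (@integrable_normal_pdf R 0 (Num.sqrt 2)).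
apply: le_integrable => //; first by apply/measurable_EFinP; exact: measurable_gauss_poly.
move=> x _; rewrite normal_pdfE //= lee_fin !normrM.
rewrite (ger0_norm C0) (ger0_norm (expR_ge0 _)).
rewrite (@ger0_norm _ (_^-1)) ?invr_ge0 ?normal_peak_ge0 //.
rewrite (ger0_norm (normal_peak_ge0 _)) (ger0_norm (normal_fun_ge0 _ _ _)).
rewrite mulrA divfK ?gt_eqF ?normal_peak_gt0 // gauss_split mulrA.
rewrite /normal_fun subr0 sqr_sqrtr // (_ : 2 *+ 2 = 4); last by rewrite -mulr_natr -natrM.
rewrite ler_wpM2r ?expR_ge0 // (le_trans (ler_wpM2r _ (pC x))) ?expR_ge0 //.
by rewrite -mulrA -expRD mulNr subrr expR0 mulr1.
Qed.

Lemma cvg_poly_gauss p :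
  (p.[n.+1%:R] * expR (- (n.+1%:R ^+ 2) / 2)) @[n --> \oo] --> (0 : R).
Proof.
have [C C0 pC] := poly_le_gauss p.
apply/norm_cvg0P.
apply: (@squeeze_cvgr _ _ _ _ (cst 0) (fun n : nat => C * (4 * n.+1%:R^-1))).
- apply: nearW => n; rewrite normr_ge0 /= normrM gauss_split.
  rewrite (@ger0_norm _ (_ * _)) ?mulr_ge0 ?expR_ge0 //.
  rewrite mulrA; apply: ler_pM => //; rewrite ?mulr_ge0 ?expR_ge0 //.
    rewrite (le_trans (ler_wpM2r _ (pC _))) ?expR_ge0 //.
    by rewrite -mulrA -expRD mulNr subrr expR0 mulr1.
  rewrite mulNr expRN -[leRHS]invrK lef_pV2 ?posrE ?expR_gt0 ?invr_gt0 ?divr_gt0 //.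
  rewrite invfM invrK (le_trans _ (expR_ge1Dx _)) //.
  apply: (@le_trans _ _ (n.+1%:R ^+ 2 / 4)); last by rewrite lerDr.
  by rewrite mulrC ler_pM2r // expr2 ler_peMl // ler1n.
- exact: cvg_cst.
- rewrite -[0 in X in _ --> X](mulr0 C); apply: cvgM; first exact: cvg_cst.
  rewrite -[0 in X in _ --> X](mulr0 4); apply: cvgM; first exact: cvg_cst.
  exact: cvg_harmonic.
Qed.

Lemma integral_deriv_poly_gauss p :
  \int[@lebesgue_measure R]_x ((p^`() - 'X * p).[x] * expR (- (x ^+ 2) / 2)) = 0.
Proof.
pose F x := p.[x] * expR (- (x ^+ 2) / 2).
pose f x := (p^`() - 'X * p).[x] * expR (- (x ^+ 2) / 2).
have cF x : {for x, continuous F}.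
  apply/differentiable_continuous/derivable1_diffP.
  by have [] := is_derive_poly_gauss p x.
have cf x : {for x, continuous f}.
  apply/differentiable_continuous/derivable1_diffP.
  by have [] := is_derive_poly_gauss (p^`() - 'X * p) x.
have intf := integrable_poly_gauss (p^`() - 'X * p).
have FTC n : (\int[@lebesgue_measure R]_(x in `[(- n.+1%:R)%R, n.+1%:R%R]) (f x)%:E =
    (F n.+1%:R - F (- n.+1%:R))%R%:E)%E.
  rewrite EFinB; apply: continuous_FTC2.
  - by rewrite gtrN.
  - exact: continuous_subspaceT.
  - split.
    + by move=> x _; have [] := is_derive_poly_gauss p x.
    + exact: cvg_at_right_filter (cF _).
    + exact: cvg_at_left_filter (cF _).
  - by move=> x _; rewrite derive1E; have [_ ->] := is_derive_poly_gauss p x.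
have lim0 : (F n.+1%:R - F (- n.+1%:R)) @[n --> \oo] --> (0 : R).
  (* The boundary term at the left end is that of the reflected polynomial at the right end, so one
     limit handles both. *)
  have FN : (fun n : nat => F n.+1%:R - F (- n.+1%:R)) =
      (fun n : nat => (p - (p \Po (- 'X))).[n.+1%:R] * expR (- (n.+1%:R ^+ 2) / 2)).
    apply/funext => n; rewrite /F hornerD hornerN horner_comp hornerN hornerX.
    by rewrite sqrrN mulrBl.
  by rewrite FN; exact: cvg_poly_gauss.
have limint : (\int[@lebesgue_measure R]_(x in `[(- n.+1%:R)%R, n.+1%:R%R]) (f x)%:E)%E
    @[n --> \oo] --> (\int[@lebesgue_measure R]_x (f x)%:E)%E.
  under eq_fun do rewrite integral_mkcond.
  have mf : measurable_fun setT (EFin \o f) := measurable_int _ intf.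
  pose f_ (n : nat) := (EFin \o f) \_ `[(- n.+1%:R)%R, n.+1%:R%R].
  have [|||||_ _ lim] := @dominated_convergence _ _ _ (@lebesgue_measure R) setT
      measurableT f_ (EFin \o f) (fun x => `|(f x)%:E|%E); last exact: lim.
  - by move=> n; apply/(measurable_restrictT _ _).1 => //; exact: measurable_funTS.
  - by [].
  - apply: aeW => x _; apply: cvg_near_cst; near=> n.
    rewrite /f_ patchE ifT // in_setE /= in_itv /= -ler_norml.
    rewrite (@le_trans _ _ n%:R) ?ler_nat //; near: n; exact: nbhs_infty_ger.
  - exact: integrable_abse.
  - apply: aeW => x n _; rewrite /f_ patchE; case: ifPn => // _.
    by rewrite abse0 abse_ge0.
have := cvg_lim _ limint; rewrite /Rintegral => <- //.
under eq_fun do rewrite FTC.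
by rewrite (cvg_lim _ (cvg_EFin _ lim0)) //; exact: nearW.
Unshelve. all: by end_near. Qed.

Lemma normal_pdf_gauss_density x : normal_pdf 0 1 x = gauss_density x.
Proof.
rewrite normal_pdfE ?oner_neq0 // /normal_peak /normal_fun /gauss_density.
by rewrite subr0 expr1n mul1r -mulr_natl.
Qed.

Lemma integrable_poly_gauss_density p : (@lebesgue_measure R).-integrable setT
  (fun x => (p.[x] * gauss_density x)%:E).
Proof.
have := integrableZl measurableT (Num.sqrt (2 * pi))^-1 (integrable_poly_gauss p).
by apply: eq_integrable => // x _; rewrite -EFinM /gauss_density mulrCA.
Qed.

Definition gauss_mean p : R := \int[@lebesgue_measure R]_x (p.[x] * gauss_density x).

Lemma gauss_mean1 : gauss_mean 1 = 1.
Proof.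
rewrite /gauss_mean /Rintegral.
under eq_integral do rewrite hornerC mul1r -normal_pdf_gauss_density.
by rewrite integral_normal_pdf.
Qed.

Lemma gauss_meanB p q : gauss_mean (p - q) = gauss_mean p - gauss_mean q.
Proof.
rewrite /gauss_mean -RintegralB //; try exact: integrable_poly_gauss_density.
by apply: eq_Rintegral => x _; rewrite hornerD hornerN mulrBl.
Qed.

Lemma gauss_meanZ (c : R) p : gauss_mean (c *: p) = c * gauss_mean p.
Proof.
rewrite /gauss_mean -RintegralZl //; try exact: integrable_poly_gauss_density.
by apply: eq_Rintegral => x _; rewrite hornerZ -mulrA.
Qed.

(* Stein's identity *)
Lemma gauss_mean_mulX p : gauss_mean ('X * p) = gauss_mean p^`().
Proof.
apply/eqP; rewrite eq_sym -subr_eq0 -gauss_meanB.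
rewrite /gauss_mean (_ : (fun _ => _) = (fun x => (Num.sqrt (2 * pi))^-1 *
    ((p^`() - 'X * p).[x] * expR (- (x ^+ 2) / 2)))); last first.
  by apply/funext => x; rewrite mulrCA.
rewrite RintegralZl //; last exact: integrable_poly_gauss.
by rewrite integral_deriv_poly_gauss mulr0.
Qed.

(** By Stein's identity, each factor X - d/dx of the Hermite polynomial passes to [q] as a
    derivative. Orthogonality follows: k derivatives kill lower degrees and send a monic polynomial
    of degree k to k!. *)
Lemma gauss_mean_hermite_poly k q : gauss_mean (hermite_poly k * q) = gauss_mean q^`(k).
Proof.
elim: k q => [|k IH] q; first by rewrite mul1r.
rewrite derivSn -IH /= mulrBl -mulrA gauss_meanB gauss_mean_mulX -gauss_meanB.
by rewrite derivM addrAC subrr add0r.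
Qed.

Lemma gauss_mean_hermite_polyM k l :
  gauss_mean (hermite_poly k * hermite_poly l) = (k == l)%:R * k`!%:R.
Proof.
wlog : k l / (l <= k)%N => [th|].
  have [/th//|/ltnW/th] := leqP l k; rewrite mulrC eq_sym => ->.
  by have [->|] := eqVneq; rewrite ?mul0r.
rewrite leq_eqVlt => /predU1P[->|lk]; last first.
  rewrite gtn_eqF // mul0r gauss_mean_hermite_poly derivn_poly0.
    by rewrite -(scale0r 1) gauss_meanZ mul0r.
  by have [_ ->] := hermite_poly_monic l.
have [mk sk] := hermite_poly_monic k.
rewrite eqxx mul1r gauss_mean_hermite_poly (_ : derivn _ _ = k`!%:R *: 1).
  by rewrite gauss_meanZ gauss_mean1 mulr1.
apply/polyP => i; rewrite coef_derivn coefZ coef1; have [->|i0] := eqVneq i 0%N.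
  rewrite addn0 ffactnn mulr1 -mulr_natl.
  by move: mk; rewrite monicE lead_coefE sk /= => /eqP ->; rewrite mulr1.
by rewrite mulr0 nth_default ?mul0rn // sk -addn1 leq_add2l lt0n.
Qed.

Lemma hermite_horner k x : hermite k x = ((Num.sqrt k`!%:R)^-1 *: hermite_poly k).[x].
Proof. by rewrite hermiteE hornerZ. Qed.

Lemma hermite0 x : hermite 0 x = 1.
Proof. by rewrite hermiteE /= hornerC fact0 sqrtr1 invr1 mulr1. Qed.

Lemma measurable_hermite k : measurable_fun setT (hermite k : R -> R).
Proof.
rewrite (_ : hermite k = horner ((Num.sqrt k`!%:R)^-1 *: hermite_poly k)).
  exact: measurable_poly.
by apply/funext => x; rewrite hermite_horner.
Qed.

Lemma integrable_hermiteM k l : (@lebesgue_measure R).-integrable setT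
  (fun x => (hermite k x * hermite l x * gauss_density x)%:E).
Proof.
apply: eq_integrable (integrable_poly_gauss_density
  ((Num.sqrt k`!%:R)^-1 *: hermite_poly k * ((Num.sqrt l`!%:R)^-1 *: hermite_poly l))) => // x _.
by rewrite hornerM -!hermite_horner.
Qed.

Lemma hermite_orthonormal k l :
  \int[@lebesgue_measure R]_x (hermite k x * hermite l x * gauss_density x) = (k == l)%:R.
Proof.
transitivity (gauss_mean ((Num.sqrt k`!%:R)^-1 *: hermite_poly k *
    ((Num.sqrt l`!%:R)^-1 *: hermite_poly l))).
  by apply: eq_Rintegral => x _; rewrite hornerM -!hermite_horner.
rewrite -scalerAl -scalerAr scalerA gauss_meanZ gauss_mean_hermite_polyM.
have [->|] := eqVneq k l; last by rewrite mul0r mulr0.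
rewrite mul1r -invfM -expr2 sqr_sqrtr // mulVf // pnatr_eq0 -lt0n fact_gt0 //.
Qed.

Lemma gauss_density_gt0 x : 0 < gauss_density x :> R.
Proof.
by rewrite mulr_gt0 ?expR_gt0 // invr_gt0 sqrtr_gt0 mulr_gt0 // pi_gt0.
Qed.

Lemma measurable_gauss_density : measurable_fun setT (gauss_density : R -> R).
Proof.
have := measurable_normal_pdf (0 : R) 1; apply: eq_measurable_fun => x _.
exact: normal_pdf_gauss_density.
Qed.

End hermite_polynomial.

(** * Sums of real families *)

Section absolute_sums.
Context {R : realType} (I : choiceType).
Implicit Types (a b : I -> R).

Lemma esum_ge_seq (a : I -> \bar R) (s : seq I) : uniq s ->
  (\sum_(i <- s) a i <= \esum_(i in [set: I]) a i)%E.
Proof.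
move=> us; apply: ereal_sup_ubound; exists [set` s]; first by split.
by rewrite -fsbig_seq.
Qed.

Lemma esum_le_seq (a : I -> \bar R) (M : \bar R) :
  (forall s, uniq s -> (\sum_(i <- s) a i <= M)%E) ->
  (\esum_(i in [set: I]) a i <= M)%E.
Proof.
move=> aM; apply: ge_ereal_sup => _ [F [finF _] <-].
by rewrite fsbig_finite //; apply: aM; exact: fset_uniq.
Qed.

Lemma esumZ (c : R) (a : I -> \bar R) : 0 <= c -> (forall i, (0 <= a i)%E) ->
  (\esum_(i in [set: I]) (c%:E * a i) = c%:E * \esum_(i in [set: I]) a i)%E.
Proof.
(* One inequality for all factors suffices: applied to [c^-1] it gives the converse. *)
have le (d : R) (b : I -> \bar R) : 0 <= d -> (forall i, (0 <= b i)%E) ->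
    (\esum_(i in [set: I]) (d%:E * b i) <= d%:E * \esum_(i in [set: I]) b i)%E.
  move=> d0 b0; apply: esum_le_seq => s us; rewrite -ge0_sume_distrr //.
  by rewrite lee_wpmul2l ?lee_fin // esum_ge_seq.
move=> c0 a0; apply/eqP; rewrite eq_le le //=.
have [->|cn0] := eqVneq c 0.
  by rewrite mul0e esum_ge0 // => i _; rewrite mul0e.
have {cn0}c0 : 0 < c by rewrite lt_neqAle eq_sym cn0.
have := le c^-1 (fun i => (c%:E * a i)%E).
rewrite invr_ge0 (ltW c0) => /(_ isT) h.
have {h} : (\esum_(i in [set: I]) (c^-1%:E * (c%:E * a i)) <=
   c^-1%:E * \esum_(i in [set: I]) (c%:E * a i))%E.
  by apply: h => i; rewrite mule_ge0 // lee_fin ltW.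
under eq_esum do rewrite muleA -EFinM mulVf ?gt_eqF // mul1e.
by rewrite -lee_pdivlMl.
Qed.

Lemma summable_real a :
  summable setT (EFin \o a) = (\esum_(i in [set: I]) `|a i|%:E < +oo)%E.
Proof. by []. Qed.

Lemma le_summable a b : (forall i, `|a i| <= b i) ->
  (\esum_(i in [set: I]) (b i)%:E < +oo)%E -> summable setT (EFin \o a).
Proof.
move=> ab; apply: le_lt_trans; apply: le_esum => i _.
by rewrite lee_fin.
Qed.

Lemma ge0_abs_sum a : (forall i, 0 <= a i) ->
  abs_sum a = fine (\esum_(i in [set: I]) (a i)%:E)%E.
Proof.
move=> a0; rewrite /abs_sum [X in (_ - X)%E]esum1 ?sube0.
  by congr fine; apply: eq_esum => i _; rewrite max_l.
by move=> i _; rewrite max_r // oppr_le0.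
Qed.

Lemma ge0_abs_sumK a : (forall i, 0 <= a i) ->
  (\esum_(i in [set: I]) (a i)%:E < +oo)%E ->
  ((abs_sum a)%:E = \esum_(i in [set: I]) (a i)%:E)%E.
Proof.
move=> a0 sa; rewrite ge0_abs_sum // fineK //.
by rewrite ge0_fin_numE //; apply: esum_ge0 => i _; rewrite lee_fin.
Qed.

(** Any splitting into two summable nonnegative families computes the sum, not only the one into
    positive and negative parts. Additivity needs this, since positive parts do not add up. *)
Lemma abs_sum_diff a b : (forall i, 0 <= a i) -> (forall i, 0 <= b i) ->
  (\esum_(i in [set: I]) (a i)%:E < +oo)%E ->
  (\esum_(i in [set: I]) (b i)%:E < +oo)%E ->
  abs_sum (fun i => a i - b i) =
  fine (\esum_(i in [set: I]) (a i)%:E)%E - fine (\esum_(i in [set: I]) (b i)%:E)%E.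
Proof.
move=> a0 b0 sa sb; rewrite -fineB; last 2 first.
- by rewrite ge0_fin_numE //; apply: esum_ge0 => i _; rewrite lee_fin.
- by rewrite ge0_fin_numE //; apply: esum_ge0 => i _; rewrite lee_fin.
rewrite -(@esumB _ _ setT (EFin \o a) (EFin \o b)).
- rewrite /abs_sum; congr (fine (_ - _)%E); apply: eq_esum => i _;
    by rewrite ?funeposE ?funenegE /= EFin_max // oppeB // addrC.
- by apply: le_lt_trans sa; apply: le_esum => i _; rewrite lee_fin /= ger0_norm.
- by apply: le_lt_trans sb; apply: le_esum => i _; rewrite lee_fin /= ger0_norm.
- by move=> i _; rewrite lee_fin.
- by move=> i _; rewrite lee_fin.
Qed.

Definition pos_part (x : R) : R := Num.max x 0.

Lemma pos_part_ge0 x : 0 <= pos_part x.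
Proof. by rewrite /pos_part le_max lexx orbT. Qed.

Lemma pos_partB x : pos_part x - pos_part (- x) = x.
Proof. by rewrite /pos_part; case: (lerP 0 x); case: (lerP 0 (- x)) => *; lra. Qed.

Lemma pos_part_le x : pos_part x <= `|x|.
Proof. by rewrite /pos_part ge_max ler_norm normr_ge0. Qed.

Lemma pos_part_summable a : summable setT (EFin \o a) ->
  (\esum_(i in [set: I]) (pos_part (a i))%:E < +oo)%E /\
  (\esum_(i in [set: I]) (pos_part (- a i))%:E < +oo)%E.
Proof.
move=> sa; split; apply: le_lt_trans sa; apply: le_esum => i _; rewrite lee_fin.
  exact: pos_part_le.
by rewrite -(normrN (a i)); exact: pos_part_le.
Qed.

Lemma abs_sumD a b : summable setT (EFin \o a) -> summable setT (EFin \o b) ->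
  abs_sum (fun i => a i + b i) = abs_sum a + abs_sum b.
Proof.
move=> /pos_part_summable[sap san] /pos_part_summable[sbp sbn].
have fn (c : I -> R) : (forall i, 0 <= c i) -> (\esum_(i in [set: I]) (c i)%:E < +oo)%E ->
    (\esum_(i in [set: I]) (c i)%:E)%E \is a fin_num.
  move=> c0 sc; rewrite ge0_fin_numE //; apply: esum_ge0 => i _.
  by rewrite lee_fin.
have p0 := pos_part_ge0.
have sumD (c d : I -> R) : (forall i, 0 <= c i) -> (forall i, 0 <= d i) ->
    (\esum_(i in [set: I]) (c i + d i)%:E =
     \esum_(i in [set: I]) (c i)%:E + \esum_(i in [set: I]) (d i)%:E)%E.
  move=> c0 d0; rewrite -esumD; first by apply: eq_esum => i _; rewrite EFinD.
    by move=> i _; rewrite lee_fin.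
  by move=> i _; rewrite lee_fin.
rewrite (_ : (fun i => a i + b i) = (fun i => (pos_part (a i) + pos_part (b i)) -
    (pos_part (- a i) + pos_part (- b i)))); last first.
  by apply/funext => i; rewrite opprD addrACA !pos_partB.
rewrite [in abs_sum a](_ : a = (fun i => pos_part (a i) - pos_part (- a i))); last first.
  by apply/funext => i; rewrite pos_partB.
rewrite [in abs_sum b](_ : b = (fun i => pos_part (b i) - pos_part (- b i))); last first.
  by apply/funext => i; rewrite pos_partB.
rewrite !abs_sum_diff //; try by move=> i; rewrite addr_ge0.
- by rewrite !sumD // !fineD ?fn //; ring.
- by rewrite sumD // lte_add_pinfty.
- by rewrite sumD // lte_add_pinfty.
Qed.

(** No summability is assumed: if a part is infinite, [fine] gives 0 on both sides. The same holds
    in [abs_sumZ], so the Gaussian density can be moved into the kernel series at every point. *)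
Lemma abs_sumN a : abs_sum (fun i => - a i) = - abs_sum a.
Proof.
rewrite /abs_sum; under [X in (_ - X)%E]eq_esum do rewrite opprK.
set x := (\esum_(i in _) (Num.max (- a i) 0)%:E)%E.
set y := (\esum_(i in _) (Num.max (a i) 0)%:E)%E.
have x0 : (0 <= x)%E by apply: esum_ge0 => i _; rewrite lee_fin le_max lexx orbT.
have y0 : (0 <= y)%E by apply: esum_ge0 => i _; rewrite lee_fin le_max lexx orbT.
move: x y x0 y0 => [x| |] [y| |] //= _ _; rewrite ?oppr0 //; ring.
Qed.

Lemma abs_sumZ (c : R) a : abs_sum (fun i => c * a i) = c * abs_sum a.
Proof.
wlog c0 : c / 0 <= c => [th|].
  have [c0|/ltW c0] := leP 0 c; first exact: th.
  have := th (- c); rewrite oppr_ge0 => /(_ c0).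
  under eq_fun do rewrite mulNr.
  by rewrite abs_sumN mulNr => /oppr_inj.
have sZ (d : I -> R) : (forall i, 0 <= d i) ->
    (\esum_(i in [set: I]) (c * d i)%:E = c%:E * \esum_(i in [set: I]) (d i)%:E)%E.
  by move=> d0; rewrite -esumZ.
have pos x : Num.max (c * x) 0 = c * pos_part x.
  by rewrite /pos_part maxr_pMr // mulr0.
rewrite /abs_sum; under eq_esum do rewrite pos.
under [X in (_ - X)%E]eq_esum do rewrite -mulrN pos.
rewrite !sZ; try by move=> i; exact: pos_part_ge0.
rewrite -/pos_part.
set x := (\esum_(i in _) (pos_part (a i))%:E)%E.
set y := (\esum_(i in _) (pos_part (- a i))%:E)%E.
have x0 : (0 <= x)%E by apply: esum_ge0 => i _; rewrite lee_fin pos_part_ge0.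
have y0 : (0 <= y)%E by apply: esum_ge0 => i _; rewrite lee_fin pos_part_ge0.
have [->|cn0] := eqVneq c 0; first by rewrite !mul0e sube0 mul0r.
have {}c0 : 0 < c by rewrite lt_neqAle eq_sym cn0.
move: x y x0 y0 => [x| |] [y| |] //= _ _.
- by rewrite mulrBr.
- by rewrite gt0_muley ?lte_fin //= mulr0.
- by rewrite gt0_muley ?lte_fin //= mulr0.
- by rewrite gt0_muley ?lte_fin //= mulr0.
Qed.

Lemma abs_sum_single (i : I) a : (forall j, j != i -> a j = 0) -> abs_sum a = a i.
Proof.
move=> ai; have single (b : I -> R) : (forall j, 0 <= b j) ->
    (forall j, j != i -> b j = 0) -> (\esum_(j in [set: I]) (b j)%:E = (b i)%:E)%E.
  move=> b0 bi; transitivity (\esum_(j in [set i]) (b j)%:E)%E; last by rewrite esum_set1 ?lee_fin.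
  rewrite [RHS]esum_mkcond; apply: eq_esum => j _; case: ifPn => // ji.
  by rewrite bi //; apply: contraNN ji => /eqP ->; exact: mem_set.
rewrite /abs_sum !single ?EFinB //=.
- exact: pos_partB.
- by move=> j; exact: pos_part_ge0.
- by move=> j ji; rewrite ai // oppr0 maxxx.
- by move=> j; exact: pos_part_ge0.
- by move=> j ji; rewrite ai // maxxx.
Qed.

Lemma summableZ (c : R) a : summable setT (EFin \o a) ->
  summable setT (EFin \o (fun i => c * a i)).
Proof.
move=> sa; rewrite summable_real.
under eq_esum do rewrite normrM EFinM.
by rewrite esumZ // lte_mul_pinfty // lee_fin.
Qed.

Lemma summable_add a b : summable setT (EFin \o a) -> summable setT (EFin \o b) ->
  summable setT (EFin \o (fun i => a i + b i)).
Proof. exact: summableD. Qed.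

Lemma abs_sum_ge (i : I) a : (forall j, 0 <= a j) -> summable setT (EFin \o a) ->
  a i <= abs_sum a.
Proof.
move=> a0 sa; rewrite -lee_fin ge0_abs_sumK //.
  by have := @esum_ge_seq (EFin \o a) [:: i]; rewrite big_seq1; exact.
by apply: le_lt_trans sa; apply: le_esum => j _; rewrite lee_fin ler_norm.
Qed.

End absolute_sums.

(** * Termwise integration of countable families *)

Section countable_sums.
Context {R : realType} (I : countType).

(** Enumeration by codes turns a sum over a countable type into a series, to which monotone
    convergence applies; codes of no element contribute 0. *)
Lemma esum_countE (b : I -> \bar R) : (forall i, 0 <= b i)%E ->
  (\esum_(i in [set: I]) b i = \sum_(n <oo) oapp b 0 (@choice.pickle_inv I n))%E.
Proof.
move=> b0; rewrite nneseries_esumT; last by move=> n; case: choice.pickle_inv.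
transitivity (\esum_(n in @choice.pickle I @` [set: I])
    (oapp b 0 (@choice.pickle_inv I n)))%E.
  rewrite esum_image; last by move=> i j _ _ /(pcan_inj (@choice.pickleK I)).
  by apply: eq_esum => i _; rewrite choice.pickleK_inv.
rewrite esum_mkcond; apply: eq_esum => n _; case: ifPn => // nI.
case E : (@choice.pickle_inv I n) => [i|//]; case/negP: nI; apply: mem_set; exists i => //.
by have := @choice.pickle_invK I n; rewrite E.
Qed.

Context d (T : measurableType d) (mu : {measure set T -> \bar R}).

Lemma measurable_esum (f : I -> T -> \bar R) :
  (forall i, measurable_fun setT (f i)) -> (forall i x, (0 <= f i x)%E) ->
  measurable_fun setT (fun x => \esum_(i in [set: I]) f i x)%E.
Proof.
move=> mf f0; under eq_fun do rewrite esum_countE //.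
apply: (ge0_emeasurable_sum (P := xpredT)) => [n x _ _|n _]; first by case: choice.pickle_inv => //= i.
by case: choice.pickle_inv => [i|] /=; [exact: mf|exact: measurable_cst].
Qed.

Lemma integral_esum (f : I -> T -> \bar R) :
  (forall i, measurable_fun setT (f i)) -> (forall i x, (0 <= f i x)%E) ->
  (\int[mu]_x (\esum_(i in [set: I]) f i x) =
   \esum_(i in [set: I]) \int[mu]_x f i x)%E.
Proof.
move=> mf f0; under eq_integral do rewrite esum_countE //.
rewrite esum_countE; last by move=> i; exact: integral_ge0.
pose g n x := oapp (f^~ x) 0%E (@choice.pickle_inv I n).
rewrite (@integral_nneseries _ _ _ mu setT measurableT g).
- apply: eq_eseriesr => n _; rewrite /g.
  by case: choice.pickle_inv => //=; rewrite integral0.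
- move=> n; rewrite /g; case: choice.pickle_inv => [i|] /=; first exact: mf.
  exact: measurable_cst.
- by move=> n x _; rewrite /g; case: choice.pickle_inv => //= i.
Qed.

(** Tonelli makes the sum [S] of absolute values integrable, hence finite almost everywhere. The
    sums [p] and [n] of positive and negative parts lie below [S] and are integrated termwise by
    monotone convergence. *)
Lemma integral_abs_sum (a : I -> T -> R) :
  (forall i, measurable_fun setT (a i)) ->
  (\esum_(i in [set: I]) \int[mu]_x `|a i x|%:E < +oo)%E ->
  [/\ {ae mu, forall x, summable setT (EFin \o (a^~ x))},
      mu.-integrable setT (fun x => (abs_sum (a^~ x))%:E) &
      \int[mu]_x abs_sum (a^~ x) = abs_sum (fun i => \int[mu]_x a i x)].
Proof.
move=> ma fin; pose S x := (\esum_(i in [set: I]) `|a i x|%:E)%E.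
pose p x := (\esum_(i in [set: I]) (pos_part (a i x))%:E)%E.
pose n x := (\esum_(i in [set: I]) (pos_part (- a i x))%:E)%E.
have mpos i : measurable_fun setT (fun x => pos_part (a i x)).
  by apply: measurable_maxr.
have mneg i : measurable_fun setT (fun x => pos_part (- a i x)).
  by apply: measurable_maxr => //; exact: measurableT_comp.
have p0 x : (0 <= p x)%E by apply: esum_ge0 => i _; rewrite lee_fin pos_part_ge0.
have n0 x : (0 <= n x)%E by apply: esum_ge0 => i _; rewrite lee_fin pos_part_ge0.
have pS x : (p x <= S x)%E by apply: le_esum => i _; rewrite lee_fin pos_part_le.
have nS x : (n x <= S x)%E.
  by apply: le_esum => i _; rewrite lee_fin -(normrN (a i x)) pos_part_le.
have mS : measurable_fun setT S.
  by apply: measurable_esum => // i; apply/measurable_EFinP; exact: measurableT_comp.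
have mp : measurable_fun setT p.
  apply: measurable_esum => [i|i x]; first exact/measurable_EFinP.
  by rewrite lee_fin pos_part_ge0.
have mn : measurable_fun setT n.
  apply: measurable_esum => [i|i x]; first exact/measurable_EFinP.
  by rewrite lee_fin pos_part_ge0.
have iS : mu.-integrable setT S.
  apply/integrableP; split => //.
  under eq_integral => x _ do rewrite gee0_abs ?(le_trans (p0 x) (pS x)) //.
  by rewrite integral_esum // => i; apply/measurable_EFinP; exact: measurableT_comp.
have ip : mu.-integrable setT p.
  apply: le_integrable iS => // x _.
  by rewrite !gee0_abs // (le_trans (p0 x)).
have i_n : mu.-integrable setT n.
  apply: le_integrable iS => // x _.
  by rewrite !gee0_abs // (le_trans (n0 x)).
have aS : {ae mu, forall x, setT x -> S x \is a fin_num} by exact: integrable_ae.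
have S0 x : (0 <= S x)%E by exact: le_trans (p0 x) (pS x).
have mA : measurable_fun setT (fun x => abs_sum (a^~ x)).
  by apply: measurableT_comp => //; exact: emeasurable_funB.
have iA : mu.-integrable setT (fun x => (abs_sum (a^~ x))%:E).
  apply: le_integrable iS => //; first exact/measurable_EFinP.
  move=> x _; rewrite (gee0_abs (S0 x)).
  (* Where [S] is infinite, [abs_sum] may be a default value, but the bound by [S] is then
     trivial. *)
  have [->|Sfin] := eqVneq (S x) +oo%E; first by rewrite leey.
  have Soo : (S x < +oo)%E by rewrite ltey.
  have pf : p x \is a fin_num by rewrite ge0_fin_numE // (le_lt_trans (pS x)).
  have nf : n x \is a fin_num by rewrite ge0_fin_numE // (le_lt_trans (nS x)).
  have sf : S x \is a fin_num by rewrite ge0_fin_numE.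
  rewrite (_ : abs_sum _ = fine (p x) - fine (n x)); last by rewrite -fineB.
  rewrite -[leRHS]fineK //= lee_fin ler_norml; apply/andP; split.
    rewrite lerBrDl (@le_trans _ _ 0) ?fine_ge0 // subr_le0.
    by rewrite fine_le.
  by rewrite lerBlDr (le_trans (fine_le _ _ (pS x))) // lerDl fine_ge0.
split=> //.
  apply: filterS aS => x /(_ Logic.I); rewrite ge0_fin_numE //.
have ia i : mu.-integrable setT (EFin \o a i).
  apply/integrableP; split; first exact/measurable_EFinP.
  apply: le_lt_trans fin.
  have := @esum_ge_seq R I (fun i => \int[mu]_x `|a i x|%:E)%E [:: i] isT.
  by rewrite big_seq1.
have ipos i : mu.-integrable setT (fun x => (pos_part (a i x))%:E).
  apply: le_integrable (ia i) => //; first exact/measurable_EFinP.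
  by move=> x _; rewrite lee_fin ger0_norm ?pos_part_ge0 // pos_part_le.
have ineg i : mu.-integrable setT (fun x => (pos_part (- a i x))%:E).
  apply: le_integrable (ia i) => //; first exact/measurable_EFinP.
  move=> x _; rewrite lee_fin ger0_norm ?pos_part_ge0 //.
  by rewrite -(normrN (a i x)) pos_part_le.
have EE (f : T -> R) : mu.-integrable setT (EFin \o f) ->
    ((\int[mu]_x f x)%:E = \int[mu]_x (f x)%:E)%E.
  by move=> fi; rewrite /Rintegral fineK //; exact: integrable_fin_num.
have lhs : \int[mu]_x abs_sum (a^~ x) =
    fine (\int[mu]_x p x - \int[mu]_x n x)%E.
  rewrite -integralB // /Rintegral; congr fine; apply: ae_eq_integral => //.
  - exact/measurable_EFinP.
  - exact: emeasurable_funB.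
  apply: filterS aS => x h xT; have := h xT; rewrite ge0_fin_numE // => Soo.
  have pf : p x \is a fin_num by rewrite ge0_fin_numE // (le_lt_trans (pS x)).
  have nf : n x \is a fin_num by rewrite ge0_fin_numE // (le_lt_trans (nS x)).
  by rewrite /abs_sum fineK // fin_numB pf nf.
have pE : (\int[mu]_x p x = \esum_(i in [set: I]) (\int[mu]_x pos_part (a i x))%:E)%E.
  rewrite integral_esum //.
  - by apply: eq_esum => i _; rewrite (EE _ (ipos i)).
  - by move=> i; exact/measurable_EFinP.
  - by move=> i x; rewrite lee_fin pos_part_ge0.
have nE : (\int[mu]_x n x = \esum_(i in [set: I]) (\int[mu]_x pos_part (- a i x))%:E)%E.
  rewrite integral_esum //.
  - by apply: eq_esum => i _; rewrite (EE _ (ineg i)).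
  - by move=> i; exact/measurable_EFinP.
  - by move=> i x; rewrite lee_fin pos_part_ge0.
have pfin : (\int[mu]_x p x)%E \is a fin_num by exact: integrable_fin_num.
have nfin : (\int[mu]_x n x)%E \is a fin_num by exact: integrable_fin_num.
rewrite lhs fineB // pE nE -abs_sum_diff.
- congr abs_sum; apply/funext => i; rewrite -(RintegralB measurableT (ipos i) (ineg i)).
  by apply: eq_Rintegral => x _; rewrite pos_partB.
- by move=> i; apply: Rintegral_ge0 => x _; exact: pos_part_ge0.
- by move=> i; apply: Rintegral_ge0 => x _; exact: pos_part_ge0.
- by rewrite -pE; move: pfin; rewrite fin_numElt => /andP[].
- by rewrite -nE; move: nfin; rewrite fin_numElt => /andP[].
Qed.

End countable_sums.

(** * Product integrals and sums over tuples *)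

Section tuple_integral.
Context {R : realType}.

Lemma tnth_tuple_consS s (p : measurableTypeR R * s.-tuple (measurableTypeR R)) (j : 'I_s) :
  tnth (tuple_cons p) (lift ord0 j) = tnth p.2 j.
Proof. by case: p => x t; rewrite tnthS. Qed.

Lemma prod_tuple_cons s (g : 'I_s.+1 -> R -> R) p :
  \prod_(j < s.+1) g j (tnth (tuple_cons p) j) =
  g ord0 p.1 * \prod_(j < s) g (lift ord0 j) (tnth p.2 j).
Proof.
rewrite big_ord_recl; congr (_ * _).
by apply: eq_bigr => j _; rewrite tnth_tuple_consS.
Qed.

Lemma measurable_tuple_prod s (g : 'I_s -> R -> R) :
  (forall j, measurable_fun setT (g j)) ->
  measurable_fun [set: s.-tuple (measurableTypeR R)]
    (fun x => \prod_(j < s) g j (tnth x j)).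
Proof.
move=> mg; apply: measurable_prod => j _.
exact: (measurableT_comp (mg j) (measurable_tnth j)).
Qed.

(** Induction along the recursive construction of [lebesgue_tuple], with Tonelli at each step. This
    case precedes the signed one because, applied to absolute values, it supplies the integrability
    that Fubini requires. *)
Lemma ge0_integral_tuple_prod s (g : 'I_s -> R -> R) (c : 'I_s -> R) :
  (forall j, measurable_fun setT (g j)) -> (forall j x, 0 <= g j x) ->
  (forall j, \int[@lebesgue_measure R]_x (g j x)%:E = (c j)%:E)%E ->
  (\int[lebesgue_tuple s]_x (\prod_(j < s) g j (tnth x j))%:E =
   (\prod_(j < s) c j)%:E)%E.
Proof.
elim: s g c => [|s IH] g c mg g0 gc.
  rewrite big_ord0 /= integral_dirac //=.
    by rewrite diracE mem_set // mul1e big_ord0.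
  by apply/measurable_EFinP; exact: measurable_tuple_prod.
rewrite /= /lebesgue_step ge0_integral_pushforward //=; last 3 first.
- exact: (measurable_cons measurable_fst measurable_snd).
- by apply/measurable_EFinP; exact: measurable_tuple_prod.
- by move=> x _; rewrite lee_fin prodr_ge0.
rewrite preimage_setT.
under eq_integral do rewrite /= prod_tuple_cons.
have mG : measurable_fun setT (fun p : measurableTypeR R * s.-tuple (measurableTypeR R) =>
    g ord0 p.1 * \prod_(j < s) g (lift ord0 j) (tnth p.2 j)).
  apply: measurable_funM.
    exact: (measurableT_comp (mg ord0) measurable_fst).
  exact: (measurableT_comp (measurable_tuple_prod (fun j => mg (lift ord0 j)))
    measurable_snd).
rewrite fubini_tonelli1 //=; last 2 first.
- exact/measurable_EFinP.
- by move=> p; rewrite lee_fin mulr_ge0 // prodr_ge0.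
rewrite /fubini_F /=.
under eq_integral => x _.
  under eq_integral do rewrite EFinM.
  rewrite ge0_integralZl //=; last 3 first.
  - apply/measurable_EFinP.
    exact: (measurable_tuple_prod (fun j => mg (lift ord0 j))).
  - by move=> y _; rewrite lee_fin prodr_ge0.
  - by rewrite lee_fin.
  rewrite (IH (fun j => g (lift ord0 j)) (fun j => c (lift ord0 j))) //.
  over.
rewrite ge0_integralZr //=; last 3 first.
- apply/measurable_EFinP; exact: mg.
- by move=> x _; rewrite lee_fin.
- rewrite lee_fin; apply: prodr_ge0 => j _; rewrite -lee_fin -gc.
  by apply: integral_ge0 => x _; rewrite lee_fin.
by rewrite gc -EFinM big_ord_recl.
Qed.

Lemma integrable_tuple_prod s (g : 'I_s -> R -> R) :
  (forall j, (@lebesgue_measure R).-integrable setT (EFin \o g j)) ->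
  (lebesgue_tuple s).-integrable setT
    (fun x => (\prod_(j < s) g j (tnth x j))%:E).
Proof.
move=> ig; have mg j : measurable_fun setT (g j).
  by apply/measurable_EFinP; exact: measurable_int (ig j).
apply/integrableP; split.
  by apply/measurable_EFinP; exact: measurable_tuple_prod.
under eq_integral do rewrite /= normr_prod.
rewrite (@ge0_integral_tuple_prod s (fun j x => `|g j x|)
  (fun j => \int[@lebesgue_measure R]_x `|g j x|)) ?ltry //.
- by move=> j; exact: measurableT_comp.
- move=> j; rewrite /Rintegral fineK //; apply: integrable_fin_num => //.
  exact: integrable_norm.
Qed.

Lemma Rintegral_tuple_prod s (g : 'I_s -> R -> R) :
  (forall j, (@lebesgue_measure R).-integrable setT (EFin \o g j)) ->
  \int[lebesgue_tuple s]_x (\prod_(j < s) g j (tnth x j)) =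
  \prod_(j < s) \int[@lebesgue_measure R]_x g j x.
Proof.
elim: s g => [|s IH] g ig.
  rewrite big_ord0 /= /Rintegral integral_dirac //=.
    by rewrite indicE mem_set // mul1r big_ord0.
  by apply/measurable_EFinP; apply: measurable_tuple_prod => -[].
have iF := integrable_tuple_prod ig.
have mcons : measurable_fun setT (@tuple_cons R s).
  exact: (measurable_cons measurable_fst measurable_snd).
have iG : (lebesgue_measure \x lebesgue_tuple s)%E.-integrable setT
    (fun p : measurableTypeR R * s.-tuple (measurableTypeR R) =>
      (\prod_(j < s.+1) g j (tnth (tuple_cons p) j))%:E).
  have [mF foo] := integrableP _ _ _ iF.
  apply/integrableP; split; first exact: measurableT_comp mF _.
  apply: le_lt_trans foo; rewrite /= /lebesgue_step ge0_integral_pushforward //=.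
  apply/measurable_EFinP; apply: measurableT_comp => //; exact/measurable_EFinP.
rewrite /Rintegral /= /lebesgue_step integral_pushforward //=.
rewrite preimage_setT -integral12_prod_meas1 //= /fubini_F.
under eq_integral => x _.
  under eq_integral => y _ do rewrite /= prod_tuple_cons EFinM /=.
  rewrite integralZl //=; last exact: integrable_tuple_prod (fun j => ig (lift ord0 j)).
  rewrite -[X in (_ * X)%E](@fineK _ (integral _ _ _)); last first.
    apply: integrable_fin_num => //.
    exact: integrable_tuple_prod (fun j => ig (lift ord0 j)).
  rewrite -/(Rintegral _ _ _) (IH (fun j => g (lift ord0 j))) //.
  over.
rewrite integralZr //=; last exact: (ig ord0).
  rewrite fineM //= ?big_ord_recl //.
  by apply: integrable_fin_num => //; exact: (ig ord0).
exact: measurable_int iF.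
Qed.

End tuple_integral.

Lemma esum_tuple_prod_le {R : realType} s (u : 'I_s -> nat -> R) (M : 'I_s -> R) :
  (forall j n, 0 <= u j n) ->
  (forall j, \esum_(n in [set: nat]) (u j n)%:E <= (M j)%:E)%E ->
  (\esum_(k in [set: s.-tuple nat]) (\prod_(j < s) u j (tnth k j))%:E <=
   (\prod_(j < s) M j)%:E)%E.
Proof.
elim: s u M => [|s IH] u M u0 uM.
  rewrite (_ : [set: 0.-tuple nat] = [set [tuple]]); last first.
    by apply/seteqP; split => // t _ /=; exact: tuple0.
  by rewrite esum_set1 !big_ord0 // lee_fin.
pose e (p : nat * s.-tuple nat) := [tuple of p.1 :: p.2].
have ebij : set_bij setT setT e.
  split=> // [[n k] [m l] _ _ /(congr1 val)/= [-> /val_inj->]//|t _].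
  exists (thead t, [tuple of behead t]) => //=.
  by rewrite /e /= [RHS]tuple_eta.
have M0 j : 0 <= M j.
  rewrite -lee_fin (le_trans _ (uM j)) //; apply: esum_ge0 => n _.
  by rewrite lee_fin.
rewrite (reindex_esum _ _ _ _ ebij).
rewrite (_ : [set: nat * s.-tuple nat] = [set: nat] `*`` (fun=> [set: s.-tuple nat])); last first.
  by apply/seteqP; split.
pose a n (k : s.-tuple nat) := (u ord0 n * \prod_(j < s) u (lift ord0 j) (tnth k j))%:E.
rewrite (eq_esum (b := fun p => a p.1 p.2)); last first.
  move=> [n k] _ /=; rewrite /a /e big_ord_recl; congr (_ * _)%:E.
  by apply: eq_bigr => j _; rewrite tnthS.
rewrite -esum_esum; last by move=> n k _ _; rewrite lee_fin mulr_ge0 // prodr_ge0.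
apply: (@le_trans _ _ (\esum_(n in [set: nat]) ((u ord0 n)%:E *
    (\prod_(j < s) M (lift ord0 j))%:E))%E).
  apply: le_esum => n _; rewrite /a; under eq_esum do rewrite EFinM.
  rewrite esumZ // => [|k]; last by rewrite lee_fin prodr_ge0.
  by rewrite lee_wpmul2l ?lee_fin //;
    apply: (IH (fun j => u (lift ord0 j)) (fun j => M (lift ord0 j))).
under eq_esum do rewrite muleC.
rewrite esumZ ?prodr_ge0 // => [|n]; last by rewrite lee_fin.
rewrite big_ord_recl EFinM muleC; apply: lee_wpmul2r => //.
by rewrite lee_fin prodr_ge0.
Qed.

(** * Bounds on the Fourier weights *)

Section power_series.
Context {R : realType}.
Implicit Types (q : R).

(** With d = q - 1, division by (k+1)^(-d) leaves (1 - 1/(k+1))^(-d) >= 1 + d/(k+1), which follows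
    from e^x >= 1 + x and ln(1 - x) <= -x. *)
Lemma powRN_telescope q (k : nat) : 1 < q -> (0 < k)%N ->
  (q - 1) * k.+1%:R `^ (- q) <= k%:R `^ (1 - q) - k.+1%:R `^ (1 - q).
Proof.
move=> q1 k0; set d := q - 1; have d0 : 0 < d by rewrite subr_gt0.
have kS0 : 0 < k.+1%:R :> R by rewrite ltr0n.
have k0' : 0 < k%:R :> R by rewrite ltr0n.
have -> : 1 - q = - d by rewrite opprB.
have -> : k.+1%:R `^ (- q) = k.+1%:R `^ (- d) / k.+1%:R.
  rewrite -[X in _ / X](powRr1 (ltW kS0)) -powRN -powRD; last first.
    by rewrite (gt_eqF kS0) implybT.
  by congr (_ `^ _); rewrite /d; ring.
have -> : k%:R `^ (- d) = k.+1%:R `^ (- d) * (k%:R / k.+1%:R) `^ (- d).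
  by rewrite -powRM ?divr_ge0 // mulrCA divff ?gt_eqF // mulr1.
rewrite mulrCA -[X in _ <= _ - X]mulr1 -mulrBr ler_wpM2l ?powR_ge0 //.
rewrite lerBrDl /powR gt_eqF ?divr_gt0 //.
apply: le_trans (expR_ge1Dx _) _; rewrite ler_expR mulNr -mulrN ler_wpM2l ?(ltW d0) //.
rewrite lerNr (_ : k%:R / k.+1%:R = 1 - k.+1%:R^-1); last first.
  by apply: (mulIf (lt0r_neq0 kS0)); rewrite mulrBl divfK ?gt_eqF // mulVf ?gt_eqF // mul1r -natr1 addrK.
by rewrite le_ln1Dx // ltrN2 invf_lt1 // ltr1n ltnS.
Qed.

Lemma esum_powRN_le q : 1 < q ->
  (\esum_(k in [set: nat]) (if k == 0%N then 0 else k%:R `^ (- q))%:E <=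
   (1 + (q - 1)^-1)%:E)%E.
Proof.
move=> q1; have d0 : 0 < q - 1 by rewrite subr_gt0.
have u0 k : 0 <= (if k == 0%N then 0 else k%:R `^ (- q)) :> R.
  by case: ifP => // _; exact: powR_ge0.
rewrite -nneseries_esumT; last by move=> k; rewrite lee_fin.
apply: lime_le; first by apply: is_cvg_nneseries => k _ _; rewrite lee_fin.
apply: nearW => n; rewrite sumEFin lee_fin.
(* The telescoped remainder stays in the bound so that the induction closes; the leading 1 is the
   term k = 1. *)
suff h m : \sum_(0 <= k < m.+2) (if k == 0%N then 0 else k%:R `^ (- q)) <=
    1 + (q - 1)^-1 * (1 - m.+1%:R `^ (1 - q)).
  apply: (@le_trans _ _ (\sum_(0 <= k < n.+2) (if k == 0%N then 0 else k%:R `^ (- q)))).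
    by rewrite [leRHS](@big_cat_nat _ _ _ n) //= ?lerDl ?sumr_ge0 // leqW.
  apply: le_trans (h n) _; rewrite lerD2l -[leRHS]mulr1 ler_wpM2l ?invr_ge0 ?(ltW d0) //.
elim: m => [|m IH].
  by rewrite big_nat_recl // big_nat1 /= !powR1 add0r subrr mulr0 addr0.
rewrite big_nat_recr //= (le_trans (lerD IH (lexx _))) // -addrA lerD2l.
rewrite [leRHS](_ : _ = (q - 1)^-1 * (1 - m.+1%:R `^ (1 - q)) +
  (q - 1)^-1 * (m.+1%:R `^ (1 - q) - m.+2%:R `^ (1 - q))); last by ring.
by rewrite lerD2l ler_pdivlMl //; exact: powRN_telescope.
Qed.

End power_series.

(** * Comparison of Gamma values with factorials *)

Section gamma_bound.
Context {R : realType}.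
Local Notation mu := (@lebesgue_measure R).

(* Chosen so that [- exp_poly n * exp(-t)] is an antiderivative of
   [t^n * exp(-t)]. *)
Fixpoint exp_poly (n : nat) : {poly R} :=
  if n is n'.+1 then 'X^n + n%:R *: exp_poly n' else 1.

Lemma exp_polyE n : exp_poly n - (exp_poly n)^`() = 'X^n.
Proof.
elim: n => [|n IH]; first by rewrite /= derivC subr0 expr0.
rewrite [exp_poly n.+1]/= derivD derivZ derivXn /=.
rewrite opprD addrACA -scalerBr IH.
by rewrite scaler_nat subrK.
Qed.

Lemma exp_poly0 n : (exp_poly n).[0] = n`!%:R.
Proof.
elim: n => [|n IH]; first by rewrite hornerC.
by rewrite /= hornerD hornerZ hornerXn IH expr0n /= add0r -natrM -factS.
Qed.

Lemma exp_poly_bound n : exists C : R, forall t, 0 <= t ->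
  0 <= (exp_poly n).[t] <= C * expR (t / 2).
Proof.
have eb (m : nat) (t : R) : 0 <= t -> t ^+ m <= 2 ^+ m * m`!%:R * expR (t / 2).
  move=> t0; have t2 : 0 <= t / 2 by rewrite divr_ge0.
  rewrite -[X in X ^+ m](divfK (_ : 2 != 0 :> R)) ?pnatr_eq0 // exprMn mulrC -mulrA.
  by rewrite ler_wpM2l ?exprn_ge0 // exprn_le_expR.
elim: n => [|n [C IH]].
  by exists 1 => t t0; rewrite hornerC ler01 mul1r -[leLHS]expR0 ler_expR divr_ge0.
exists (2 ^+ n.+1 * n.+1`!%:R + n.+1%:R * C) => t t0; have /andP[h1 h2] := IH _ t0.
rewrite /= hornerD hornerZ hornerXn; apply/andP; split.
  by rewrite addr_ge0 ?exprn_ge0 // mulr_ge0.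
by rewrite mulrDl lerD ?eb // -mulrA ler_wpM2l.
Qed.

Lemma integral_exprn_expR n :
  (\int[mu]_(t in `]0%R, +oo[) (t ^+ n * expR (- t))%:E = (n`!%:R)%:E)%E.
Proof.
pose f (t : R) := t ^+ n * expR (- t).
pose F (t : R) := - ((exp_poly n).[t] * expR (- t)).
have dF t : is_derive t (1 : R) F (f t).
  have de : is_derive t (1 : R) (fun x : R => expR (- x)) (- expR (- t)).
    have := @is_derive1_comp R expR -%R t _ _ (is_derive_expR _) (is_deriveNid t 1).
    by rewrite mulrN1.
  have := is_deriveN (is_deriveM (is_derive_poly (exp_poly n) t) de).
  move=> h; apply: (trigger_derive h).
  rewrite /f -hornerXn -exp_polyE hornerD hornerN /GRing.scale /=; ring.
have cF : continuous F.
  move=> t; apply/differentiable_continuous/derivable1_diffP.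
  by have [] := dF t.
have cf : continuous f.
  move=> t; apply: cvgM; first exact: exprn_continuous.
  apply: (@continuous_comp _ _ _ -%R expR); first exact: opp_continuous.
  exact: continuous_expR.
have -> : (n`!%:R)%:E = ((0 : R)%:E - (F 0)%:E)%E.
  by rewrite /F exp_poly0 oppr0 expR0 mulr1 -EFinB sub0r opprK.
rewrite -(@ge0_continuous_FTC2y R f F 0 0).
- rewrite -integral_itv_obnd_cbnd //.
  by apply/measurable_EFinP; apply: measurable_funTS; exact: continuous_measurable_fun.
- by move=> x x0; rewrite mulr_ge0 ?exprn_ge0 ?expR_ge0.
- exact: continuous_subspaceT.
- have [C CP] := exp_poly_bound n.
  apply/norm_cvg0P.
  apply: (@squeeze_cvgr _ _ _ _ (cst 0) (fun t => C * expR (- (t * 2^-1)))).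
  + near=> t; have t0 : 0 <= t by near: t; exact: nbhs_pinfty_ge.
    have /andP[h1 h2] := CP _ t0.
    rewrite normr_ge0 /= normrN ger0_norm ?mulr_ge0 ?expR_ge0 //.
    rewrite (le_trans (ler_wpM2r _ h2)) ?expR_ge0 // -mulrA -expRD.
    by rewrite (_ : t / 2 - t = - (t * 2^-1)) //; lra.
  + exact: cvg_cst.
  + rewrite -[0 in X in _ --> X](mulr0 C); apply: cvgM; first exact: cvg_cst.
    apply: (@cvg_comp _ _ _ (fun t : R => t * 2^-1) (fun t => expR (- t)) _ +oo).
      by apply: gt0_cvgMly; [rewrite invr_gt0|exact: cvg_id].
    exact: cvgr_expR.
- by move=> x _; have [] := dF x.
- exact: cvg_at_right_filter (cF 0).
- by move=> x _; rewrite derive1E; have [_ ->] := dF x.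
Unshelve. all: by end_near. Qed.

(** Each of the [a] factors of the falling factorial is at least k - a + 1, and k <= a (k - a +
    1). *)
Lemma expn_le_ffact (a k : nat) : (0 < a)%N -> (a <= k)%N ->
  (k ^ a <= a ^ a * k ^_ a)%N.
Proof.
move=> a0 ak; apply: (@leq_trans ((a * (k - a).+1) ^ a)).
  by rewrite leq_exp2r // mulnS -leq_subLR leq_pmull.
rewrite expnMn leq_mul2l; apply/orP; right.
have : forall i, (i <= a)%N -> ((k - a).+1 ^ i <= k ^_ i)%N.
  elim=> [|i IH] ia //; rewrite expnSr ffactnSr leq_mul ?IH ?(ltnW ia) //.
  by rewrite ltn_sub2l // (leq_trans ia).
exact.
Qed.

(** Bounds a real power of [t] by two integer powers, whose integrals against e^(-t) are factorials.
    For t >= x compare t^(-alpha) with x^(-alpha); for t < x compare t^(a - alpha) with x^(a -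
    alpha). *)
Lemma powR_mix (t x alpha : R) (a k : nat) : 0 < t -> 0 < x ->
  0 <= alpha <= a%:R -> (a <= k)%N ->
  t `^ (k%:R - alpha) <= x `^ (- alpha) * (t ^+ k + x ^+ a * t ^+ (k - a)).
Proof.
move=> t0 x0 /andP[al0 ala] ak; rewrite mulrDr.
have [xt|tx] := leP x t.
  rewrite (@le_trans _ _ (x `^ (- alpha) * t ^+ k)) //; last first.
    by rewrite lerDl !(mulr_ge0, powR_ge0, exprn_ge0) ?(ltW x0) ?(ltW t0).
  rewrite powRD; last by rewrite (gt_eqF t0) implybT.
  rewrite powR_mulrn ?(ltW t0) // mulrC ler_wpM2r ?exprn_ge0 ?(ltW t0) //.
  rewrite !powRN lef_pV2 ?posrE ?powR_gt0 //.
  by apply: ge0_ler_powR; rewrite ?nnegrE ?(ltW x0) ?(ltW t0).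
rewrite (@le_trans _ _ (x `^ (- alpha) * (x ^+ a * t ^+ (k - a)))) //; last first.
  by rewrite lerDr !(mulr_ge0, powR_ge0, exprn_ge0) ?(ltW x0) ?(ltW t0).
have -> : k%:R - alpha = (a%:R - alpha) + (k - a)%:R by rewrite natrB //; ring.
rewrite powRD; last by rewrite (gt_eqF t0) implybT.
rewrite powR_mulrn ?(ltW t0) // mulrA ler_wpM2r ?exprn_ge0 ?(ltW t0) //.
rewrite -powR_mulrn ?(ltW x0) // -powRD; last by rewrite (gt_eqF x0) implybT.
rewrite addrC; apply: ge0_ler_powR; rewrite ?nnegrE ?subr_ge0 ?(ltW x0) ?(ltW t0) ?(ltW tx) //.
by rewrite addrC subr_ge0.
Qed.

(** Integrate [powR_mix] at x = k, the scale where the mass of t^k e^(-t) sits. This gives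
    k^(-alpha) (k! + k^a (k-a)!), and k^a (k-a)! <= a^a k!. *)
Lemma Gamma_le (alpha : R) (a k : nat) : 0 <= alpha <= a%:R -> (0 < a <= k)%N ->
  0 <= Gamma (k%:R - alpha + 1) <=
  k%:R `^ (- alpha) * (k`!%:R * (1 + (a ^ a)%:R)).
Proof.
move=> /andP[al0 ala] /andP[a0 ak].
have k0 : 0 < k%:R :> R by rewrite ltr0n (leq_trans a0).
have g0 : (0 <= \int[mu]_(t in `]0%R, +oo[)
    (t `^ (k%:R - alpha + 1 - 1) * expR (- t))%:E)%E.
  by apply: integral_ge0 => t _; rewrite lee_fin mulr_ge0 ?powR_ge0 ?expR_ge0.
have le : (\int[mu]_(t in `]0%R, +oo[)
      (t `^ (k%:R - alpha + 1 - 1) * expR (- t))%:E <=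
    (k%:R `^ (- alpha) * (k`!%:R + (k ^ a)%:R * (k - a)`!%:R))%:E)%E.
  rewrite EFinM EFinD EFinM -!integral_exprn_expR.
  have mt (n : nat) : measurable_fun (`]0%R, +oo[%classic : set R)
      (fun t : R => (t ^+ n * expR (- t))%:E).
    apply/measurable_EFinP; apply: measurable_funM; first exact: measurable_funX.
    by apply: measurableT_comp => //; exact: measurableT_comp.
  have p0 (n : nat) (t : R) : (`]0%R, +oo[%classic : set R) t -> (0 <= (t ^+ n * expR (- t))%:E)%E.
    rewrite /= in_itv /= andbT => t0.
    by rewrite lee_fin mulr_ge0 ?expR_ge0 // exprn_ge0 // ltW.
  rewrite -ge0_integralZl //; [|exact: mt|exact: p0].
  rewrite -ge0_integralD //; last 4 first.
  - exact: p0.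
  - exact: mt.
  - by move=> t t0; rewrite mule_ge0 ?p0 // lee_fin.
  - by apply: measurable_funeM; exact: mt.
  rewrite -ge0_integralZl //; last 2 first.
  - by apply: emeasurable_funD; [exact: mt|apply: measurable_funeM; exact: mt].
  - by move=> t t0; rewrite adde_ge0 ?p0 // mule_ge0 ?p0 // lee_fin.
  apply: ge0_le_integral => //.
  - by move=> t t0; rewrite lee_fin mulr_ge0 ?powR_ge0 ?expR_ge0.
  - apply/measurable_EFinP; apply: measurable_funM.
      by apply: measurable_funTS; exact: measurable_powR.
    by apply: measurableT_comp => //; exact: measurableT_comp.
  - apply: measurable_funeM; apply: emeasurable_funD; first exact: mt.
    by apply: measurable_funeM; exact: mt.
  move=> t; rewrite /= in_itv /= andbT => t0.
  rewrite -[leRHS]/((k%:R `^ (- alpha) * (t ^+ k * expR (- t) +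
    (k ^ a)%:R * (t ^+ (k - a) * expR (- t))))%:E) lee_fin addrK.
  rewrite (mulrA (k ^ a)%:R) -mulrDl mulrA ler_wpM2r ?expR_ge0 // natrX.
  by apply: powR_mix => //; rewrite al0.
rewrite /Gamma /Rintegral; apply/andP; split; first exact: fine_ge0.
rewrite -[leRHS]/(fine _%:E) fine_le //.
  by rewrite ge0_fin_numE // (le_lt_trans le) // ltry.
apply: (le_trans le); rewrite lee_fin ler_wpM2l ?powR_ge0 //.
rewrite mulrDr mulr1 lerD2l -!natrM ler_nat.
rewrite -(ffact_fact ak) [leqRHS]mulnC mulnA leq_mul2r; apply/orP; right.
exact: expn_le_ffact.
Qed.

End gamma_bound.

(** * Decay of the three weights and sums of their powers *)

Section weights.
Context {R : realType}.

Lemma weight_r_bound (alpha : R) : 1 < alpha ->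
  exists2 C : R, 0 <= C & forall g, 0 < g <= 1 ->
  [/\ weight_r alpha g 0 = 1, forall k, 0 <= weight_r alpha g k &
    forall k, (0 < k)%N -> weight_r alpha g k <= C * (g * k%:R `^ (- alpha))].
Proof.
move=> al1; have al0 : 0 < alpha by exact: lt_trans al1.
have exa : exists n : nat, alpha <= n%:R.
  by exists (Num.bound alpha); rewrite ltW // archi_boundP // ltW.
(* Minimality of [a] turns alpha <= k into a <= k, so the second branch of the weight meets the
   hypotheses of [Gamma_le]. *)
have [a ala ka] := ex_minnP exa.
have a0 : (0 < a)%N by rewrite -(ltr_nat R) (lt_le_trans al0).
exists (1 + (a ^ a)%:R); first by rewrite addr_ge0.
move=> g /andP[g0 g1].
have fact0' k : 0 < k`!%:R :> R by rewrite ltr0n fact_gt0.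
split.
- by rewrite /weight_r eqxx.
- move=> k; rewrite /weight_r; case: ifP => // k0; case: ifPn => [_|].
    by rewrite mulr_ge0 ?invr_ge0 ?(ltW g0).
  rewrite -leNgt => /ka ak; have := @Gamma_le R alpha a k.
  rewrite (ltW al0) ala a0 ak => /(_ isT isT)/andP[G0 _].
  by rewrite mulr_ge0 ?(ltW g0) // divr_ge0.
move=> k k0; rewrite /weight_r gtn_eqF //.
have kR : 0 < k%:R :> R by rewrite ltr0n.
(* For k < alpha, the bound is 1/k! <= 1 <= a^a k^(-alpha). *)
case: ifPn => [kal|].
  rewrite mulrCA ler_pM2l // (@le_trans _ _ 1) //.
    by rewrite invf_le1 // ler1n fact_gt0.
  rewrite powRN ler_pdivlMr ?powR_gt0 // mul1r.
  apply: (@le_trans _ _ (a%:R `^ alpha)).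
    apply: ge0_ler_powR; rewrite ?nnegrE ?(ltW al0) //.
    exact: le_trans (ltW kal) ala.
  apply: (@le_trans _ _ (a%:R `^ a%:R)); first by rewrite ler_powR // ler1n.
  by rewrite powR_mulrn // -natrX lerDr.
rewrite -leNgt => /ka ak; have := @Gamma_le R alpha a k.
rewrite (ltW al0) ala a0 ak => /(_ isT isT)/andP[_ G1].
rewrite [leRHS]mulrCA ler_pM2l // ler_pdivrMr // (le_trans G1) //.
by rewrite [leRHS](_ : _ = k%:R `^ (- alpha) * (k`!%:R * (1 + (a ^ a)%:R))) //; ring.
Qed.

Lemma weight_rho_bound (alpha : R) :
  exists2 C : R, 0 <= C & forall g, 0 < g <= 1 ->
  [/\ weight_rho alpha g 0 = 1, forall k, 0 <= weight_rho alpha g k &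
    forall k, (0 < k)%N -> weight_rho alpha g k <= C * (g * k%:R `^ (- alpha))].
Proof.
exists 1 => // g /andP[g0 g1]; split.
- by rewrite /weight_rho eqxx.
- move=> k; rewrite /weight_rho; case: ifP => // _.
  by rewrite mulr_ge0 ?(ltW g0) ?powR_ge0.
- by move=> k k0; rewrite /weight_rho gtn_eqF // mul1r.
Qed.

(** One term of the sum is enough: for k >= a the last one, a falling factorial comparable with k^a;
    for k < a the first one, which is at least 1 while k^a <= a^a. The number [x] in [key] is this
    term. *)
Lemma weight_psi_bound (a : nat) : (0 < a)%N ->
  exists2 C : R, 0 <= C & forall g, 0 < g <= 1 ->
  [/\ weight_psi a g 0 = 1, forall k, 0 <= weight_psi a g k &
    forall k, (0 < k)%N -> weight_psi a g k <= C * (g * k%:R `^ (- a%:R))].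
Proof.
move=> a0; exists ((a ^ a)%:R) => // g /andP[g0 g1].
have b0 tau k : 0 <= beta_psi tau k :> R.
  by rewrite /beta_psi; case: ifP => // _; rewrite divr_ge0.
have beta_ffact tau k : (tau <= k)%N -> beta_psi tau k = (k ^_ tau)%:R :> R.
  move=> tk; rewrite /beta_psi tk -(ffact_fact tk) natrM mulfK //.
have S0 k : 0 <= \sum_(1 <= tau < a.+1) beta_psi tau k :> R by exact: sumr_ge0.
split.
- rewrite /weight_psi big_nat_cond big1 ?mulr0 ?addr0 ?invr1 // => tau.
  rewrite andbT => /andP[t0 _].
  by rewrite /beta_psi leqNgt t0.
- by move=> k; rewrite /weight_psi invr_ge0 addr_ge0 // mulr_ge0 // invr_ge0 ltW.
move=> k k0; have kR : 0 < k%:R :> R by rewrite ltr0n.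
have key (x : R) : 0 < x -> (k ^ a)%:R <= (a ^ a)%:R * x ->
    x <= \sum_(1 <= tau < a.+1) beta_psi tau k ->
    weight_psi a g k <= (a ^ a)%:R * (g * k%:R `^ (- a%:R)).
  move=> x0 kx xS; rewrite /weight_psi powRN powR_mulrn // -natrX.
  apply: (@le_trans _ _ (g / x)).
    rewrite -[leRHS]invrK invf_div lef_pV2 ?posrE ?divr_gt0 //; last first.
      rewrite (lt_le_trans ltr01) // lerDl mulr_ge0 // invr_ge0 ltW //.
    rewrite mulrC (@le_trans _ _ (g^-1 * \sum_(1 <= tau < a.+1) beta_psi tau k)) //.
      by rewrite ler_pM2l // invr_gt0.
    by rewrite lerDr.
  rewrite mulrCA ler_pM2l // ler_pdivlMr ?ltr0n ?expn_gt0 ?k0 //.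
  by rewrite mulrC ler_pdivrMr.
have [ak|ka] := leqP a k.
  apply: (key (k ^_ a)%:R); first by rewrite ltr0n ffact_gt0.
    by rewrite -natrM ler_nat expn_le_ffact.
  by rewrite -beta_ffact // big_nat_recr //= lerDr sumr_ge0.
apply: (key 1) => //; first by rewrite mulr1 ler_nat leq_exp2r // ltnW.
rewrite big_ltn // (@le_trans _ _ (beta_psi 1 k)) //.
  by rewrite beta_ffact // ffactn1 ler1n.
by rewrite lerDl sumr_ge0.
Qed.

Lemma fourier_weight_bound (alpha : R) w : 1 < alpha -> is_fourier_weight alpha w ->
  exists2 C : R, 0 <= C & forall g, 0 < g <= 1 ->
  [/\ w g 0 = 1, forall k, 0 <= w g k &
    forall k, (0 < k)%N -> w g k <= C * (g * k%:R `^ (- alpha))].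
Proof.
move=> al1 [->|->|[a alE ->]]; first exact: weight_r_bound.
  exact: weight_rho_bound.
rewrite alE; apply: weight_psi_bound; rewrite -(ltr_nat R) -alE.
exact: lt_trans al1.
Qed.

Lemma powR_prod (I : Type) (r : seq I) (P : pred I) (F : I -> R) (p : R) :
  (forall i, P i -> 0 <= F i) ->
  (\prod_(i <- r | P i) F i) `^ p = \prod_(i <- r | P i) F i `^ p.
Proof.
move=> F0; elim: r => [|i r IH]; first by rewrite !big_nil powR1.
rewrite !big_cons; case: ifPn => // Pi.
by rewrite powRM ?IH ?F0 // prodr_ge0.
Qed.

Lemma esum_weight_powR (alpha p : R) w : 1 < alpha -> is_fourier_weight alpha w ->
  0 < p -> 1 < alpha * p ->
  exists2 c : R, 0 <= c & forall g, 0 < g <= 1 ->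
  (\esum_(k in [set: nat]) (w g k `^ p)%:E <= (1 + c * g `^ p)%:E)%E.
Proof.
move=> al1 ww p0 ap1; have [C C0 Cw] := fourier_weight_bound al1 ww.
(* C^p comes from the pointwise bound on the weights, the other factor bounds zeta(alpha p). *)
exists (C `^ p * (1 + (alpha * p - 1)^-1)).
  by rewrite mulr_ge0 ?powR_ge0 // addr_ge0 // invr_ge0 subr_ge0 ltW.
move=> g /[dup] g01 /andP[g0 g1]; have [w0 wge wle] := Cw _ g01.
pose v (k : nat) : R := if k == 0%N then 0 else k%:R `^ (- (alpha * p)).
have v0 k : 0 <= v k by rewrite /v; case: ifP => // _; exact: powR_ge0.
apply: (@le_trans _ _ (\esum_(k in [set: nat])
   ((k == 0%N)%:R%:E + (C `^ p * g `^ p)%:E * (v k)%:E))%E).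
  apply: le_esum => k _; rewrite -EFinM -EFinD lee_fin /v.
  have [->|k0] := eqVneq k 0%N; first by rewrite w0 powR1 mulr0 addr0.
  rewrite add0r -powRM ?(ltW g0) //.
  rewrite -mulNr powRrM -powRM ?powR_ge0 //; last by rewrite mulr_ge0 // ltW.
  apply: ge0_ler_powR; rewrite ?nnegrE ?(ltW p0) ?wge //.
    by rewrite !(mulr_ge0, powR_ge0) // ltW.
  by rewrite -mulrA wle // lt0n.
rewrite esumD; last 2 first.
- by move=> k _; rewrite lee_fin.
- by move=> k _; rewrite -EFinM lee_fin !mulr_ge0 ?powR_ge0.
rewrite EFinD leeD //.
  rewrite (_ : (\esum_(k in [set: nat]) (k == 0%N)%:R%:E)%E =
     (\esum_(k in [set: nat]) (if k \in [set 0%N] then 1 else 0))%E).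
    by rewrite -esum_mkcond esum_set1.
  apply: eq_esum => k _; have [->|k0] := eqVneq k 0%N; first by rewrite mem_set.
  by rewrite memNset // => k0'; rewrite k0' eqxx in k0.
rewrite esumZ; last 2 first.
- by rewrite mulr_ge0 ?powR_ge0.
- by move=> k; rewrite lee_fin.
rewrite [leRHS](_ : _ = (C `^ p * g `^ p)%:E * (1 + (alpha * p - 1)^-1)%:E)%E; last first.
  by rewrite -EFinM; congr EFin; ring.
by apply: lee_wpmul2l; [rewrite lee_fin mulr_ge0 ?powR_ge0|exact: esum_powRN_le].
Qed.

Lemma esum_weight_prod_powR (alpha p : R) w : 1 < alpha -> is_fourier_weight alpha w ->
  0 < p -> 1 < alpha * p ->
  exists2 c : R, 0 <= c & forall gamma, (forall j : nat, 0 < gamma j <= 1) -> forall s,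
  (\esum_(k in [set: s.-tuple nat]) (weight_prod w gamma k `^ p)%:E <=
   (expR (c * \sum_(j < s) gamma j `^ p))%:E)%E.
Proof.
move=> al1 ww p0 ap1; have [C C0 Cw] := fourier_weight_bound al1 ww.
have [c c0 cw] := esum_weight_powR al1 ww p0 ap1.
exists c => // gamma g01 s.
under eq_esum => k _.
  rewrite /weight_prod powR_prod; last by move=> i _; have [_ ->] := Cw _ (g01 i).
  over.
apply: le_trans (@esum_tuple_prod_le R s (fun j n => w (gamma j) n `^ p)
  (fun j => 1 + c * gamma j `^ p) _ _) _.
- by move=> j n; exact: powR_ge0.
- by move=> j; exact: cw.
rewrite lee_fin mulr_sumr expR_sum; apply: ler_prod => j _.
by rewrite expR_ge1Dx addr_ge0 // mulr_ge0 ?powR_ge0.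
Qed.

End weights.

(** * The Hermite kernel *)

Lemma ae_imply d (T : measurableType d) (R : realType)
    (mu : {measure set T -> \bar R}) (A B : T -> Prop) :
  (forall x, A x -> B x) -> {ae mu, forall x, A x} -> {ae mu, forall x, B x}.
Proof. by move=> AB; apply: filterS. Qed.

Lemma ae_le_Rintegral d (T : measurableType d) (R : realType)
    (mu : {measure set T -> \bar R}) (f g : T -> R) :
  mu.-integrable setT (EFin \o f) -> mu.-integrable setT (EFin \o g) ->
  {ae mu, forall x, f x <= g x} -> \int[mu]_x f x <= \int[mu]_x g x.
Proof.
move=> fi gi fg; rewrite -subr_ge0 -RintegralB // /Rintegral.
have di : mu.-integrable setT (EFin \o (g \- f)) := integrableB measurableT gi fi.
have md : measurable_fun setT (EFin \o (g \- f)) := measurable_int _ di.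
rewrite (@ae_eq_integral _ _ _ mu setT (fun x => (Num.max (g x - f x) 0)%:E)) //.
- by apply: fine_ge0; apply: integral_ge0 => x _; rewrite lee_fin le_max lexx orbT.
- by apply/measurable_EFinP; apply: measurable_maxr => //; exact/measurable_EFinP.
- by apply: filterS fg => x fgx _; rewrite max_l // subr_ge0.
Qed.

Section hermite_kernel.
Context {R : realType} (s : nat).
Local Notation T := (s.-tuple (measurableTypeR R)).
Local Notation mu := (@lebesgue_tuple R s).
Implicit Types (k l : s.-tuple nat) (f g : s.-tuple R -> R).

Definition tuple0s : s.-tuple nat := [tuple 0%N | j < s].

Lemma hermite_prod0 (x : s.-tuple R) : hermite_prod tuple0s x = 1.
Proof. by rewrite /hermite_prod big1 // => j _; rewrite tnth_mktuple hermite0. Qed.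

Lemma gauss_density_prod_gt0 (x : s.-tuple R) : 0 < gauss_density_prod x.
Proof. by apply: prodr_gt0 => j _; exact: gauss_density_gt0. Qed.

Lemma measurable_hermite_prod k : measurable_fun [set: T] (hermite_prod k).
Proof.
apply: (measurable_tuple_prod (g := fun j => hermite (tnth k j))) => j.
exact: measurable_hermite.
Qed.

Lemma measurable_gauss_density_prod : measurable_fun [set: T] (@gauss_density_prod R s).
Proof.
apply: (measurable_tuple_prod (g := fun j => gauss_density)) => j.
exact: measurable_gauss_density.
Qed.

Lemma measurable_gauss_density_prodV :
  measurable_fun [set: T] (fun x => (gauss_density_prod x)^-1).
Proof.
rewrite (_ : (fun _ => _) = fun x : T => \prod_(j < s)
    (Num.sqrt (2 * pi) * expR ((tnth x j : R) ^+ 2 / 2))).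
  apply: (measurable_tuple_prod (g := fun _ t => Num.sqrt (2 * pi) * expR (t ^+ 2 / 2))) => _.
  apply: measurable_funM => //; apply: measurableT_comp => //.
  by apply: measurable_funM => //; exact: measurable_funX.
apply/funext => x; rewrite -prodfV; apply: eq_bigr => j _.
by rewrite /gauss_density invfM invrK -expRN mulNr opprK.
Qed.

Lemma hermite_prodMM k l (x : s.-tuple R) :
  hermite_prod k x * hermite_prod l x * gauss_density_prod x =
  \prod_(j < s) (hermite (tnth k j) (tnth x j) * hermite (tnth l j) (tnth x j)
    * gauss_density (tnth x j)).
Proof. by rewrite -!big_split. Qed.

Lemma integrable_hermite_prodMM k l : mu.-integrable setT
  (fun x => (hermite_prod k x * hermite_prod l x * gauss_density_prod x)%:E).
Proof.
have := @integrable_tuple_prod R s (fun j t => hermite (tnth k j) t *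
  hermite (tnth l j) t * gauss_density t) (fun j => integrable_hermiteM _ _).
by apply: eq_integrable => // x _; rewrite hermite_prodMM.
Qed.

Lemma hermite_prod_orthonormal k l :
  \int[mu]_x (hermite_prod k x * hermite_prod l x * gauss_density_prod x) = (k == l)%:R.
Proof.
under eq_Rintegral do rewrite hermite_prodMM.
rewrite (@Rintegral_tuple_prod R s (fun j t => hermite (tnth k j) t *
  hermite (tnth l j) t * gauss_density t) (fun j => integrable_hermiteM _ _)).
under eq_bigr do rewrite hermite_orthonormal.
have [->|kl] := eqVneq k l; first by rewrite big1 // => j _; rewrite eqxx.
have [j kj] : exists j, tnth k j != tnth l j.
  apply/existsP; apply: contraNT kl => /existsPn h.
  by apply/eqP/eq_from_tnth => j; apply/eqP; have := h j; rewrite negbK.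
by rewrite (bigD1 j) //= (negbTE kj) mul0r.
Qed.

Definition gauss_int f := mu.-integrable setT (fun x => (f x * gauss_density_prod x)%:E).

Definition gauss_sq f := measurable_fun [set: T] f /\ gauss_int (fun x => f x * f x).

Lemma gauss_int_lin a f g : gauss_int f -> gauss_int g ->
  gauss_int (fun x => a * f x + g x).
Proof.
move=> fi gi; have := integrableD measurableT (integrableZl measurableT a fi) gi.
by apply: eq_integrable => // x _; rewrite /= -EFinM -EFinD mulrDl mulrA.
Qed.

Lemma INT_lin a f g : gauss_int f -> gauss_int g ->
  INT (fun x => a * f x + g x) = a * INT f + INT g.
Proof.
move=> fi gi; rewrite /INT -(RintegralZl _ measurableT fi) -RintegralD //; last first.
  exact: (integrableZl measurableT a fi).
by apply: eq_Rintegral => x _; rewrite mulrDl mulrA.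
Qed.

Lemma gauss_int_le f g : measurable_fun [set: T] f ->
  (forall x, `|f x| <= g x) -> gauss_int g -> gauss_int f.
Proof.
move=> mf fg; apply: le_integrable => //.
  by apply/measurable_EFinP; apply: measurable_funM => //; exact: measurable_gauss_density_prod.
move=> x _; rewrite lee_fin !normrM ler_wpM2r //.
exact: le_trans (fg x) (ler_norm _).
Qed.

Lemma gauss_sqM f g : gauss_sq f -> gauss_sq g -> gauss_int (fun x => f x * g x).
Proof.
move=> [mf f2] [mg g2]; apply: gauss_int_le (gauss_int_lin 1 f2 g2).
  exact: measurable_funM.
move=> x; rewrite mul1r normrM -!expr2 -(real_normK (num_real (f x))) -(real_normK (num_real (g x))).
have : 0 <= (`|f x| - `|g x|) ^+ 2 by exact: sqr_ge0.
have : 0 <= `|f x| * `|g x| by rewrite mulr_ge0.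
by rewrite sqrrB; lra.
Qed.

Lemma gauss_sq_lin a f g : gauss_sq f -> gauss_sq g ->
  gauss_sq (fun x => a * f x + g x).
Proof.
move=> fs gs; have [mf f2] := fs; have [mg g2] := gs; split.
  by apply: measurable_funD => //; exact: measurable_funM.
have fg := gauss_sqM fs gs.
have := gauss_int_lin (a ^+ 2) f2 (gauss_int_lin (2 * a) fg g2).
by apply: eq_integrable => // x _; congr ((_ * _)%:E); ring.
Qed.

Lemma gauss_int0 : gauss_int (cst 0).
Proof.
have := @integrable0 _ T R mu setT; apply: eq_integrable => // x _ /=.
by rewrite mul0r.
Qed.

Lemma INT_le (good : set (s.-tuple R)) f g : {ae mu, forall x, good x} ->
  gauss_int f -> gauss_int g -> (forall x, good x -> f x <= g x) -> INT f <= INT g.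
Proof.
move=> ae_good fi gi fg; apply: ae_le_Rintegral => //.
apply: ae_imply ae_good => x gx.
by rewrite ler_wpM2r ?(ltW (gauss_density_prod_gt0 x)) // fg.
Qed.

Lemma hermite_mean (good : set (s.-tuple R)) : {ae mu, forall x, good x} ->
  is_mean good gauss_int gauss_sq (@INT R s).
Proof.
move=> ae_good; split.
- exact: gauss_int0.
- exact: gauss_int_lin.
- exact: INT_lin.
- by move=> f g; exact: INT_le.
- split; first exact: measurable_cst.
  by have := gauss_int0; apply: eq_integrable => // x _ /=; rewrite mulr0.
- exact: gauss_sq_lin.
- exact: gauss_sqM.
Qed.

Lemma gauss_sq_hermite_prod k : gauss_sq (hermite_prod k).
Proof.
split; first exact: measurable_hermite_prod.
exact: integrable_hermite_prodMM.
Qed.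

Lemma hermite_prod0_cst : hermite_prod tuple0s = cst (1 : R).
Proof. by apply/funext => x; rewrite hermite_prod0. Qed.

Lemma INT_hermite_prodM k l :
  INT (fun x : s.-tuple R => hermite_prod k x * hermite_prod l x) = (k == l)%:R.
Proof. exact: hermite_prod_orthonormal. Qed.

Section weighted.
Variable W : s.-tuple nat -> R.
Hypothesis W0 : forall k, 0 <= W k.
Hypothesis Wfin : (\esum_(k in [set: s.-tuple nat]) (W k)%:E < +oo)%E.

(** The points where the diagonal series of the kernel converges and [hermite_kernel] is its true
    sum. *)
Definition good_point : set (s.-tuple R) := [set z |
  (\esum_(k in [set: s.-tuple nat]) (W k * hermite_prod k z ^+ 2)%:E < +oo)%E].

(** The terms are nonnegative and the k-th integrates to [W k], so termwise integration gives the
    trace formula. Convergence almost everywhere comes with it, and is the source of the good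
    points. *)
Lemma hermite_kernel_diag_aux :
  [/\ {ae mu, forall x, summable setT (EFin \o fun k =>
        W k * hermite_prod k x * hermite_prod k x * gauss_density_prod x)},
      gauss_int (fun x => hermite_kernel W x x) &
      INT (fun x => hermite_kernel W x x) = abs_sum W].
Proof.
pose a k (x : T) := W k * hermite_prod k x * hermite_prod k x * gauss_density_prod x.
have aE k x : a k x = W k * (hermite_prod k x * hermite_prod k x * gauss_density_prod x).
  by rewrite /a !mulrA.
have a0 k x : 0 <= a k x.
  by rewrite aE -expr2 mulr_ge0 // mulr_ge0 ?sqr_ge0 ?(ltW (gauss_density_prod_gt0 _)).
have ma k : measurable_fun setT (a k).
  apply: measurable_funM; last exact: measurable_gauss_density_prod.
  apply: measurable_funM; last exact: measurable_hermite_prod.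
  by apply: measurable_funM => //; exact: measurable_hermite_prod.
have ia k : mu.-integrable setT (EFin \o a k).
  have := integrableZl measurableT (W k) (integrable_hermite_prodMM k k).
  by apply: eq_integrable => // x _; rewrite /= -EFinM aE.
have Ia k : \int[mu]_x a k x = W k.
  under eq_Rintegral do rewrite aE.
  rewrite RintegralZl //; last exact: integrable_hermite_prodMM.
  by rewrite hermite_prod_orthonormal eqxx mulr1.
have Iabs k : (\int[mu]_x `|a k x|%:E = (W k)%:E)%E.
  rewrite -Ia /Rintegral fineK; last exact: integrable_fin_num (ia k).
  by apply: eq_integral => x _; rewrite ger0_norm.
have [|sa ia' Ia'] := @integral_abs_sum R _ _ T mu a ma.
  by under eq_esum do rewrite Iabs.
have KE (x : s.-tuple R) : hermite_kernel W x x * gauss_density_prod x = abs_sum (a^~ x).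
  by rewrite mulrC -abs_sumZ; congr abs_sum; apply/funext => k; rewrite mulrC.
split=> //.
- by apply: eq_integrable ia' => // x _; rewrite KE.
- rewrite /INT; under eq_Rintegral do rewrite KE.
  by rewrite Ia'; congr abs_sum; apply/funext => k; exact: Ia.
Qed.

Lemma ae_good_point : {ae mu, forall x, good_point x}.
Proof.
have [sa _ _] := hermite_kernel_diag_aux.
apply: ae_imply sa => x /(summableZ (gauss_density_prod x)^-1).
rewrite summable_real /good_point /=; apply: le_lt_trans.
apply: le_esum => k _; rewrite lee_fin.
rewrite [X in `|X|]mulrC mulfK ?gt_eqF ?gauss_density_prod_gt0 // -mulrA -expr2.
exact: ler_norm.
Qed.

(** The eigenvalue equation: integrated termwise, only the index [k] survives. Domination holds at
    good [z] because the mean of |H_l H_k| is at most 1 and W_l |H_l(z)| <= W_l + W_l H_l(z)^2. *)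
Lemma hermite_kernelM k (z : s.-tuple R) : good_point z ->
  gauss_int (fun y => hermite_kernel W y z * hermite_prod k y) /\
  INT (fun y => hermite_kernel W y z * hermite_prod k y) = W k * hermite_prod k z.
Proof.
move=> gz.
pose a l (y : T) := W l * hermite_prod l z *
  (hermite_prod l y * hermite_prod k y * gauss_density_prod y).
have ia l : mu.-integrable setT (EFin \o a l).
  exact: (integrableZl measurableT (W l * hermite_prod l z) (integrable_hermite_prodMM l k)).
have ma l : measurable_fun setT (a l).
  by apply/measurable_EFinP; exact: measurable_int (ia l).
have Ia l : \int[mu]_y a l y = W l * hermite_prod l z * (l == k)%:R.
  rewrite RintegralZl //; last exact: integrable_hermite_prodMM.
  by rewrite hermite_prod_orthonormal.
have iabs l : (\int[mu]_y `|hermite_prod l y * hermite_prod k y * gauss_density_prod y|%:E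
    <= 1%:E)%E.
  have h1 := integrable_hermite_prodMM l l.
  have h2 := integrable_hermite_prodMM k k.
  have hh : mu.-integrable setT (fun y => (2^-1 * (hermite_prod l y * hermite_prod l y * gauss_density_prod y)
      + 2^-1 * (hermite_prod k y * hermite_prod k y * gauss_density_prod y))%:E).
    exact: (integrableD measurableT (integrableZl measurableT 2^-1 h1)
      (integrableZl measurableT 2^-1 h2)).
  apply: (@le_trans _ _ (\int[mu]_y (2^-1 * (hermite_prod l y * hermite_prod l y * gauss_density_prod y)
      + 2^-1 * (hermite_prod k y * hermite_prod k y * gauss_density_prod y))%:E)%E).
    apply: ge0_le_integral => //.
    - apply/measurable_EFinP; apply: measurableT_comp => //.
      by apply/measurable_EFinP; exact: measurable_int (integrable_hermite_prodMM l k).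
    - exact: measurable_int hh.
    move=> y _; rewrite lee_fin !normrM (ger0_norm (ltW (gauss_density_prod_gt0 y))).
    rewrite !mulrA -mulrDl ler_wpM2r ?(ltW (gauss_density_prod_gt0 _)) //.
    rewrite -!mulrA -!expr2 -(real_normK (num_real (hermite_prod l y))).
    rewrite -(real_normK (num_real (hermite_prod k y))).
    have : 0 <= (`|hermite_prod l y| - `|hermite_prod k y|) ^+ 2 by exact: sqr_ge0.
    by rewrite sqrrB; lra.
  rewrite -[leLHS]fineK; last exact: integrable_fin_num hh.
  rewrite lee_fin -/(Rintegral _ _ _) RintegralD //; [|exact: (integrableZl measurableT 2^-1 h1)
    |exact: (integrableZl measurableT 2^-1 h2)].
  by rewrite !RintegralZl // !hermite_prod_orthonormal !eqxx !mulr1; lra.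
have [|sa ia' Ia'] := @integral_abs_sum R _ _ T mu a ma.
  apply: (@le_lt_trans _ _ (\esum_(l in [set: s.-tuple nat])
      ((W l)%:E + (W l * hermite_prod l z ^+ 2)%:E))%E); last first.
    rewrite esumD; first exact: lte_add_pinfty.
      by move=> l _; rewrite lee_fin.
    by move=> l _; rewrite lee_fin mulr_ge0 ?sqr_ge0.
  apply: le_esum => l _.
  under eq_integral do rewrite normrM EFinM.
  rewrite ge0_integralZl //=; last first.
    apply/measurable_EFinP; apply: measurableT_comp => //.
    by apply/measurable_EFinP; exact: measurable_int (integrable_hermite_prodMM l k).
  apply: (@le_trans _ _ (`|W l * hermite_prod l z|%:E * 1%:E)%E).
    by apply: lee_wpmul2l => //; rewrite lee_fin.
  rewrite -EFinM mulr1 -EFinD lee_fin normrM ger0_norm // -[X in _ <= X + _]mulr1 -mulrDr.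
  rewrite ler_wpM2l // -(real_normK (num_real (hermite_prod l z))).
  have : 0 <= (`|hermite_prod l z| - 1) ^+ 2 by exact: sqr_ge0.
  have : 0 <= `|hermite_prod l z| by [].
  by rewrite sqrrB expr1n mulr1; lra.
have KE (y : s.-tuple R) :
    hermite_kernel W y z * hermite_prod k y * gauss_density_prod y = abs_sum (a^~ y).
  rewrite -mulrA mulrC -abs_sumZ; congr abs_sum; apply/funext => l.
  by rewrite /a; ring.
split; first by apply: eq_integrable ia' => // y _; rewrite KE.
rewrite /INT; under eq_Rintegral do rewrite KE.
rewrite Ia' (@abs_sum_single _ _ k).
  by rewrite Ia eqxx mulr1.
by move=> l lk; rewrite Ia (negbTE lk) mulr0.
Qed.

(** The case of index 0 in [hermite_kernelM] makes the section times the density measurable; the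
    density is then divided out. *)
Lemma measurable_hermite_kernel z : good_point z ->
  measurable_fun [set: T] (fun y => hermite_kernel W y z).
Proof.
move=> gz; have [ig _] := hermite_kernelM tuple0s gz.
have mg : measurable_fun [set: T] (fun y : T =>
    hermite_kernel W y z * hermite_prod tuple0s y * gauss_density_prod y).
  by apply/measurable_EFinP; exact: measurable_int ig.
have := measurable_funM mg measurable_gauss_density_prodV.
apply: eq_measurable_fun => y _ /=.
by rewrite hermite_prod0 mulr1 mulfK // gt_eqF ?gauss_density_prod_gt0.
Qed.

(** Cauchy-Schwarz in [H] gives K(y,z)^2 <= K(z,z) K(y,y), and the diagonal is integrable. *)
Lemma gauss_sq_hermite_kernel (H : set (s.-tuple R -> R)) z :
  is_hermite_space W H -> good_point z -> gauss_sq (hermite_kernel W ^~ z).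
Proof.
move=> hK gz; have mK := measurable_hermite_kernel gz.
split=> //; have [_ iK _] := hermite_kernel_diag_aux.
apply: gauss_int_le (gauss_int_lin (hermite_kernel W z z) iK gauss_int0).
  exact: measurable_funM.
move=> y; rewrite addr0 -expr2 ger0_norm ?sqr_ge0 //.
have Hy := rkhs_kernel hK y; have Hz := rkhs_kernel hK z.
have := rkhs_cauchy_schwarz hK Hz Hy.
by rewrite !(rkhs_reproducing hK).
Qed.

End weighted.
End hermite_kernel.

(** * Bounds on the information complexity *)

Section complexity_bounds.
Context {R : realType} (s : nat) (W : s.-tuple nat -> R)
  (H : set (s.-tuple R -> R)).
Local Notation k0 := (tuple0s s).
Hypothesis W0 : forall k, 0 <= W k.
Hypothesis W1 : W k0 = 1.
Hypothesis Wfin : (\esum_(k in [set: s.-tuple nat]) (W k)%:E < +oo)%E.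
Hypothesis hH : is_hermite_space W H.
Implicit Types (f g : s.-tuple R -> R).

Lemma INT_fourier_coef f : INT f = fourier_coef f k0.
Proof.
by rewrite /INT /fourier_coef; apply: eq_Rintegral => x _; rewrite hermite_prod0 mulr1.
Qed.

Lemma fourier_sq_ge0 f k : 0 <= (W k)^-1 * fourier_coef f k * fourier_coef f k.
Proof. by rewrite -mulrA -expr2 mulr_ge0 ?sqr_ge0 // invr_ge0. Qed.

(* A divergent sum would give [f] the junk norm 0, hence [f = 0]. *)
Lemma fourier_sq_fin f : H f ->
  (\esum_(k in [set: s.-tuple nat])
     ((W k)^-1 * fourier_coef f k * fourier_coef f k)%:E < +oo)%E.
Proof.
move=> Hf; rewrite ltey; apply/eqP => foo.
have : hermite_inner W f f = 0.
  by rewrite /hermite_inner ge0_abs_sum ?foo // => k; exact: fourier_sq_ge0.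
move=> /(rkhs_ip_eq0 hH Hf) f0; move: foo.
rewrite esum1 // => k _; rewrite f0 /fourier_coef.
by under eq_Rintegral do rewrite mul0r mul0r; rewrite Rintegral_cst // !mul0r mulr0.
Qed.

Lemma summable_fourier_sq f : H f -> summable setT (EFin \o fun k =>
  (W k)^-1 * fourier_coef f k * fourier_coef f k).
Proof.
move=> Hf; apply: le_summable (fourier_sq_fin Hf) => k.
by rewrite ger0_norm // fourier_sq_ge0.
Qed.

Lemma summable_fourier f g : H f -> H g -> summable setT (EFin \o fun k =>
  (W k)^-1 * fourier_coef f k * fourier_coef g k).
Proof.
move=> Hf Hg.
have := summable_add (summable_fourier_sq Hf) (summable_fourier_sq Hg).
rewrite summable_real; apply: le_lt_trans; apply: le_esum => k _.
rewrite lee_fin (ger0_norm (addr_ge0 (fourier_sq_ge0 f k) (fourier_sq_ge0 g k))).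
rewrite -!mulrA -mulrDr normrM (@ger0_norm _ (W k)^-1) ?invr_ge0 //.
rewrite ler_wpM2l ?invr_ge0 // normrM -!expr2.
rewrite -(real_normK (num_real (fourier_coef f k))).
rewrite -(real_normK (num_real (fourier_coef g k))).
have : 0 <= (`|fourier_coef f k| - `|fourier_coef g k|) ^+ 2 by exact: sqr_ge0.
have : 0 <= `|fourier_coef f k| * `|fourier_coef g k| by rewrite mulr_ge0.
by rewrite sqrrB; lra.
Qed.

(* Termwise AM-GM replaces the Cauchy-Schwarz inequality for
   [INT f - ip f g], which is a sum of products because [INT f] is the
   zeroth Fourier coefficient. *)
Lemma quadrature_error_signed (sg e : R) f g : sg ^+ 2 = 1 -> 0 < e -> H f -> H g ->
  sg * (INT f - hermite_inner W f g) <=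
  (e * hermite_inner W f f + (1 - 2 * INT g + hermite_inner W g g) / e) / 2.
Proof.
move=> sg2 e0 Hf Hg.
pose u k := (W k)^-1 * fourier_coef f k * fourier_coef f k.
pose v k := (W k)^-1 * fourier_coef g k * fourier_coef g k.
pose p k := (W k)^-1 * fourier_coef f k * fourier_coef g k.
have su : summable setT (EFin \o u) by exact: summable_fourier_sq.
have sv : summable setT (EFin \o v) by exact: summable_fourier_sq.
have sp : summable setT (EFin \o p) by exact: summable_fourier.
pose q k := e / 2 * u k + ((2 * e)^-1 * v k + sg * p k).
have amgm (x y : R) : 0 <= e / 2 * x ^+ 2 + ((2 * e)^-1 * y ^+ 2 + sg * (x * y)).
  have : 0 <= (e * x + sg * y) ^+ 2 / (2 * e) by rewrite divr_ge0 ?sqr_ge0 // mulr_ge0 // ltW.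
  rewrite (_ : _ / _ = e / 2 * x ^+ 2 + ((2 * e)^-1 * (sg ^+ 2 * y ^+ 2) + sg * (x * y))).
    by rewrite sg2 mul1r.
  by field; rewrite gt_eqF.
have q0 k : 0 <= q k.
  have -> : q k = (W k)^-1 * (e / 2 * fourier_coef f k ^+ 2 +
      ((2 * e)^-1 * fourier_coef g k ^+ 2 + sg * (fourier_coef f k * fourier_coef g k))).
    by rewrite /q /u /v /p; ring.
  by rewrite mulr_ge0 ?invr_ge0.
have sq : summable setT (EFin \o q).
  apply: summable_add; first exact: summableZ.
  by apply: summable_add; exact: summableZ.
(* The term at [k0] is exchanged for the same expression with [INT g - 1] in place of [INT g]; this
   has the effect of passing from [g] to [g - 1] although the constant need not lie in [H]. *)
have := abs_sum_ge k0 q0 sq.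
rewrite abs_sumD; [|exact: summableZ|by apply: summable_add; exact: summableZ].
rewrite abs_sumD; [|exact: summableZ|exact: summableZ].
rewrite !abs_sumZ -/(hermite_inner W f f) -/(hermite_inner W g g) -/(hermite_inner W f g).
rewrite /q /u /v /p W1 invr1 !mul1r -!INT_fourier_coef.
have := amgm (INT f) (INT g - 1).
set F := INT f; set G := INT g; set U := hermite_inner W f f.
set V := hermite_inner W g g; set Q := hermite_inner W f g => h1 h2.
rewrite -subr_ge0.
have -> : (e * U + (1 - 2 * G + V) / e) / 2 - sg * (F - Q) =
  (e / 2 * F ^+ 2 + ((2 * e)^-1 * (G - 1) ^+ 2 + sg * (F * (G - 1)))) +
  ((e / 2 * U + ((2 * e)^-1 * V + sg * Q)) -
   (e / 2 * (F * F) + ((2 * e)^-1 * (G * G) + sg * (F * G)))).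
  by field; rewrite gt_eqF.
by rewrite addr_ge0 // subr_ge0.
Qed.

(** The free parameter of the AM-GM bound is set to the target error. Since 1 - 2 (1 - E) + (1 - E)
    = E <= e^2, the bound is at most (e + e) / 2. *)
Lemma quadrature_error (E e : R) f g : 0 < e -> H f -> H g ->
  hermite_inner W f f <= 1 -> INT g = 1 - E -> hermite_inner W g g = 1 - E ->
  E <= e ^+ 2 -> `|INT f - hermite_inner W f g| <= e.
Proof.
move=> e0 Hf Hg f1 gE ggE Ee.
have le : (e * hermite_inner W f f + (1 - 2 * INT g + hermite_inner W g g) / e) / 2 <= e.
  rewrite gE ggE ler_pdivrMr // mulr_natr mulr2n; apply: lerD.
    by rewrite ger_pMr.
  rewrite ler_pdivrMr // -expr2; apply: le_trans Ee; lra.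
rewrite ler_norml; apply/andP; split.
  have := @quadrature_error_signed (-1) e f g; rewrite sqrrN expr1n => /(_ erefl e0 Hf Hg) h.
  by rewrite lerNl -mulN1r (le_trans h).
have := @quadrature_error_signed 1 e f g; rewrite expr1n => /(_ erefl e0 Hf Hg) h.
by rewrite -[leLHS]mul1r (le_trans h).
Qed.

Local Notation chol := (@cholesky R (s.-tuple R) (@gauss_sq R s) (hermite_inner W) H).
Local Notation trc := (residual_trace (@INT R s) (hermite_kernel W)).
Local Notation energy := (residual_energy (@INT R s)).

Let good := @good_point R s W.
Let ae_good : {ae lebesgue_tuple s, forall x, good x} := ae_good_point W0 Wfin.
Let mI : is_mean good (@gauss_int R s) (@gauss_sq R s) (@INT R s) := hermite_mean ae_good.
Let KL z : good z -> gauss_sq (hermite_kernel W ^~ z) :=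
  fun gz => gauss_sq_hermite_kernel W0 Wfin hH gz.

Let Kdiag : gauss_int (fun x => hermite_kernel W x x).
Proof. by have [] := hermite_kernel_diag_aux W0 Wfin. Qed.

Lemma INT_kernel_diag : INT (fun x => hermite_kernel W x x) = abs_sum W.
Proof. by have [] := hermite_kernel_diag_aux W0 Wfin. Qed.

Let IK z : good z -> INT (hermite_kernel W ^~ z) = 1.
Proof.
move=> gz; have [_ h] := hermite_kernelM W0 Wfin k0 gz.
rewrite W1 hermite_prod0 mulr1 in h; rewrite -h; congr INT.
by apply/funext => y; rewrite hermite_prod0 mulr1.
Qed.

Let L1 : gauss_sq (cst (1 : R) : s.-tuple R -> R).
Proof. by rewrite -hermite_prod0_cst; exact: gauss_sq_hermite_prod. Qed.

Let I1 : INT (cst 1 : s.-tuple R -> R) = 1.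
Proof.
transitivity (INT (fun x : s.-tuple R => hermite_prod k0 x * hermite_prod k0 x)).
  by congr INT; apply/funext => y; rewrite hermite_prod0 mulr1.
by rewrite INT_hermite_prodM eqxx.
Qed.

Lemma minimal_error_le n a (e : R) : 0 < e -> chol n a ->
  energy n a 1 (cst 1) <= e ^+ 2 -> (minimal_error W H n <= e%:E)%E.
Proof.
move=> e0 ca Ee; have [x [c [g [Hg gA gg Ig]]]] := cholesky_quadrature mI hH L1 ca.
apply: ge_ereal_inf.
exists (worst_case_error W H (algorithm (fun i : 'I_n => c i) (fun i : 'I_n => x i))).
  by exists (fun i : 'I_n => c i, fun i : 'I_n => x i).
apply: ge_ereal_sup => _ [f [Hf f1] <-]; rewrite lee_fin /algorithm -gA //.
apply: (quadrature_error e0 Hf Hg _ Ig gg Ee).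
by rewrite -[leLHS]sqr_sqrtr ?(rkhs_ip_ge0 hH) // expr_le1 // sqrtr_ge0.
Qed.

Lemma info_complexity_le n (eps : R) : (minimal_error W H n <= eps%:E)%E ->
  (info_complexity W H eps <= n%:R%:E)%E.
Proof. by move=> h; apply: ereal_inf_lbound; exists n. Qed.

Lemma mul_le_energy (E eps L : R) (N : nat) : 0 < eps -> L <= N%:R * eps ^+ 2 ->
  N%:R * E <= L -> (0 < N)%N -> E <= eps ^+ 2.
Proof.
move=> e0 LN EL N0; have N0' : 0 < N%:R :> R by rewrite ltr0n.
by rewrite -(ler_pM2l N0') (le_trans EL).
Qed.

(** Prevents [lne] from being -oo in the weak tractability notions. The witness against the zero
    algorithm is a projection [g] of norm at most 1 whose integral 1 - E exceeds [eps]; many nodes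
    are used only to construct it. *)
Lemma info_complexity_ge1 (eps : R) : 0 < eps < 1 -> (1%:E <= info_complexity W H eps)%E.
Proof.
move=> /andP[e0 e1]; apply: le_ereal_inf_tmp => _ [n mn <-].
rewrite lee_fin ler1n lt0n; apply/eqP => n0; move: mn; rewrite {}n0 /=.
apply/negP; rewrite -ltNge.
pose tb := Num.max 1 (abs_sum W).
have tb0 : 0 < tb by rewrite lt_max ltr01.
have tr0 : trc 0%N (fun=> cst 0) <= tb.
  by rewrite /residual_trace big_ord0 subr0 INT_kernel_diag le_max lexx orbT.
have x0 : s.-tuple R := [tuple 0 | i < s].
have c0 := @cholesky0 R (s.-tuple R) (@gauss_sq R s) (hermite_inner W) H x0 (fun=> cst 0).
pose x := 2 * tb / (1 - eps); have x_ge0 : 0 <= x.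
  by rewrite divr_ge0 ?mulr_ge0 ?(ltW tb0) // subr_ge0 ltW.
have /andP[_ xN] := truncn_itv x_ge0; set N := (Num.truncn x).+1 in xN.
have [m [a [_ ca _ EN]]] := energy_decay mI hH KL Kdiag x0 L1 I1 IK tb0 c0 tr0 N.
have [y [c [g [Hg _ gg Ig]]]] := cholesky_quadrature mI hH L1 ca.
set E := residual_energy _ _ _ _ _ in gg Ig EN.
have Eeps : E < 1 - eps.
  have N0 : 0 < N%:R :> R by rewrite ltr0n.
  rewrite -(ltr_pM2l N0) (le_lt_trans EN) // -ltr_pdivrMr ?subr_gt0 //.
(* The squared norm 1 - E of [g] dominates its term of index 0, which is (1 - E)^2, so 1 - E <=
   1. *)
have gg1 : hermite_inner W g g <= 1.
  have := @abs_sum_ge R _ k0 _ (fourier_sq_ge0 g) (summable_fourier_sq Hg).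
  rewrite -/(hermite_inner W g g) W1 invr1 mul1r -INT_fourier_coef gg Ig => h.
  have : 0 <= 1 - E by lra.
  nra.
apply: (@lt_le_trans _ _ `|INT g|%:E).
  by rewrite lte_fin Ig ger0_norm; lra.
apply: le_ereal_inf_tmp => _ [wx _ <-]; apply: ereal_sup_ubound; exists g.
  by split => //; rewrite -sqrtr1 ler_sqrt.
by rewrite /algorithm big_ord0 subr0.
Qed.

Lemma info_complexity_mc (L eps : R) : 1 <= L -> abs_sum W <= L -> 0 < eps < 1 ->
  (info_complexity W H eps <= (3 * L * eps ^- 2)%:E)%E.
Proof.
move=> L1' WL /andP[e0 e1]; have L0 : 0 < L by exact: lt_le_trans L1'.
have tr0 : trc 0%N (fun=> cst 0) <= L.
  by rewrite /residual_trace big_ord0 subr0 INT_kernel_diag.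
have x0 : s.-tuple R := [tuple 0 | i < s].
have c0 := @cholesky0 R (s.-tuple R) (@gauss_sq R s) (hermite_inner W) H x0 (fun=> cst 0).
have e2 : 0 < eps ^+ 2 by rewrite exprn_gt0.
pose x := 2 * L * eps ^- 2; have x_ge0 : 0 <= x.
  by rewrite divr_ge0 ?mulr_ge0 ?(ltW L0) // ltW.
have /andP[xN' xN] := truncn_itv x_ge0; set N := (Num.truncn x).+1 in xN.
have [m [a [mN ca _ EN]]] := energy_decay mI hH KL Kdiag x0 L1 I1 IK L0 c0 tr0 N.
have Ee : energy m a 1 (cst 1) <= eps ^+ 2.
  apply: (mul_le_energy e0 _ EN) => //.
  by rewrite -ler_pdivrMr // ltW.
apply: le_trans (info_complexity_le (minimal_error_le e0 ca Ee)) _.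
rewrite lee_fin (@le_trans _ _ N%:R) ?ler_nat //.
(* The third copy of L / eps^2 is at least 1 and pays for rounding up. *)
rewrite [leRHS](_ : _ = x + L * eps ^- 2); last by rewrite /x; ring.
rewrite /N -natr1 lerD // ler_pdivlMr // mul1r (le_trans _ L1') //.
by rewrite expr_le1 ?ltW.
Qed.

(** To have [S] as a sequence, a finite [F] carrying all but [eta] of the sum is fixed and its large
    weights are kept. The factor 2 counts [eta] once for what [F] misses and once for the small
    weights inside [F]. *)
Lemma large_weights (p theta L : R) : 0 < p <= 1 -> 0 < theta -> 0 < L ->
  (\esum_(k in [set: s.-tuple nat]) (W k `^ p)%:E <= L%:E)%E ->
  exists S : seq (s.-tuple nat), [/\ uniq S, (size S)%:R <= L * theta `^ (- p) &
    abs_sum W - \sum_(k <- S) W k <= 2 * (theta `^ (1 - p) * L)].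
Proof.
move=> /andP[p0 p1] th0 L0 WpL; set eta := theta `^ (1 - p) * L.
have eta0 : 0 < eta by rewrite mulr_gt0 ?powR_gt0.
have [F [uF FW]] : exists F, uniq F /\ abs_sum W - eta <= \sum_(k <- F) W k.
  apply: contrapT => nF.
  have : (\esum_(k in [set: s.-tuple nat]) (W k)%:E <= (abs_sum W - eta)%:E)%E.
    apply: esum_le_seq => F uF; rewrite sumEFin lee_fin leNgt; apply/negP => lt.
    by apply: nF; exists F; rewrite ltW.
  by rewrite -ge0_abs_sumK // lee_fin; lra.
exists [seq k <- F | theta <= W k]; split.
- exact: filter_uniq.
- rewrite powRN ler_pdivlMr ?powR_gt0 // -lee_fin.
  apply: le_trans WpL; apply: le_trans (esum_ge_seq _ (filter_uniq _ uF)).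
  rewrite sumEFin lee_fin big_filter.
  apply: (@le_trans _ _ (\sum_(k <- F | theta <= W k) theta `^ p)).
    by rewrite big_const_seq iter_addr_0 size_filter mulr_natl.
  apply: ler_sum => k thW; apply: ge0_ler_powR; rewrite ?nnegrE //; exact: ltW.
- rewrite big_filter lerBlDr; apply: (@le_trans _ _ (\sum_(k <- F) W k + eta)); first lra.
  rewrite mulr_natl mulr2n addrAC lerD2r addrC (bigID (fun k => theta <= W k)) /= lerD2l.
  apply: (@le_trans _ _ (\sum_(k <- F | ~~ (theta <= W k)) theta `^ (1 - p) * W k `^ p)).
    apply: ler_sum => k; rewrite -ltNge => Wth.
    have [->|Wk0] := eqVneq (W k) 0; first by rewrite mulr_ge0 ?powR_ge0.
    have Wk : 0 < W k by rewrite lt_neqAle eq_sym Wk0 W0.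
    rewrite -[leLHS](powRr1 (W0 k)) -[in leLHS](subrK p 1) powRD; last first.
      by rewrite Wk0 implybT.
    rewrite ler_wpM2r ?powR_ge0 //; apply: ge0_ler_powR; rewrite ?nnegrE ?subr_ge0 //.
    - exact: ltW.
    - exact: ltW.
  rewrite -mulr_sumr ler_wpM2l ?powR_ge0 // -lee_fin; apply: le_trans WpL.
  apply: le_trans (esum_ge_seq _ uF); rewrite sumEFin lee_fin.
  rewrite [leRHS](bigID (fun k => theta <= W k)) /= lerDr.
  by apply: sumr_ge0 => k _; exact: powR_ge0.
Qed.

Lemma info_complexity_pow (p d L eps : R) : 0 < p <= 1 -> 0 < d -> 1 <= L ->
  abs_sum W <= L ->
  (\esum_(k in [set: s.-tuple nat]) (W k `^ p)%:E <= L%:E)%E -> 0 < eps < 1 ->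
  (info_complexity W H eps <=
   ((8 / d + 3) * L * (eps ^+ 2 / 8) `^ (- (p + d)))%:E)%E.
Proof.
move=> p01 d0 L1' WL WpL /andP[e0 e1]; have L0 : 0 < L by exact: lt_le_trans L1'.
have /andP[p0 p1] := p01.
(* The 8 collects three factors 2, from [large_weights], [trace_decay] and [energy_decay]: the final
   bound 8 th^(1-p) L on N2 times the energy is exactly [m * eps ^+ 2], and N2 > m. *)
set th := eps ^+ 2 / 8; have th0 : 0 < th by rewrite divr_gt0 // exprn_gt0.
have e21 : eps ^+ 2 < 1 by rewrite expr_lt1 // ltW.
have th1 : th < 1 by rewrite ltr_pdivrMr // mul1r (lt_le_trans e21) // ler1n.
have [S [uS Sm Stau]] := large_weights p01 th0 L0 WpL.
set m := L * th `^ (- p) in Sm.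
have thp1 : 1 <= th `^ (- p).
  by rewrite powRN -[leLHS]invr1 lef_pV2 ?posrE ?powR_gt0 // -[leRHS](powRr0 th) ger_powR ?th0 ?(ltW th1) // ltW.
have m1 : 1 <= m by rewrite -[leLHS]mulr1 ler_pM.
have m0 : 0 < m by exact: lt_le_trans m1.
have m8 : 0 <= 1 - (8 * m)^-1.
  rewrite subr_ge0 invf_le1; first lra.
  by rewrite mulr_gt0.
have x0 : s.-tuple R := [tuple 0 | i < s].
set tau := 2 * (th `^ (1 - p) * L) in Stau.
have tau0 : 0 < tau by rewrite !mulr_gt0 ?powR_gt0.
have Ktau : INT (fun x => hermite_kernel W x x) - \sum_(k <- S) W k <= tau.
  by rewrite INT_kernel_diag.
have Lphi k : k \in S -> gauss_sq (hermite_prod k : s.-tuple R -> R) by move=> _; exact: gauss_sq_hermite_prod.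
have on k l : k \in S -> l \in S ->
    dot (@INT R s) (hermite_prod k) (hermite_prod l) = (k == l)%:R.
  by move=> _ _; exact: INT_hermite_prodM.
have eig k z : k \in S -> good z ->
    dot (@INT R s) (hermite_kernel W ^~ z) (hermite_prod k) = W k * hermite_prod k z.
  by move=> _ gz; have [_] := hermite_kernelM W0 Wfin k gz.
have lnth : 0 <= ln (th^-1) by rewrite ln_ge0 // -[leLHS]invr1 lef_pV2 ?posrE // ltW.
(* After this many nodes (1 - 1/(8m))^N <= e^(-N/(8m)) <= th, and th L <= th^(1-p) L brings the
   trace below the threshold. *)
pose y1 := 8 * m * ln (th^-1); have y1_ge0 : 0 <= y1.
  by rewrite mulr_ge0 // mulr_ge0 // ltW.
have /andP[yN1' yN1] := truncn_itv y1_ge0; set N1 := (Num.truncn y1).+1 in yN1.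
have /andP[yN2' yN2] := truncn_itv (ltW m0); set N2 := (Num.truncn m).+1 in yN2.
have [n1 [a1 [n1N ca1 tr1]]] := trace_decay mI hH KL Kdiag uS Lphi on eig x0 m1 Sm tau0 Ktau N1.
have {}tr1 : residual_trace (@INT R s) (hermite_kernel W) n1 a1 <= 2 * tau.
  apply: (le_trans tr1); rewrite ge_max lexx /= INT_kernel_diag.
  apply: (@le_trans _ _ (th * L)); last first.
    rewrite /tau mulrA (@le_trans _ _ (th `^ (1 - p) * L)) //.
      by rewrite ler_wpM2r ?(ltW L0) // -[leLHS](powRr1 (ltW th0)) ger_powR ?th0 ?(ltW th1) // gerBl ltW.
    by rewrite ler_peMl ?mulr_ge0 ?powR_ge0 ?(ltW L0) //; lra.
  apply: ler_pM => //.
  - exact: exprn_ge0.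
  - rewrite ge0_abs_sum // fine_ge0 //; apply: esum_ge0 => k _.
    by rewrite lee_fin.
  apply: (@le_trans _ _ (expR (- (8 * m)^-1) ^+ N1)).
    by rewrite lerXn2r ?nnegrE ?expR_ge0 // ?expR_ge1Dx.
  rewrite -expRM_natl -[leRHS]lnK ?posrE // ler_expR.
  have m8' : 0 < 8 * m by rewrite mulr_gt0.
  have hy : ln (th^-1) * (8 * m) <= N1%:R by rewrite mulrC ltW.
  by rewrite -lerN2 -lnV ?posrE // mulrN opprK ler_pdivlMr.
have [n2 [a2 [n2N ca2 _ EN]]] := energy_decay mI hH KL Kdiag x0 L1 I1 IK
  (mulr_gt0 (ltr0Sn R 1) tau0) ca1 tr1 N2.
have Ee : energy n2 a2 1 (cst 1) <= eps ^+ 2.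
  apply: (mul_le_energy e0 _ EN) => //.
  apply: (@le_trans _ _ (m * eps ^+ 2)); last by rewrite ler_wpM2r ?sqr_ge0 // ltW.
  rewrite /tau /m (_ : eps ^+ 2 = 8 * th); last by rewrite /th mulrC divfK.
  rewrite [leRHS](_ : _ = 8 * (th * th `^ (- p) * L)); last by ring.
  have -> : th * th `^ (- p) = th `^ (1 - p).
    by rewrite -[X in X * _](powRr1 (ltW th0)) -powRD // (gt_eqF th0) implybT.
  by rewrite le_eqVlt; apply/orP; left; apply/eqP; ring.
apply: le_trans (info_complexity_le (minimal_error_le e0 ca2 Ee)) _.
rewrite lee_fin (@le_trans _ _ (N1%:R + N2%:R)) //.
  by rewrite -natrD ler_nat (leq_trans n2N) // leq_add2r.
(* Of the 3 m, one is for the second phase and two cover the roundings, as m >= 1. *)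
apply: (@le_trans _ _ (m * (8 * ln (th^-1) + 3))).
  rewrite /N1 /N2 -2!natr1 (@le_trans _ _ ((y1 + 1) + (m + 1))) //.
    by rewrite !lerD.
  by rewrite /y1; nra.
have thd1 : 1 <= th `^ (- d).
  by rewrite powRN -[leLHS]invr1 lef_pV2 ?posrE ?powR_gt0 // -[leRHS](powRr0 th) ger_powR ?th0 ?(ltW th1) // ltW.
(* From ln y < y at y = th^(-d): the logarithmic number of rounds in the first phase is what costs
   [d] in the exponent. *)
have lnd : ln (th^-1) <= th `^ (- d) / d.
  rewrite ler_pdivlMr // mulrC -ln_powR ltW //.
  rewrite -powR_inv1 ?(ltW th0) // -powRrM mulN1r.
  by apply: ln_sublinear; exact: powR_gt0.
have -> : th `^ (- (p + d)) = th `^ (- p) * th `^ (- d).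
  by rewrite opprD powRD // (gt_eqF th0) implybT.
rewrite [leRHS](_ : _ = m * ((8 / d + 3) * th `^ (- d))); last by rewrite /m; ring.
apply: ler_wpM2l; first exact: ltW.
rewrite [leRHS]mulrDl; apply: lerD; last by rewrite ler_peMr.
by rewrite -mulrA ler_wpM2l // mulrC.
Qed.

End complexity_bounds.

(** * Tractability *)

Section exponent_of_summability.
Context {R : realType} (gamma : nat -> R).
Hypothesis gamma_gt0 : forall j, 0 < gamma j.
Hypothesis gamma_le1 : forall j, gamma j <= 1.

Lemma sum_powR_fin (kappa p : R) : kappa <= p ->
  (\sum_(0 <= j <oo) (gamma j `^ kappa)%:E < +oo)%E ->
  (\sum_(0 <= j <oo) (gamma j `^ p)%:E < +oo)%E.
Proof.
move=> kp; apply: le_lt_trans; apply: lee_nneseries => j _.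
  by move=> _; rewrite lee_fin powR_ge0.
by rewrite lee_fin ger_powR // gamma_gt0 gamma_le1.
Qed.

Lemma sum_powR1 : (\sum_(0 <= j <oo) (gamma j `^ 1)%:E =
  \sum_(0 <= j <oo) (gamma j)%:E)%E.
Proof. by apply: eq_eseriesr => j _; rewrite powRr1 // ltW. Qed.

Lemma partial_sum_le (p : R) : (\sum_(0 <= j <oo) (gamma j `^ p)%:E < +oo)%E ->
  exists G : R, forall s, \sum_(j < s) gamma j `^ p <= G.
Proof.
move=> fin; have g0 : (0 <= \sum_(0 <= j <oo) (gamma j `^ p)%:E)%E.
  by apply: nneseries_ge0 => j _ _; rewrite lee_fin powR_ge0.
exists (fine (\sum_(0 <= j <oo) (gamma j `^ p)%:E)%E) => s.
rewrite -lee_fin fineK ?ge0_fin_numE // -sumEFin.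
rewrite -(big_mkord xpredT (fun j => (gamma j `^ p)%:E)).
by apply: nneseries_lim_ge => j _ _; rewrite lee_fin powR_ge0.
Qed.

Lemma sum_exponent_le1 : (\sum_(0 <= j <oo) (gamma j)%:E < +oo)%E ->
  (sum_exponent gamma <= 1%:E)%E.
Proof.
by move=> fin; apply: ereal_inf_lbound; exists 1 => //; split=> //; rewrite sum_powR1.
Qed.

Lemma sum_exponent_lt (p : R) : (sum_exponent gamma < p%:E)%E ->
  (\sum_(0 <= j <oo) (gamma j `^ p)%:E < +oo)%E.
Proof.
move=> /ereal_inf_lt[_ [kappa [_ fin] <-]]; rewrite lte_fin => kp.
exact: sum_powR_fin (ltW kp) fin.
Qed.

End exponent_of_summability.

(** * From complexity bounds to tractability *)

Section tractability_bounds.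
Context {R : realType} (n : nat -> R -> \bar R) (S : nat -> R) (c : R).
Hypothesis S0 : forall s, 0 <= S s.
Hypothesis Sle : forall s, S s <= s%:R.
Hypothesis c0 : 0 <= c.
Hypothesis n_ge1 : forall s eps, (0 < s)%N -> 0 < eps < 1 -> (1%:E <= n s eps)%E.
Hypothesis n_le : forall s eps, (0 < s)%N -> 0 < eps < 1 ->
  (n s eps <= (3 * expR (c * S s) * eps ^- 2)%:E)%E.

Lemma powRN2 (eps : R) : 0 < eps -> eps `^ (- 2) = eps ^- 2.
Proof. by move=> e0; rewrite powRN powR_mulrn // ltW. Qed.

Lemma SPT_of_bounded (G : R) : (forall s, S s <= G) -> SPT_with n 2.
Proof.
move=> SG; split=> //; exists (3 * expR (c * G)); first by rewrite mulr_ge0 // expR_ge0.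
move=> s eps s0 /[dup] e01 /andP[e0 _]; apply: le_trans (n_le s0 e01) _.
rewrite lee_fin powRN2 // ler_wpM2r ?invr_ge0 ?exprn_ge0 ?(ltW e0) //.
by rewrite ler_wpM2l // ler_expR ler_wpM2l.
Qed.

Lemma PT_of_limsup :
  (limn_esup (fun s => ((ln s%:R)^-1 * S s)%:E) < +oo)%E -> PT n.
Proof.
move=> /ereal_inf_lt[_ [V [N _ NV] <-]] supV.
have [B BV] : exists B : R, forall s, V s -> (ln s%:R)^-1 * S s <= B.
  move: supV; set x := ereal_sup _ => xoo.
  exists (fine (maxe x 0)) => s Vs; rewrite -lee_fin fineK; last first.
    by rewrite ge0_fin_numE ?le_max ?lexx ?orbT // maxEle; case: ifP => // _; rewrite ltry.
  by rewrite le_max; apply/orP; left; apply: ereal_sup_ubound; exists s.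
pose B' := Num.max B 0; have B'0 : 0 <= B' by rewrite le_max lexx orbT.
(* From [N'] on, ln s > 0 and exp(c S) <= exp(c B' ln s) = s^(c B'). The finitely many smaller s go
   into the constant through [S s <= s], where [B' >= 0] ensures s^(c B') >= 1. *)
pose N' := maxn N 2.
exists 2, (c * B'), (3 * expR (c * N'%:R)); split=> //.
  by rewrite mulr_ge0.
move=> s eps s0 /[dup] e01 /andP[e0 _]; apply: le_trans (n_le s0 e01) _.
rewrite lee_fin powRN2 // [leRHS]mulrAC ler_wpM2r ?invr_ge0 ?exprn_ge0 ?(ltW e0) //.
rewrite -mulrA ler_wpM2l //; have sR : 0 < s%:R :> R by rewrite ltr0n.
have [Ns|sN] := leqP N' s.
  have Vs : V s by apply: NV; exact: leq_trans (leq_maxl _ _) Ns.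
  have lns : 0 < ln s%:R :> R.
    by rewrite ln_gt0 // ltr1n (leq_trans (leq_maxr _ _) Ns).
  rewrite -[leLHS]mul1r; apply: ler_pM => //; rewrite ?expR_ge0 //.
    by rewrite -[leLHS]expR0 ler_expR mulr_ge0.
  rewrite /powR gt_eqF // ler_expR -mulrA ler_wpM2l //.
  have := BV s Vs; rewrite ler_pdivrMl // mulrC => /le_trans; apply.
  by rewrite ler_wpM2r ?(ltW lns) // le_max lexx.
rewrite -[leLHS]mulr1; apply: ler_pM => //; rewrite ?expR_ge0 //.
  by rewrite ler_expR ler_wpM2l // (le_trans (Sle s)) // ler_nat ltnW.
have h1 : 1 `^ (c * B') = 1 :> R by rewrite powR1.
by rewrite -[leLHS]h1 ge0_ler_powR ?nnegrE ?mulr_ge0 // ler1n.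
Qed.

(** Up to constants, ln n is at most c S + 2 ln(1/eps). Each of these two takes a share delta/4 of
    its part of the denominator, and the constants take delta/2 once the denominator exceeds [D]. *)
Lemma sigma_tau_WT_of_cvg (sigma tau : R) : 0 < sigma -> 0 < tau ->
  (s%:R `^ sigma)^-1 * S s @[s --> \oo] --> (0 : R) -> sigma_tau_WT sigma tau n.
Proof.
move=> sg0 tau0 cvgS delta delta0.
have [N NP] : exists N, forall s, (N <= s)%N -> (0 < s)%N ->
    c * S s <= delta / 4 * s%:R `^ sigma.
  have e0 : 0 < delta / 4 / (c + 1) by rewrite !divr_gt0 // ltr_wpDl.
  have /cvgrPdist_lt/(_ _ e0)[N _ NP] := cvgS.
  exists N => s Ns s0; have := NP s Ns; rewrite sub0r normrN /= => h.
  have sp : 0 < s%:R `^ sigma :> R by rewrite powR_gt0 // ltr0n.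
  rewrite ger0_norm ?mulr_ge0 ?invr_ge0 ?(ltW sp) // in h.
  rewrite ltr_pdivrMl // in h.
  apply: (@le_trans _ _ (c * (s%:R `^ sigma * (delta / 4 / (c + 1))))).
    by rewrite ler_wpM2l // ltW.
  rewrite mulrCA mulrC ler_wpM2r ?(ltW sp) // mulrCA ger_pMr ?divr_gt0 //.
  by rewrite ler_pdivrMr ?ltr_wpDl // mul1r lerDl.
pose C1 := c * N%:R.
have SC s : (0 < s)%N -> c * S s <= delta / 4 * s%:R `^ sigma + C1.
  move=> s0; have [Ns|sN] := leqP N s.
    by rewrite (le_trans (NP _ Ns s0)) // lerDl mulr_ge0.
  rewrite (@le_trans _ _ C1) //; last first.
    by rewrite lerDr mulr_ge0 ?powR_ge0 // divr_ge0 // ltW.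
  by rewrite ler_wpM2l // (le_trans (Sle s)) // ler_nat ltnW.
(* Chosen so that (2/tau) a = delta/4 when ln y < y is applied at y = a eps^(-tau). *)
pose a := delta * tau / 8; have a0 : 0 < a by rewrite divr_gt0 // mulr_gt0.
pose C2 := - (2 / tau * ln a).
have lnC eps : 0 < eps < 1 -> 2 * ln (eps^-1) <= delta / 4 * eps `^ (- tau) + C2.
  move=> /andP[e0 _]; have u0 : 0 < eps `^ (- tau) by exact: powR_gt0.
  have := ltW (ln_sublinear (mulr_gt0 a0 u0)).
  rewrite lnM ?posrE // ln_powR => h.
  have -> : 2 * ln (eps^-1) = 2 / tau * (- tau * ln eps).
    by rewrite lnV ?posrE //; field; rewrite gt_eqF.
  have -> : delta / 4 * eps `^ (- tau) + C2 = 2 / tau * (a * eps `^ (- tau) - ln a).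
    by rewrite /C2 /a; field; rewrite gt_eqF.
  by rewrite ler_wpM2l ?divr_ge0 ?(ltW tau0) // lerBrDl.
pose C3 := Num.max (ln 3 + C1 + C2) 0.
pose D := 2 / delta * C3.
have D0 : 0 <= D by rewrite mulr_ge0 ?le_max ?lexx ?orbT // divr_ge0 // ltW.
have powD (r x : R) : 0 < r -> D `^ r^-1 <= x -> D <= x `^ r.
  move=> r0 Dx; rewrite -[leLHS](powRr1 D0) -[X in _ `^ X](mulVf (lt0r_neq0 r0)).
  rewrite powRrM; apply: ge0_ler_powR; rewrite ?nnegrE ?(ltW r0) ?powR_ge0 //.
  exact: le_trans (powR_ge0 _ _) Dx.
(* Because of the 2, one of s and 1/eps reaches the maximum, and its power alone is at least [D]. *)
exists (2 * Num.max (D `^ sigma^-1) (D `^ tau^-1)) => s eps s0 /[dup] e01 /andP[e0 e1] MD.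
have d_gt0 : 0 < s%:R `^ sigma + eps `^ (- tau) :> R.
  by rewrite addr_gt0 // powR_gt0 // ltr0n.
have Dd : D <= s%:R `^ sigma + eps `^ (- tau).
  set x := D `^ sigma^-1 in MD; set y := D `^ tau^-1 in MD.
  have [xs|sx] := leP (Num.max x y) s%:R.
    rewrite (@le_trans _ _ (s%:R `^ sigma)) ?lerDl ?powR_ge0 //.
    by apply: powD => //; move: xs; rewrite ge_max => /andP[].
  have ye : Num.max x y <= eps^-1 by lra.
  rewrite (@le_trans _ _ (eps `^ (- tau))) ?lerDr ?powR_ge0 //.
  rewrite -mulN1r powRrM powR_inv1 ?(ltW e0) //.
  by apply: powD => //; move: ye; rewrite ge_max => /andP[].
have nge := n_ge1 s0 e01; have nle := n_le s0 e01.
have nfin : n s eps \is a fin_num.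
  by rewrite ge0_fin_numE ?(le_lt_trans nle) ?ltry // (le_trans _ nge) // lee_fin.
move: nge nle; rewrite -(fineK nfin) !lee_fin; set r := fine _ => r1 rle.
have r0 : 0 < r by exact: lt_le_trans r1.
rewrite lne_EFin // -EFinM lee_fin ger0_norm ?divr_ge0 ?ln_ge0 ?(ltW d_gt0) //.
rewrite ler_pdivrMr //.
have e2 : 0 < eps ^- 2 by rewrite invr_gt0 exprn_gt0.
have ln_r : ln r <= ln 3 + c * S s + 2 * ln (eps^-1).
  apply: (@le_trans _ _ (ln (3 * expR (c * S s) * eps ^- 2))).
    by rewrite ler_ln ?posrE // !mulr_gt0 ?expR_gt0.
  rewrite !lnM ?posrE ?mulr_gt0 ?expR_gt0 // expRK lerD2l.
  by rewrite -exprVn lnXn ?invr_gt0 // mulr_natl.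
have h1 := SC s s0; have h2 := lnC eps e01.
have h3 : ln 3 + C1 + C2 <= C3 by rewrite le_max lexx.
have h4 : C3 <= delta / 2 * (s%:R `^ sigma + eps `^ (- tau)).
  have -> : C3 = delta / 2 * D by rewrite /D; field; rewrite gt_eqF.
  by rewrite ler_wpM2l // divr_ge0 // ltW.
have : delta * (s%:R `^ sigma + eps `^ (- tau)) = delta / 4 * s%:R `^ sigma +
   delta / 4 * eps `^ (- tau) + (delta / 2 * (s%:R `^ sigma + eps `^ (- tau))) +
   delta / 4 * (s%:R `^ sigma + eps `^ (- tau)) by field.
have h5 : 0 <= delta / 4 * (s%:R `^ sigma + eps `^ (- tau)).
  by rewrite mulr_ge0 ?divr_ge0 ?(ltW delta0) ?(ltW d_gt0).
by move=> ->; lra.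
Qed.

Lemma WT_of_cvg : s%:R^-1 * S s @[s --> \oo] --> (0 : R) -> WT n.
Proof.
move=> cvgS; have : sigma_tau_WT 1 1 n.
  apply: sigma_tau_WT_of_cvg => //; move: cvgS.
  by under [X in _ -> X @ _ --> _]eq_fun do rewrite powRr1 //.
move=> h delta /h[M MP]; exists M => s eps s0 /[dup] e01 /andP[e0 _] Ms.
by have := MP s eps s0 e01 Ms; rewrite powRr1 // powR_inv1 // ltW.
Qed.

End tractability_bounds.

(** * Complexity of the weighted Hermite spaces *)

Section weighted_hermite_complexity.
Context {R : realType} (alpha : R) (gamma : nat -> R) (w : R -> nat -> R).
Variable H : forall s : nat, set (s.-tuple R -> R).
Arguments H : clear implicits.
Hypothesis alpha_gt1 : 1 < alpha.
Hypothesis gamma01 : forall j, 0 < gamma j <= 1.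
Hypothesis w_weight : is_fourier_weight alpha w.
Hypothesis H_space : forall s, (0 < s)%N ->
  is_hermite_space (@weight_prod R w gamma s) (H s).

Local Notation n s eps := (info_complexity (@weight_prod R w gamma s) (H s) eps).

Lemma weight_prod_ge0 s (k : s.-tuple nat) : 0 <= weight_prod w gamma k.
Proof.
have [C _ wP] := fourier_weight_bound alpha_gt1 w_weight.
by apply: prodr_ge0 => j _; have [_ + _] := wP _ (gamma01 j); apply.
Qed.

Lemma weight_prod_tuple0s s : weight_prod w gamma (tuple0s s) = 1.
Proof.
have [C _ wP] := fourier_weight_bound alpha_gt1 w_weight.
rewrite /weight_prod big1 // => j _; rewrite tnth_mktuple.
by have [-> _ _] := wP _ (gamma01 j).
Qed.

Lemma weight_prod_sum_le : exists2 c, 0 <= c & forall s,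
  (\esum_(k in setT) (@weight_prod R w gamma s k)%:E < +oo)%E /\
  abs_sum (@weight_prod R w gamma s) <= expR (c * \sum_(j < s) gamma j).
Proof.
have a1 : 1 < alpha * 1 by rewrite mulr1.
have [c c0 cP] := esum_weight_prod_powR alpha_gt1 w_weight ltr01 a1.
exists c => // s; have g1 j : gamma j `^ 1 = gamma j.
  by rewrite powRr1 //; case/andP: (gamma01 j) => /ltW.
have := cP _ gamma01 s; under eq_bigr do rewrite g1.
under eq_esum do rewrite powRr1 ?weight_prod_ge0 //.
move=> le; have fin := le_lt_trans le (ltry _); split=> //.
by rewrite -lee_fin ge0_abs_sumK //; exact: weight_prod_ge0.
Qed.

Lemma hermite_complexity_ge1 s eps : (0 < s)%N -> 0 < eps < 1 -> (1%:E <= n s eps)%E.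
Proof.
move=> s0 e01; have [c _ /(_ s)[fin _]] := weight_prod_sum_le.
exact: (info_complexity_ge1 (@weight_prod_ge0 s) (weight_prod_tuple0s s) fin
  (H_space s0) e01).
Qed.

Lemma hermite_complexity_le : exists2 c, 0 <= c & forall s eps, (0 < s)%N ->
  0 < eps < 1 -> (n s eps <= (3 * expR (c * \sum_(j < s) gamma j) * eps ^- 2)%:E)%E.
Proof.
have [c c0 cP] := weight_prod_sum_le; exists c => // s eps s0 e01.
have [fin le] := cP s.
apply: (info_complexity_mc (@weight_prod_ge0 s) (weight_prod_tuple0s s) fin
  (H_space s0) _ le e01).
rewrite -[leLHS]expR0 ler_expR mulr_ge0 // sumr_ge0 // => j _.
by case/andP: (gamma01 j) => /ltW.
Qed.

Lemma SPT_with_of_sum (p q : R) : 0 < p <= 1 -> p < q -> 1 < alpha * p ->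
  (\sum_(0 <= j <oo) (gamma j `^ p)%:E < +oo)%E ->
  SPT_with (fun s eps => n s eps) (2 * q).
Proof.
move=> /[dup] p01 /andP[p0 p1] pq ap fin.
have gam0 j : 0 < gamma j by case/andP: (gamma01 j).
have gam1 j : gamma j <= 1 by case/andP: (gamma01 j).
have [Gp GpP] := partial_sum_le fin.
have [G GP] := partial_sum_le (sum_powR_fin gam0 gam1 p1 fin).
have [c c0 cP] := weight_prod_sum_le.
have [d d0 dP] := esum_weight_prod_powR alpha_gt1 w_weight p0 ap.
have G0 : 0 <= G by have := GP 0; rewrite big_ord0.
have Gp0 : 0 <= Gp by have := GpP 0; rewrite big_ord0.
(* A single bound, independent of s, for both the sum of the weights and the sum of their p-th
   powers. *)
pose L := expR (c * G + d * Gp).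
have L1 : 1 <= L by rewrite -[leLHS]expR0 ler_expR addr_ge0 ?mulr_ge0.
have qp : 0 < q - p by rewrite subr_gt0.
have q0 : 0 < q by exact: lt_trans pq.
split; first by rewrite mulr_ge0 // ltW.
exists ((8 / (q - p) + 3) * L * 8^-1 `^ (- q)).
  by rewrite !mulr_ge0 ?powR_ge0 ?expR_ge0 // addr_ge0 // divr_ge0 // ltW.
move=> s eps s0 /[dup] e01 /andP[e0 _]; have [fin1 le1] := cP s.
have gam1E j : gamma j `^ 1 = gamma j by rewrite powRr1 // ltW.
have leL : abs_sum (@weight_prod R w gamma s) <= L.
  apply: (le_trans le1); rewrite ler_expR ler_wpDr ?mulr_ge0 // ler_wpM2l //.
  by have := GP s; under eq_bigr do rewrite gam1E.
have lepL : (\esum_(k in setT) (@weight_prod R w gamma s k `^ p)%:E <= L%:E)%E.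
  apply: (le_trans (dP _ gamma01 s)); rewrite lee_fin ler_expR.
  by rewrite ler_wpDl ?mulr_ge0 // ler_wpM2l.
apply: (le_trans (info_complexity_pow (@weight_prod_ge0 s) (weight_prod_tuple0s s)
  fin1 (H_space s0) p01 qp L1 leL lepL e01)).
rewrite lee_fin (_ : p + (q - p) = q); last by rewrite addrC subrK.
suff -> : (eps ^+ 2 / 8) `^ (- q) = 8^-1 `^ (- q) * eps `^ (- (2 * q)).
  by rewrite mulrA.
rewrite mulrC powRM ?invr_ge0 ?exprn_ge0 ?(ltW e0) //; congr (_ * _).
by rewrite -powR_mulrn ?(ltW e0) // -powRrM mulrN.
Qed.

(** The exponent being an infimum, it suffices to reach 2 q for every q above the maximum [q0],
    which is at most 1. As [info_complexity_pow] is limited to p <= 1, the case q >= 1 rests on the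
    exponent 2 of the one-phase bound. *)
Lemma SPT_exponent_le : (\sum_(0 <= j <oo) (gamma j)%:E < +oo)%E ->
  (SPT_exponent (fun s eps => n s eps) <=
    2%:E * maxe (alpha^-1)%:E (sum_exponent gamma))%E.
Proof.
move=> fin; have gam0 j : 0 < gamma j by case/andP: (gamma01 j).
have gam1 j : gamma j <= 1 by case/andP: (gamma01 j).
have alpha0 : 0 < alpha by exact: lt_trans alpha_gt1.
have ai0 : 0 < alpha^-1 by rewrite invr_gt0.
set r := maxe _ _.
have r_ge : ((alpha^-1)%:E <= r)%E by rewrite le_max lexx.
have r_ges : (sum_exponent gamma <= r)%E by rewrite le_max lexx orbT.
have r_le : (r <= 1%:E)%E.
  rewrite ge_max lee_fin invf_le1 // (ltW alpha_gt1) /=.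
  exact: sum_exponent_le1.
have rfin : r \is a fin_num.
  rewrite ge0_fin_numE ?(le_lt_trans r_le) ?ltry // (le_trans _ r_ge) //.
  by rewrite lee_fin ltW.
move: r_ge r_ges r_le; rewrite -(fineK rfin) !lee_fin; set q0 := fine r.
move=> q0_ge q0_ges q0_le; apply/lee_addgt0Pr => e e0.
rewrite -EFinM -EFinD; apply: ereal_inf_lbound.
exists (2 * (q0 + e / 2)); last by congr (_%:E); field.
have e2 : 0 < e / 2 by rewrite divr_gt0.
set q := q0 + e / 2; have q0q : q0 < q by rewrite ltrDl.
have [q1|q1] := leP 1 q.
  have [c c0 cP] := hermite_complexity_le.
  have [G GP] : exists G, forall s, \sum_(j < s) gamma j `^ 1 <= G.
    by apply: partial_sum_le; rewrite sum_powR1.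
  have [] := @SPT_of_bounded _ _ (fun s => \sum_(j < s) gamma j) c c0 cP G.
    by move=> s; have := GP s; under eq_bigr do rewrite powRr1 ?(ltW (gam0 _)) //.
  move=> _ [C C0 CP]; split; first by rewrite mulr_ge0 // (le_trans _ q1).
  exists C => // s eps s0 /[dup] e01 /andP[eps0 eps1].
  apply: (le_trans (CP s eps s0 e01)); rewrite lee_fin ler_wpM2l //.
  rewrite ger_powR ?eps0 ?(ltW eps1) // lerN2; lra.
(* Strictly above [q0], so that the p-th powers of gamma are summable and alpha p > 1; strictly
   below [q], to leave a margin q - p for the logarithm. *)
pose p := (q0 + q) / 2; have q0p : q0 < p by rewrite /p; lra.
have pq : p < q by rewrite /p; lra.
apply: (@SPT_with_of_sum p) => //.
- by rewrite (ltW (lt_trans pq q1)) andbT (lt_trans _ q0p) // (lt_le_trans ai0).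
- by rewrite mulrC -ltr_pdivrMr // mul1r (le_lt_trans q0_ge).
- by apply: sum_exponent_lt => //; rewrite (le_lt_trans q0_ges) // lte_fin.
Qed.

End weighted_hermite_complexity.

Theorem theorem24 (R : realType) (alpha : R) (gamma : nat -> R)
    (w : R -> nat -> R) (H : forall s : nat, set (s.-tuple R -> R))
    (alpha_gt1 : 1 < alpha)
    (gamma_le1 : gamma 0%N <= 1)
    (gamma_noninc : forall j, gamma j.+1 <= gamma j)
    (gamma_gt0 : forall j, 0 < gamma j)
    (w_weight : is_fourier_weight alpha w)
    (H_space : forall s, (0 < s)%N ->
       is_hermite_space (@weight_prod R w gamma s) (H s)) :
  let n s eps := info_complexity (@weight_prod R w gamma s) (H s) eps in
  [/\ [/\ (\sum_(0 <= j <oo) (gamma j)%:E < +oo)%E ->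
          SPT n /\
          (SPT_exponent n <=
             2%:E * maxe (alpha^-1)%:E (sum_exponent gamma))%E,
        (\sum_(0 <= j <oo) (gamma j)%:E < +oo)%E ->
          (sum_exponent gamma <= 1%:E)%E &
        (sum_exponent gamma < 1%:E)%E ->
          (\sum_(0 <= j <oo) (gamma j)%:E < +oo)%E],
      (limn_esup (fun s => ((ln s%:R)^-1 * \sum_(j < s) gamma j)%:E)
         < +oo)%E -> PT n,
      s%:R^-1 * (\sum_(j < s) gamma j) @[s --> \oo] --> (0 : R) -> WT n,
      forall sigma tau : R, 0 < sigma <= 1 -> 0 < tau ->
        (s%:R `^ sigma)^-1 * (\sum_(j < s) gamma j) @[s --> \oo] --> (0 : R) ->
        sigma_tau_WT sigma tau n &
      (forall sigma : R, 0 < sigma <= 1 ->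
        (s%:R `^ sigma)^-1 * (\sum_(j < s) gamma j) @[s --> \oo] --> (0 : R)) ->
        UWT n].
Proof.
move=> n.
have gamma1 j : gamma j <= 1 by elim: j => // j; exact: le_trans.
have gamma01 j : 0 < gamma j <= 1 by rewrite gamma_gt0 gamma1.
pose S s := \sum_(j < s) gamma j.
have S0 s : 0 <= S s by apply: sumr_ge0 => j _; exact: ltW.
have Sle s : S s <= s%:R.
  by rewrite -[s in leRHS]card_ord -sumr_const; exact: ler_sum.
have n_ge1 := hermite_complexity_ge1 alpha_gt1 gamma01 w_weight H_space.
have [c c0 n_le] := hermite_complexity_le alpha_gt1 gamma01 w_weight H_space.
have WTn (sigma tau : R) : 0 < sigma <= 1 -> 0 < tau ->
    (s%:R `^ sigma)^-1 * S s @[s --> \oo] --> (0 : R) -> sigma_tau_WT sigma tau n.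
  by move=> /andP[sigma0 _] tau0; exact: (sigma_tau_WT_of_cvg S0 Sle c0 n_ge1 n_le).
split.
- split.
  + move=> fin; split; last exact: SPT_exponent_le.
    have [G GP] : exists G, forall s, S s <= G.
      rewrite -(sum_powR1 gamma_gt0) in fin.
      have [G GP] := partial_sum_le fin; exists G => s; have := GP s.
      by under eq_bigr do rewrite powRr1 ?(ltW (gamma_gt0 _)) //.
    by exists 2; exact: (SPT_of_bounded c0 n_le GP).
  + exact: sum_exponent_le1.
  + by move=> /(sum_exponent_lt gamma_gt0 gamma1); rewrite sum_powR1.
- exact: (PT_of_limsup Sle c0 n_le).
- exact: (WT_of_cvg S0 Sle c0 n_ge1 n_le).
- exact: WTn.
- move=> cvgS sigma tau sigma01 /andP[tau0 _].
  by apply: WTn => //; exact: cvgS.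
Qed.
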